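(* Let $V$ be an operator space. Then $V$ has the operator approximation property if and only if for every operator space $W$ and every operator compact map $\varphi\in\mathcal{CB}(W,V)$, the map $\varphi$ can be approximated completely uniformly (i.e. in the completely bounded norm) by completely bounded finite rank maps in $\mathcal{CB}(W,V)$.
   Context: Operator spaces are abstract (matrix normed) operator spaces; $\mathcal{CB}(V,W)$ denotes the completely bounded maps with the cb-norm; for linear $\varphi$, $\varphi_n:M_n(V)\to M_n(W)$ is $[v_{ij}]\mapsto[\varphi(v_{ij})]$. $\mathcal{K}$ denotes the compact operators on $\ell^2$ and $\mathcal{K}(V)=\mathcal{K}\check{\otimes}V$ the operator-space minimal (spatial) tensor product, which is the completion of $M_\infty(V)$ (infinite matrices over $V$ with finitely many nonzero entries). $\mathcal{T}$ denotes the trace class operators on $\ell^2$ with its operator space structure as the dual of $\mathcal{K}$, so $M_k(\mathcal{T})\cong\mathcal{CB}(\mathcal{K},M_k)$ with norm $\|\cdot\|_{\mathcal{T}}$; $M_\infty\subseteq\mathcal{T}$. For $\sigma\in M_k(\mathcal{T})$ and $x\in\mathcal{K}(V)$, $(\sigma\otimes\mathrm{id})(x)\in M_k(V)$ is the slice map. A matrix set $\boldsymbol{K}=(K_n)$ in $V$ is a sequence of subsets $K_n\subseteq M_n(V)$; it is closed if each $K_n$ is closed. For $x\in\mathcal{K}(V)$, the absolutely matrix convex hull of $x$ is the matrix set whose $k$-th level is $\{(\sigma\otimes\mathrm{id})(x):\sigma\in M_k(M_\infty),\ \|\sigma\|_{\mathcal{T}}\le1\}$. A matrix set $\boldsymbol{K}$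 is operator compact if it is closed and there is $x\in\mathcal{K}(V)$ such that each $K_k$ is contained in the closure of the $k$-th level of the absolutely matrix convex hull of $x$. A map $\varphi\in\mathcal{CB}(W,V)$ is operator compact if the matrix image $(\varphi_n(B_n))_n$ of the matrix unit ball $(B_n)$ of $W$ ($B_n$ the closed unit ball of $M_n(W)$) is operator compact. A net $\varphi_\nu\to\varphi$ in $\mathcal{CB}(V,W)$ in the stable point-norm topology if $\mathrm{id}_{\mathcal{K}}\otimes\varphi_\nu\to\mathrm{id}_{\mathcal{K}}\otimes\varphi$ in the point-norm topology on $\mathcal{K}\check{\otimes}V\to\mathcal{K}\check{\otimes}W$. $V$ has the operator approximation property if the identity map of $V$ is a limit of completely bounded finite rank maps $V\to V$ in the stable point-norm topology. *)

(* Defs.v *)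
From HB Require Import structures.
From mathcomp Require Import all_boot all_order all_algebra.
From mathcomp Require Import classical_sets reals.
From mathcomp.real_closed Require Import complex.
Set Implicit Arguments. Unset Strict Implicit. Unset Printing Implicit Defensive.
Import Order.TTheory GRing.Theory Num.Theory.
Local Open Scope ring_scope.
Local Open Scope classical_set_scope.

Section OpSpaces.
Variable R : realType.
Local Notation C := R[i].

Definition cnorm (z : C) : R := let: Complex a b := z in Num.sqrt (a ^+ 2 + b ^+ 2).

Definition l2F (J : finType) (x : J -> C) : R := Num.sqrt (\sum_j cnorm (x j) ^+ 2).

Definition opnormF (I J : finType) (a : I -> J -> C) : R :=
  sup [set l2F (fun i => \sum_j a i j * x j) | x in [set x : J -> C | l2F x <= 1]].

Definition opnorm m n (a : 'M[C]_(m, n)) : R := opnormF (fun i j => a i j).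

Definition smulmx (V : lmodType C) m n (a : 'M[C]_(m, n)) (x : 'M[V]_n)
   (b : 'M[C]_(n, m)) : 'M[V]_m :=
  \matrix_(i, j) \sum_(k < n) \sum_(l < n) (a i k * b l j) *: x k l.

Definition mx1 (V : Type) (v : V) : 'M[V]_1 := \matrix_(i, j) v.

(** Abstract operator space (Ruan's axioms) on a complex vector space V with
    matrix norms mn n on M_n(V); complete (Banach) at level 1. *)
Definition opspace (V : lmodType C) (mn : forall n, 'M[V]_n -> R) : Prop :=
  [/\ [/\ (forall n (x : 'M[V]_n), 0 <= mn n x),
      (forall n (x : 'M[V]_n), mn n x = 0 -> x = 0),
      (forall n (x y : 'M[V]_n), mn n (x + y) <= mn n x + mn n y) &
      (forall n (c : C) (x : 'M[V]_n), mn n (map_mx (fun v => c *: v) x) = cnorm c * mn n x)],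
      (forall m n (x : 'M[V]_m) (y : 'M[V]_n),
          mn (m + n)%N (block_mx x 0 0 y) = Num.max (mn m x) (mn n y)),
      (forall m n (a : 'M[C]_(m, n)) (x : 'M[V]_n) (b : 'M[C]_(n, m)),
          mn m (smulmx a x b) <= opnorm a * mn n x * opnorm b)
    & (forall u : nat -> V,
          (forall e : R, 0 < e -> exists K, forall k l, (K <= k)%N -> (K <= l)%N ->
             mn 1%N (mx1 (u k - u l)) < e) ->
          exists v : V, forall e : R, 0 < e -> exists K, forall k, (K <= k)%N ->
             mn 1%N (mx1 (u k - v)) < e)].

Definition seq_cvg (u : nat -> R) (l : R) : Prop :=
  forall e : R, 0 < e -> exists K, forall k, (K <= k)%N -> `|u k - l| < e.

Definition fsupp (V : zmodType) (f : nat -> nat -> V) : Prop :=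
  exists N, forall i j, (N <= i)%N \/ (N <= j)%N -> f i j = 0.

Definition trunc (V : Type) N (f : nat -> nat -> V) : 'M[V]_N := \matrix_(i, j) f i j.

Definition infnorm (V : lmodType C) (mn : forall n, 'M[V]_n -> R)
  (f : nat -> nat -> V) : R := sup [set mn N (trunc N f) | N in [set: nat]].

(** Elements of K(V) = completion of M_infty(V): Cauchy sequences in M_infty(V) *)
Definition kelt (V : lmodType C) (mn : forall n, 'M[V]_n -> R)
  (x : nat -> nat -> nat -> V) : Prop :=
  (forall k, fsupp (x k)) /\
  (forall e : R, 0 < e -> exists K, forall k l, (K <= k)%N -> (K <= l)%N ->
      infnorm mn (fun i j => x k i j - x l i j) < e).

(** norm of an element of M_n(M_infty) (complex), as operator on l^2 *)
Definition minfnorm n (y : 'I_n -> 'I_n -> nat -> nat -> C) : R :=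
  sup [set opnormF (fun (pi : 'I_n * 'I_M) (qj : 'I_n * 'I_M) =>
                         y pi.1 qj.1 pi.2 qj.2) | M in [set: nat]].

(** trace-class norm of sigma in M_k(M_N) (subset M_k(T)) = cb norm of the
    induced map K -> M_k, y |-> [ <sigma_ab, y> ]_ab *)
Definition tnorm k N (s : 'I_k -> 'I_k -> 'M[C]_N) : R :=
  sup [set r | exists n (y : 'I_n -> 'I_n -> nat -> nat -> C),
     [/\ (forall p q, fsupp (y p q)), minfnorm y <= 1 &
       r = opnormF (fun (pa : 'I_n * 'I_k) (qb : 'I_n * 'I_k) =>
             \sum_(i < N) \sum_(j < N) s pa.2 qb.2 i j * y pa.1 qb.1 i j)]].

Definition slice (V : lmodType C) k N (s : 'I_k -> 'I_k -> 'M[C]_N)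
  (f : nat -> nat -> V) : 'M[V]_k :=
  \matrix_(a, b) \sum_(i < N) \sum_(j < N) s a b i j *: f i j.

Definition amchull (V : lmodType C) (mn : forall n, 'M[V]_n -> R)
  (x : nat -> nat -> nat -> V) k : set 'M[V]_k :=
  [set y | exists N (s : 'I_k -> 'I_k -> 'M[C]_N), tnorm s <= 1 /\
     (forall e : R, 0 < e -> exists K, forall l, (K <= l)%N ->
        mn k (slice s (x l) - y) < e)].

Arguments amchull [V] mn x k.

Definition mclosure (V : lmodType C) n (nrm : 'M[V]_n -> R) (S : set 'M[V]_n)
  : set 'M[V]_n :=
  [set y | forall e : R, 0 < e -> exists z, S z /\ nrm (y - z) < e].

Definition mclosed (V : lmodType C) n (nrm : 'M[V]_n -> R) (S : set 'M[V]_n) :=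
  mclosure nrm S `<=` S.

Definition op_compact_set (V : lmodType C) (mn : forall n, 'M[V]_n -> R)
  (Ks : forall n, set 'M[V]_n) : Prop :=
  (forall n, mclosed (mn n) (Ks n)) /\
  exists x, kelt mn x /\ forall k, Ks k `<=` mclosure (mn k) (amchull mn x k).

Definition cbmap (W V : lmodType C) (mnW : forall n, 'M[W]_n -> R)
  (mnV : forall n, 'M[V]_n -> R) (phi : W -> V) : Prop :=
  linear phi /\ exists M : R, forall n (w : 'M[W]_n), mnV n (map_mx phi w) <= M * mnW n w.

Definition cbnorm (W V : lmodType C) (mnW : forall n, 'M[W]_n -> R)
  (mnV : forall n, 'M[V]_n -> R) (phi : W -> V) : R :=
  sup [set r | exists n (w : 'M[W]_n), mnW n w <= 1 /\ r = mnV n (map_mx phi w)].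

Definition finrank (W V : lmodType C) (phi : W -> V) : Prop :=
  exists n (e : 'I_n -> V), forall w, exists c : 'I_n -> C, phi w = \sum_i c i *: e i.

Definition op_compact_map (W V : lmodType C) (mnW : forall n, 'M[W]_n -> R)
  (mnV : forall n, 'M[V]_n -> R) (phi : W -> V) : Prop :=
  op_compact_set mnV (fun n => [set map_mx phi w | w in [set w | mnW n w <= 1]]).

(** norm in K(V) of the image (id_K (x) psi)(x) of x in K(W) *)
Definition knorm_is (W V : lmodType C) (mnV : forall n, 'M[V]_n -> R)
  (psi : W -> V) (x : nat -> nat -> nat -> W) (l : R) : Prop :=
  seq_cvg (fun k => infnorm mnV (fun i j => psi (x k i j))) l.

(** Operator approximation property: id_V is a limit of a net of cb finite
    rank maps in the stable point-norm topology. *)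
Definition OAP (V : lmodType C) (mn : forall n, 'M[V]_n -> R) : Prop :=
  exists (D : Type) (le : D -> D -> Prop) (f : D -> V -> V),
    [/\ inhabited D, (forall d, le d d) /\
        (forall a b c, le a b -> le b c -> le a c),
        (forall a b, exists c, le a c /\ le b c),
        (forall d, cbmap mn mn (f d) /\ finrank (f d)) &
        (forall x, kelt mn x -> forall e : R, 0 < e -> exists d0, forall d, le d0 d ->
            exists l, knorm_is mn (fun v => f d v - v) x l /\ l < e)].

End OpSpaces.

(* Main.v *)
(** The key inequality is |(s (x) id) f| <= |s|_T |f| for matrices f over an
    abstract operator space.  A norming functional F turns it into a bound for
    the scalar array m = F_ab(f_ij), and Hahn-Banach on M_k x M_k gives positive
    forms l1, l2 with Re m(a, b) <= l1(a a^H) + l2(b b^H); factoring the two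
    forms as Gram matrices X, Y writes m as X y Y with y of norm at most 2, on
    which |s|_T can be tested.  So a finite rank map that is close to the
    identity at the element x defining a compact set is uniformly close to the
    identity on the whole set, which is the forward implication.

    Conversely, a subsequence of x in K(V) is a sum of blocks d_k whose norms
    decay fast.  The rescaled blocks z_k = 2^k d_k still tend to 0, so
    diag(z_0, z_1, ...) lies in K(V); let W be the gauge space of the closure of
    its absolutely matrix convex hull.  Its matrix unit balls are closed in V,
    so the inclusion W -> V is operator compact, and it is close in cb norm to a
    finite rank psi = sum psi_i (x) v_i.  Since the unit ball of W is closed in
    V, Helly's lemma replaces the functionals psi_i on W by functionals on V
    that are as bounded on W and agree approximately on finitely many vectors;
    the tail of x is small in K(W). *)

Require Import Defs.
From HB Require Import structures.
From mathcomp Require Import all_boot all_order all_algebra.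
From mathcomp Require Import boolp classical_sets reals.
From mathcomp.real_closed Require Import complex.
From mathcomp Require Import ring lra.
Set Implicit Arguments. Unset Strict Implicit. Unset Printing Implicit Defensive.
Import Order.TTheory GRing.Theory Num.Theory.
Local Open Scope ring_scope.
Local Open Scope classical_set_scope.

Local Notation "x %:C" := (real_complex _ x) : ring_scope.
Local Notation Re := complex.Re.

(** * Vectors and matrices indexed by finite types *)

Section Vectors.
Variable R : realType.
Local Notation C := R[i].

(** [V] is abstract and is never represented on a Hilbert space, so |s|_T, which is tested on scalar
    arrays only, can reach [V] only through a functional; this is why the scalar array m has to be
    factored. The bound 2 on y costs nothing in the end: the forms satisfy l1(1) + l2(1) <= c, the
    Hilbert-Schmidt norms u, v of the two outer factors satisfy u^2 = l1(1) and v^2 = l2(1) up to an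
    epsilon, and 2uv <= u^2 + v^2. In the converse the obstacle is that psi_i is bounded for the
    gauge norm but need not be for the norm of [V], so psi need not extend to [V]. Helly's
    replacements may have large norms on [V], which is harmless, but their bounds on W are those of
    psi_i, hence known before the finitely many vectors are chosen. So x can be cut into head and
    tail first: the common bounds make the tail small, and the head has finitely many nonzero
    entries, on which the functionals are matched. The increments are of order 4^-k: one factor 2^-k
    pays for the rescaling to z_k, the other makes z_k tend to 0. *)

Lemma eqW (x y : R) : x = y -> x <= y.
Proof. by move=> ->. Qed.

Lemma normc_cnorm (z : C) : `|z| = (cnorm z)%:C.
Proof. by case: z => a b; rewrite normc_def. Qed.

Lemma cnorm_ge0 (z : C) : 0 <= cnorm z.
Proof. by case: z => a b; apply: sqrtr_ge0. Qed.

Lemma cnormM (z w : C) : cnorm (z * w) = cnorm z * cnorm w.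
Proof. exact: (Normc.normcM z w). Qed.

Lemma cnormD (z w : C) : cnorm (z + w) <= cnorm z + cnorm w.
Proof. exact: (le_normcD z w). Qed.

Lemma cnorm0 : cnorm (0 : C) = 0.
Proof. exact: Normc.normc0. Qed.

Lemma cnorm1 : cnorm (1 : C) = 1.
Proof. exact: Normc.normc1. Qed.

Lemma cnormN (z : C) : cnorm (- z) = cnorm z.
Proof. exact: (normcN z). Qed.

Lemma cnorm_eq0 (z : C) : cnorm z = 0 -> z = 0.
Proof. exact: Normc.eq0_normc. Qed.

Lemma cnormV (z : C) : cnorm z^-1 = (cnorm z)^-1.
Proof. exact: (Normc.normcV z). Qed.

Lemma cnorm_real (r : R) : cnorm r%:C = `|r|.
Proof. by rewrite /= expr0n /= addr0 sqrtr_sqr. Qed.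

Lemma cnorm_nneg (r : R) : 0 <= r -> cnorm r%:C = r.
Proof. by move=> r0; rewrite cnorm_real ger0_norm. Qed.

Lemma cnormJ (z : C) : cnorm (conjc z) = cnorm z.
Proof. by case: z => a b /=; rewrite sqrrN. Qed.

Lemma cnorm_i : cnorm ('i%C : C) = 1.
Proof. by rewrite /= expr0n /= add0r expr1n sqrtr1. Qed.

Lemma mulc_conj (z : C) : z * conjc z = ((cnorm z ^+ 2 : R)%:C).
Proof. by rewrite rmorphXn /= -normc_cnorm sqr_normc. Qed.

Lemma Re_le_cnorm (z : C) : Re z <= cnorm z.
Proof.
have := normc_ge_Re z; rewrite normc_cnorm lecR => /(le_trans (ler_norm _)).
exact.
Qed.

Lemma Re_sum I (r : seq I) (P : pred I) (F : I -> C) :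
  Re (\sum_(i <- r | P i) F i) = \sum_(i <- r | P i) Re (F i).
Proof. by elim/big_rec2: _ => // i y x _ <-; case: (F i) x => a b [c d]. Qed.

Lemma cnorm_sum I (r : seq I) (P : pred I) (F : I -> C) :
  cnorm (\sum_(i <- r | P i) F i) <= \sum_(i <- r | P i) cnorm (F i).
Proof.
elim/big_rec2: _ => [|i y x _ le_xy]; first by rewrite cnorm0.
exact: le_trans (cnormD _ _) (lerD _ _).
Qed.

(** Rotations reduce moduli to real parts, which are all that a real Hahn-Banach functional
    controls. *)
Lemma phaseP (z : C) : exists u : C, cnorm u = 1 /\ u * z = (cnorm z)%:C.
Proof.
have [->|z0] := eqVneq z 0.
  by exists 1; rewrite cnorm1 mulr0 cnorm0.
have nz : cnorm z != 0 by apply: contra_neq z0; apply: cnorm_eq0.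
exists ((cnorm z)^-1%:C * conjc z); split.
  by rewrite cnormM cnormJ cnorm_nneg ?invr_ge0 ?cnorm_ge0 // mulVf.
by rewrite -mulrA [conjc z * z]mulrC mulc_conj -rmorphM /= expr2 mulKf.
Qed.

(** Lagrange's identity: the double sum of [(a i * b j - a j * b i) ^+ 2] is twice the difference of
    the two sides. *)
Lemma cauchy_schwarz_real (I : finType) (a b : I -> R) :
  (\sum_i a i * b i) ^+ 2 <= (\sum_i a i ^+ 2) * (\sum_i b i ^+ 2).
Proof.
have : 0 <= \sum_i \sum_j (a i * b j - a j * b i) ^+ 2.
  by apply: sumr_ge0 => i _; apply: sumr_ge0 => j _; apply: sqr_ge0.
have -> : \sum_i \sum_j (a i * b j - a j * b i) ^+ 2 =
  (\sum_i a i ^+ 2) * (\sum_i b i ^+ 2) + (\sum_i b i ^+ 2) * (\sum_i a i ^+ 2)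
  - ((\sum_i a i * b i) * (\sum_i a i * b i)) *+ 2.
  rewrite !big_distrlr /= -big_split -sumrMnl -sumrB /=; apply: eq_bigr => i _.
  rewrite -big_split -sumrMnl -sumrB /=; apply: eq_bigr => j _; ring.
rewrite expr2; lra.
Qed.

Section L2.
Variable J : finType.
Implicit Types x y : J -> C.

Lemma l2F_ge0 x : 0 <= l2F x.
Proof. exact: sqrtr_ge0. Qed.

Lemma sqr_l2F x : l2F x ^+ 2 = \sum_j cnorm (x j) ^+ 2.
Proof. by rewrite sqr_sqrtr // sumr_ge0 // => j _; rewrite sqr_ge0. Qed.

Lemma l2F_le x (M : R) : 0 <= M -> (l2F x <= M) = (\sum_j cnorm (x j) ^+ 2 <= M ^+ 2).
Proof.
by move=> M0; rewrite -sqr_l2F ler_pXn2r // nnegrE l2F_ge0.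
Qed.

Lemma cauchy_schwarz x y : cnorm (\sum_j x j * y j) <= l2F x * l2F y.
Proof.
apply: le_trans (cnorm_sum _ _ _) _.
under eq_bigr do rewrite cnormM.
rewrite -(@ler_pXn2r _ 2) ?nnegrE ?mulr_ge0 ?l2F_ge0 //; last first.
  by apply: sumr_ge0 => j _; rewrite mulr_ge0 ?cnorm_ge0.
by rewrite exprMn !sqr_l2F cauchy_schwarz_real.
Qed.

Lemma l2FZ (c : C) x : l2F (fun j => c * x j) = cnorm c * l2F x.
Proof.
apply/eqP; rewrite -(@eqrXn2 _ 2) ?mulr_ge0 ?l2F_ge0 ?cnorm_ge0 //.
rewrite exprMn !sqr_l2F mulr_sumr; apply/eqP/eq_bigr => j _.
by rewrite cnormM exprMn.
Qed.

Lemma l2FJ x : l2F (fun j => conjc (x j)) = l2F x.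
Proof. by congr Num.sqrt; apply: eq_bigr => j _; rewrite cnormJ. Qed.

Lemma eq_l2F x y : x =1 y -> l2F x = l2F y.
Proof. by move=> xy; congr Num.sqrt; apply: eq_bigr => j _; rewrite xy. Qed.

Lemma l2F_eq0 x j : l2F x = 0 -> x j = 0.
Proof.
move=> x0; have /eqP := sqr_l2F x; rewrite x0 expr0n /= eq_sym psumr_eq0; last first.
  by move=> i _; rewrite sqr_ge0.
by move=> /allP/(_ j (mem_index_enum _)); rewrite sqrf_eq0 => /eqP/cnorm_eq0.
Qed.

Lemma cnorm_le_l2F x j : cnorm (x j) <= l2F x.
Proof.
rewrite -(@ler_pXn2r _ 2) ?nnegrE ?cnorm_ge0 ?l2F_ge0 // sqr_l2F (bigD1 j) //=.
by rewrite lerDl sumr_ge0 // => i _; rewrite sqr_ge0.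
Qed.

Lemma l2F0 : l2F (fun _ : J => 0 : C) = 0.
Proof. by rewrite /l2F big1 ?sqrtr0 // => j _; rewrite cnorm0 expr0n. Qed.

Lemma l2F_dual_self x : \sum_j conjc (x j) * x j = (l2F x ^+ 2)%:C.
Proof.
by rewrite sqr_l2F rmorph_sum; apply: eq_bigr => j _; rewrite mulrC mulc_conj.
Qed.

End L2.

Definition fmulv (I J : finType) (a : I -> J -> C) (x : J -> C) : I -> C :=
  fun i => \sum_j a i j * x j.

(** Operator norm bounds are carried in this form, with an explicit constant, because it composes
    without suprema; [opnormF_le] and [opb_opnormF] translate to and from [opnormF]. *)
Definition opb (I J : finType) (a : I -> J -> C) (M : R) :=
  forall x, l2F (fmulv a x) <= M * l2F x.

(** Bilinear rather than sesquilinear, so that transposing the matrix exchanges the arguments and no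
    conjugates appear. *)
Definition bform (I J : finType) (a : I -> J -> C) (y : I -> C) (x : J -> C) : C :=
  \sum_i \sum_j y i * a i j * x j.

Lemma bformE (I J : finType) (a : I -> J -> C) y x :
  bform a y x = \sum_i y i * fmulv a x i.
Proof.
by apply: eq_bigr => i _; rewrite mulr_sumr; apply: eq_bigr => j _; rewrite mulrA.
Qed.

Lemma bformT (I J : finType) (a : I -> J -> C) y x :
  bform (fun j i => a i j) x y = bform a y x.
Proof.
rewrite /bform exchange_big; apply: eq_bigr => i _; apply: eq_bigr => j _ /=; ring.
Qed.

Lemma opb_bform (I J : finType) (a : I -> J -> C) M :
  0 <= M -> opb a M <-> forall y x, cnorm (bform a y x) <= M * l2F y * l2F x.
Proof.
move=> M0; split=> [aM y x | aM x].
  rewrite bformE (le_trans (cauchy_schwarz _ _)) // mulrAC [leLHS]mulrC.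
  by rewrite ler_wpM2r ?l2F_ge0.
(* Testing with the conjugate of [fmulv a x] gives its squared norm on the left; one factor is then
   cancelled. *)
have := aM (fun i => conjc (fmulv a x i)) x.
rewrite bformE l2F_dual_self cnorm_nneg ?sqr_ge0 // l2FJ.
set A := l2F _; have [->|A0] := eqVneq A 0; first by rewrite mulr_ge0 ?l2F_ge0.
rewrite mulrAC expr2 ler_pM2r // lt_neqAle eq_sym A0 l2F_ge0 //.
Qed.

Lemma opbT (I J : finType) (a : I -> J -> C) M :
  0 <= M -> opb a M -> opb (fun j i => a i j) M.
Proof.
move=> M0 /(opb_bform _ M0) aM; apply/(opb_bform _ M0) => y x.
by rewrite bformT mulrAC; apply: aM.
Qed.

Lemma opb_le (I J : finType) (a : I -> J -> C) M M' : opb a M -> M <= M' -> opb a M'.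
Proof. by move=> aM le x; apply: le_trans (aM x) (ler_wpM2r (l2F_ge0 _) le). Qed.

Lemma eq_opb (I J : finType) (a b : I -> J -> C) M :
  (forall i j, a i j = b i j) -> opb a M -> opb b M.
Proof.
move=> ab aM x; rewrite (@eq_l2F _ _ (fmulv a x)) // => i.
by apply: eq_bigr => j _; rewrite ab.
Qed.

Definition fmulm (I J K : finType) (a : I -> J -> C) (b : J -> K -> C) : I -> K -> C :=
  fun i k => \sum_j a i j * b j k.

Lemma fmulmv (I J K : finType) (a : I -> J -> C) (b : J -> K -> C) x i :
  fmulv (fmulm a b) x i = fmulv a (fmulv b x) i.
Proof.
rewrite /fmulv /fmulm; under eq_bigr do rewrite mulr_suml.
rewrite exchange_big; apply: eq_bigr => j _ /=; rewrite mulr_sumr.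
by apply: eq_bigr => k _; rewrite mulrA.
Qed.

Lemma opbM (I J K : finType) (a : I -> J -> C) (b : J -> K -> C) M N :
  0 <= M -> opb a M -> opb b N -> opb (fmulm a b) (M * N).
Proof.
move=> M0 aM bN x; rewrite (eq_l2F (fmulmv a b x)) (le_trans (aM _)) //.
by rewrite -mulrA ler_wpM2l.
Qed.

Lemma opbZ (I J : finType) (a : I -> J -> C) M c :
  opb a M -> opb (fun i j => c * a i j) (cnorm c * M).
Proof.
move=> aM x; rewrite (@eq_l2F _ _ (fun i => c * fmulv a x i)) => [|i].
  by rewrite l2FZ -mulrA ler_wpM2l ?cnorm_ge0.
by rewrite mulr_sumr; apply: eq_bigr => j _; rewrite mulrA.
Qed.

(** A crude bound, but enough to make the supremum in [opnormF] finite. *)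
Lemma opb_sum (I J : finType) (a : I -> J -> C) : opb a (\sum_i \sum_j cnorm (a i j)).
Proof.
have S0 : 0 <= \sum_i \sum_j cnorm (a i j).
  by apply: sumr_ge0 => i _; apply: sumr_ge0 => j _; apply: cnorm_ge0.
apply/opb_bform => // y x; rewrite (le_trans (cnorm_sum _ _ _)) // !mulr_suml.
apply: ler_sum => i _; rewrite (le_trans (cnorm_sum _ _ _)) // !mulr_suml.
apply: ler_sum => j _; rewrite !cnormM [cnorm (y i) * _]mulrC.
by rewrite !ler_pM ?mulr_ge0 ?cnorm_ge0 ?cnorm_le_l2F.
Qed.

Lemma opb0 (I J : finType) : opb (fun (_ : I) (_ : J) => 0 : C) 0.
Proof.
move=> x; rewrite (@eq_l2F _ _ (fun=> 0)) ?l2F0 ?mul0r // => i.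
by rewrite /fmulv big1 // => j _; rewrite mul0r.
Qed.

Section OpnormF.
Variables (I J : finType) (a : I -> J -> C).

Let S := [set l2F (fun i => \sum_j a i j * x j) | x in [set x : J -> C | l2F x <= 1]].

Let S_ub M : 0 <= M -> opb a M -> ubound S M.
Proof.
move=> M0 aM _ [x /= x1 <-]; apply: le_trans (aM x) _.
by rewrite -[leRHS]mulr1 ler_wpM2l.
Qed.

Let S_nonempty : S !=set0.
Proof. by exists (l2F (fun i => \sum_j a i j * 0)), (fun=> 0) => //=; rewrite l2F0. Qed.

Lemma opnormF_le M : 0 <= M -> opb a M -> opnormF a <= M.
Proof. by move=> M0 aM; apply: ge_sup => //; apply: S_ub. Qed.

Let S_bounded : has_ubound S.
Proof.
eexists; apply: (S_ub _ (opb_sum a)).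
by apply: sumr_ge0 => i _; apply: sumr_ge0 => j _; apply: cnorm_ge0.
Qed.

Lemma opnormF_ge0 : 0 <= opnormF a.
Proof.
have [r Sr] := S_nonempty.
apply: le_trans (ub_le_sup S_bounded Sr).
by case: Sr => x _ <-; apply: l2F_ge0.
Qed.

Lemma opb_opnormF : opb a (opnormF a).
Proof.
move=> x; have [x0|x0] := eqVneq (l2F x) 0.
  rewrite x0 mulr0 (@eq_l2F _ _ (fun=> 0)) ?l2F0 // => i.
  by rewrite /fmulv big1 // => j _; rewrite (l2F_eq0 j x0) mulr0.
have xp : 0 < l2F x by rewrite lt_neqAle eq_sym x0 l2F_ge0.
rewrite -ler_pdivrMr //.
apply: (ub_le_sup S_bounded); exists (fun j => (l2F x)^-1%:C * x j) => /=.
  by rewrite l2FZ cnorm_nneg ?invr_ge0 ?l2F_ge0 // mulVf.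
transitivity (l2F (fun i => (l2F x)^-1%:C * fmulv a x i)).
  apply: eq_l2F => i; rewrite /fmulv mulr_sumr; apply: eq_bigr => j _.
  by rewrite mulrCA.
by rewrite l2FZ cnorm_nneg ?invr_ge0 ?l2F_ge0 // mulrC.
Qed.

Lemma opnormF_leP M : opnormF a <= M -> opb a M.
Proof. exact: opb_le opb_opnormF. Qed.

End OpnormF.

Definition pmat (I J : finType) (g : I -> option J) : I -> J -> C :=
  fun i j => (g i == Some j)%:R.

Definition pinj (I J : finType) (g : I -> option J) :=
  forall i i' j, g i = Some j -> g i' = Some j -> i = i'.

Lemma sum_pmat (I J : finType) (g : I -> option J) (x : J -> C) i :
  \sum_j pmat g i j * x j = if g i is Some j then x j else 0.
Proof.
rewrite /pmat; case: (g i) => [j|]; last first.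
  by rewrite big1 // => j _; rewrite mul0r.
rewrite (bigD1 j) //= eqxx mul1r big1 ?addr0 // => j' j'j.
case: eqP => [[jj']|]; last by rewrite mul0r.
by rewrite jj' eqxx in j'j.
Qed.

(** Each coordinate [x j] is copied to at most one row, so the l2 norm cannot grow. *)
Lemma opb_pmat (I J : finType) (g : I -> option J) : pinj g -> opb (pmat g) 1.
Proof.
move=> g_inj x; rewrite mul1r l2F_le ?l2F_ge0 // sqr_l2F.
have E i : cnorm (fmulv (pmat g) x i) ^+ 2 =
    \sum_j (if g i == Some j then cnorm (x j) ^+ 2 else 0).
  rewrite /fmulv sum_pmat; case: (g i) => [j|]; last first.
    by rewrite cnorm0 expr0n /= big1.
  rewrite (bigD1 j) //= eqxx big1 ?addr0 // => j' j'j.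
  by case: eqP => // -[jj']; rewrite jj' eqxx in j'j.
under eq_bigr do rewrite E.
rewrite exchange_big /=; apply: ler_sum => j _.
case: (pickP (fun i => g i == Some j)) => [i /eqP gij|nj]; last first.
  by rewrite big1 ?sqr_ge0 // => i _; rewrite nj.
rewrite (bigD1 i) //= gij eqxx big1 ?addr0 // => i' i'i.
by case: eqP => // gi'j; rewrite (g_inj _ _ _ gi'j gij) eqxx in i'i.
Qed.

End Vectors.

(** * The Hahn-Banach and Mazur-Orlicz theorems *)

Section HahnBanach.
Variable R : realType.
Local Notation C := R[i].
Variable E : lmodType C.

(** Real scalars act through [r%:C], so a complex space is treated as a real one without a second
    module structure. *)
Definition sublinear (p : E -> R) :=
  (forall x y, p (x + y) <= p x + p y) /\
  (forall r x, 0 <= r -> p (r%:C *: x) = r * p x).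

Definition real_linear (l : E -> R) :=
  (forall x y, l (x + y) = l x + l y) /\ (forall r x, l (r%:C *: x) = r * l x).

Lemma sublinear0 p : sublinear p -> p 0 = 0.
Proof. by case=> _ /(_ 0 0 (lexx _)); rewrite scaler0 mul0r. Qed.

Lemma sublinearN p x : sublinear p -> - p (- x) <= p x.
Proof.
by move=> sp; have := sp.1 x (- x); rewrite subrr (sublinear0 sp); lra.
Qed.

Lemma le_infD (A B : set R) c : A !=set0 -> B !=set0 ->
  (forall a b, A a -> B b -> c <= a + b) -> c <= inf A + inf B.
Proof.
move=> A0 B0 cAB; rewrite addrC -lerBlDr; apply: lb_le_inf => // b Bb.
rewrite lerBlDr addrC -lerBlDr; apply: lb_le_inf => // a Aa.
by rewrite lerBlDr; apply: cAB.
Qed.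

Lemma sublinear_homog (p : E -> R) :
  p 0 = 0 -> (forall r x, 0 < r -> p (r%:C *: x) <= r * p x) ->
  forall r x, 0 <= r -> p (r%:C *: x) = r * p x.
Proof.
move=> p0 ple r x; rewrite le_eqVlt => /predU1P[<-|r0].
  by rewrite scale0r p0 mul0r.
apply/eqP; rewrite eq_le ple //=.
have := ple r^-1 (r%:C *: x); rewrite invr_gt0 => /(_ r0).
rewrite scalerA -rmorphM /= mulVf ?gt_eqF // scale1r => le_p.
by rewrite -ler_pdivlMl.
Qed.

Section Constrained.
Variables (p : E -> R) (S : E -> R -> Prop).
Hypotheses (sp : sublinear p) (S0 : S 0 0).
Hypothesis SD : forall e r e' r', S e r -> S e' r' -> S (e + e') (r + r').
Hypothesis SZ : forall t e r, 0 < t -> S e r -> S (t%:C *: e) (t * r).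
Hypothesis Sp : forall e r, S e r -> r <= p e.

Let A x := [set s | exists e r, S e r /\ s = p (x + e) - r].
Let q x := inf (A x).

Let A0 x : A x !=set0.
Proof. by exists (p (x + 0) - 0), 0, 0. Qed.

Let A_lb x : lbound (A x) (- p (- x)).
Proof.
move=> _ [e [r [/Sp re ->]]].
have := sp.1 (x + e) (- x); rewrite addrAC subrr add0r; lra.
Qed.

Let q_le x e r : S e r -> q x <= p (x + e) - r.
Proof. by move=> Ser; apply: ge_inf; [exists (- p (- x))|exists e, r]. Qed.

(** The infimum over [S] of [p (x + e) - r] is the largest sublinear minorant of [p] with
    [q (- e) <= - r]; [Sp] keeps it finite, since it bounds these values below by [- p (- x)]. *)
Lemma constrained_sublinear :
  exists q, [/\ sublinear q, forall x, q x <= p x & forall e r, S e r -> q (- e) <= - r].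
Proof.
exists q; split; last 2 first.
- by move=> x; have := q_le x S0; rewrite addr0 subr0.
- by move=> e r /(q_le (- e)); rewrite addNr (sublinear0 sp) sub0r.
have q0 : q 0 = 0.
  apply/eqP; rewrite eq_le; apply/andP; split.
    by have := q_le 0 S0; rewrite addr0 subr0 (sublinear0 sp).
  by apply: lb_le_inf => // s /A_lb; rewrite oppr0 (sublinear0 sp) oppr0.
split=> [x y|].
  apply: le_infD => // _ _ [e [r [Se ->]]] [e' [r' [Se' ->]]].
  apply: le_trans (q_le _ (SD Se Se')) _.
  have := sp.1 (x + e) (y + e'); rewrite addrACA; lra.
apply: sublinear_homog => // t x t0.
rewrite -ler_pdivrMl //; apply: lb_le_inf => // _ [e [r [Se ->]]].
rewrite ler_pdivrMl //; apply: le_trans (q_le _ (SZ t0 Se)) _.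
by rewrite -scalerDr (sp.2 _ _ (ltW t0)) mulrBr.
Qed.

End Constrained.

(* A minimal sublinear functional is linear: hence Hahn-Banach from Zorn's lemma. *)
Lemma minimal_sublinear p : sublinear p ->
  exists q, [/\ sublinear q, forall x, q x <= p x &
    forall q', sublinear q' -> (forall x, q' x <= q x) -> q' = q].
Proof.
move=> sp; pose T := {q | sublinear q /\ forall x, q x <= p x}.
(* The pointwise order reversed: a maximal element for [r] is a minimal sublinear functional. *)
pose r (s t : T) := `[< forall x, sval t x <= sval s x >].
have [||||[q [sq qp]] qmin] := @Zorn T r.
- by move=> t; apply/asboolP.
- move=> s t u /asboolP st /asboolP tu; apply/asboolP => x.
  exact: le_trans (tu x) (st x).
- move=> [s Ps] [t Pt] /asboolP /= st /asboolP /= ts; apply: eq_exist.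
  by apply/funext => x; apply/eqP; rewrite eq_le ts st.
- move=> A Atot; have [[t0 At0]|A0] := pselect (A !=set0); last first.
    exists (exist _ p (conj sp (fun x => lexx _))) => s As.
    by case: A0; exists s.
  pose B x := [set y | exists2 t, A t & y = sval t x].
  pose m x := inf (B x).
  have B0 x : B x !=set0 by exists (sval t0 x), t0.
  have Blb x : lbound (B x) (- p (- x)).
    move=> _ [[t [st tp]] _ ->] /=.
    by apply: le_trans (sublinearN x st); rewrite lerN2.
  have m_le x t : A t -> m x <= sval t x.
    by move=> At; apply: ge_inf; [exists (- p (- x)) | exists t].
  have sm : sublinear m.
    split=> [x y|].
      apply: le_infD => // _ _ [s As ->] [t At ->].
      (* An infimum of sublinear functionals is not subadditive in general; in a chain the smaller
         of the two serves both arguments. *)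
      case: (Atot _ _ As At) => /asboolP le_st.
        apply: le_trans (m_le _ _ At) _; apply: le_trans ((svalP t).1.1 x y) _.
        by rewrite lerD2r.
      apply: le_trans (m_le _ _ As) _; apply: le_trans ((svalP s).1.1 x y) _.
      by rewrite lerD2l.
    apply: sublinear_homog => [|c x c0].
      apply/eqP; rewrite eq_le; apply/andP; split.
        by apply: le_trans (m_le _ _ At0) _; rewrite (sublinear0 (svalP t0).1).
      by apply: lb_le_inf => // _ [t _ ->]; rewrite (sublinear0 (svalP t).1).
    rewrite -ler_pdivrMl //; apply: lb_le_inf => // _ [t At ->].
    by rewrite ler_pdivrMl // -((svalP t).1.2 _ _ (ltW c0)); apply: m_le.
  have mp x : m x <= p x by apply: le_trans (m_le _ _ At0) ((svalP t0).2 x).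
  by exists (exist _ m (conj sm mp)) => s As; apply/asboolP => x /=; apply: m_le.
exists q; split=> // q' sq' q'q.
have q'p x : q' x <= p x by apply: le_trans (q'q x) (qp x).
have := qmin (exist _ q' (conj sq' q'p)).
by move=> /(_ (introT (asboolP _) q'q)) [].
Qed.

Lemma hahn_banach p : sublinear p -> exists2 l, real_linear l & forall x, l x <= p x.
Proof.
move=> /minimal_sublinear[q [sq qp qmin]]; exists q => //.
have qN x : q (- x) = - q x.
  (* Constraining along the ray of [x] produces a sublinear [q'] below [q]; minimality identifies it
     with [q], whence [q (- x) <= - q x]. *)
  pose S (e : E) (r : R) := exists t : R, [/\ 0 <= t, e = t%:C *: x & r = t * q x].
  have [||||q' [sq' q'q q'S]] := @constrained_sublinear q S sq.
  - by exists 0; rewrite scale0r mul0r.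
  - move=> _ _ _ _ [t [t0 -> ->]] [t' [t'0 -> ->]]; exists (t + t').
    by rewrite addr_ge0 // rmorphD scalerDl mulrDl.
  - move=> t _ _ t0 [s [s0 -> ->]]; exists (t * s).
    by rewrite (mulr_ge0 (ltW t0) s0) scalerA -rmorphM mulrA.
  - by move=> _ _ [t [t0 -> ->]]; rewrite sq.2.
  have := q'S x (q x); rewrite (qmin _ sq' q'q) => qNx.
  apply/eqP; rewrite eq_le; apply/andP; split.
    by apply: qNx; exists 1; rewrite ler01 scale1r mul1r.
  by have := sublinearN (- x) sq; rewrite opprK.
split=> [x y|r x].
  apply/eqP; rewrite eq_le sq.1 /=.
  have := sq.1 (- x) (- y); rewrite -opprD !qN; lra.
have [r0|r0] := leP 0 r; first by rewrite sq.2.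
have := sq.2 (- r) x; rewrite rmorphN scaleNr qN oppr_ge0 mulNr => /(_ (ltW r0)).
exact: oppr_inj.
Qed.

(** A linear [l] below the constrained functional [q] has [- l e = l (- e) <= q (- e) <= - r], so
    Hahn-Banach for [q] suffices. *)
Theorem mazur_orlicz p (S : E -> R -> Prop) : sublinear p -> S 0 0 ->
  (forall e r e' r', S e r -> S e' r' -> S (e + e') (r + r')) ->
  (forall t e r, 0 < t -> S e r -> S (t%:C *: e) (t * r)) ->
  (forall e r, S e r -> r <= p e) ->
  exists l, [/\ real_linear l, forall x, l x <= p x & forall e r, S e r -> r <= l e].
Proof.
move=> sp S0 SD SZ Sp; have [q [sq qp qS]] := constrained_sublinear sp S0 SD SZ Sp.
have [l ll lq] := hahn_banach sq; exists l; split=> // [x|e r /qS].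
  exact: le_trans (lq x) (qp x).
move=> /(le_trans (lq _)).
by have := ll.2 (-1) e; rewrite rmorphN scaleN1r => ->; lra.
Qed.

Definition seminormC (p : E -> R) :=
  (forall x y, p (x + y) <= p x + p y) /\ (forall c x, p (c *: x) = cnorm c * p x).

Lemma seminormC_sublinear p : seminormC p -> sublinear p.
Proof. by case=> pD pZ; split=> // r x r0; rewrite pZ cnorm_nneg. Qed.

(** For real linear [l] this is the unique complex linear functional with real part [l]. *)
Definition complexify (l : E -> R) (x : E) : C := (l x)%:C - 'i%C * (l ('i%C *: x))%:C.

Lemma complexify_additive l : real_linear l ->
  {morph complexify l : x y / x + y >-> x + y}.
Proof.
by move=> ll x y; rewrite /complexify scalerDr !ll.1 !rmorphD /=; ring.
Qed.

Lemma Re_complexify l x : Re (complexify l x) = l x.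
Proof. by rewrite /complexify /=; ring. Qed.

Lemma complexifyZ l c x : real_linear l -> complexify l (c *: x) = c * complexify l x.
Proof.
move=> ll; have ii : 'i%C * 'i%C = -1 :> C by rewrite -expr2 sqr_i.
have iZ (y : E) : complexify l ('i%C *: y) = 'i%C * complexify l y.
  rewrite /complexify scalerA ii scaleN1r.
  have := ll.2 (-1) y; rewrite rmorphN scaleN1r => ->.
  rewrite mulrBr mulrA ii !mulN1r !rmorphN /=; ring.
have rZ r y : complexify l (r%:C *: y) = r%:C * complexify l y.
  rewrite /complexify scalerA ['i%C * r%:C]mulrC -scalerA !ll.2.
  rewrite !(rmorphM (real_complex R)) /=; ring.
rewrite [c]complexE scalerDl complexify_additive // -scalerA iZ !rZ.
by rewrite mulrDl mulrA.
Qed.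

Lemma cnorm_complexify_le p l x : seminormC p -> real_linear l -> (forall x, l x <= p x) ->
  cnorm (complexify l x) <= p x.
Proof.
move=> [pD pZ] ll lp; have [u [u1 ux]] := phaseP (complexify l x).
have := congr1 (@complex.Re R) ux; rewrite -complexifyZ // Re_complexify /= => <-.
by apply: le_trans (lp _) _; rewrite pZ u1 mul1r.
Qed.

Lemma hahn_banach_norming p x0 : seminormC p -> exists l : E -> C,
  [/\ {morph l : x y / x + y >-> x + y}, forall c x, l (c *: x) = c * l x,
      forall x, cnorm (l x) <= p x & p x0 <= cnorm (l x0)].
Proof.
move=> np; have sp := seminormC_sublinear np.
pose S (e : E) (r : R) := exists t : R, [/\ 0 <= t, e = t%:C *: x0 & r = t * p x0].
have [||||l [ll lp lS]] := @mazur_orlicz p S sp.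
- by exists 0; rewrite scale0r mul0r.
- move=> _ _ _ _ [t [t0 -> ->]] [t' [t'0 -> ->]]; exists (t + t').
  by rewrite addr_ge0 // rmorphD scalerDl mulrDl.
- move=> t _ _ t0 [s [s0 -> ->]]; exists (t * s).
  by rewrite (mulr_ge0 (ltW t0) s0) scalerA -rmorphM mulrA.
- by move=> _ _ [t [t0 -> ->]]; rewrite sp.2.
exists (complexify l); split.
- exact: complexify_additive.
- by move=> c x; apply: complexifyZ.
- by move=> x; apply: cnorm_complexify_le.
- apply: le_trans (Re_le_cnorm _); rewrite Re_complexify; apply: lS.
  by exists 1; rewrite ler01 scale1r mul1r.
Qed.

End HahnBanach.

(** * Compressions and rows of scalar matrices *)

Section Opb.
Variable R : realType.
Local Notation C := R[i].

Lemma opb_sub (I J I' J' : finType) (f : I' -> option I) (g : J' -> option J)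
    (a : I -> J -> C) M : 0 <= M -> pinj f -> pinj g -> opb a M ->
  opb (fun i j => if f i is Some i' then if g j is Some j' then a i' j' else 0 else 0) M.
Proof.
move=> M0 f_inj g_inj aM.
have := opbM ler01 (opb_pmat f_inj) (opbM M0 aM (opbT ler01 (opb_pmat g_inj))).
rewrite mulr1 mul1r; apply: eq_opb => i j.
rewrite /fmulm sum_pmat; case: (f i) => // i'.
by under eq_bigr do rewrite mulrC; rewrite sum_pmat.
Qed.

Lemma opb_row (J : finType) (y : J -> C) : opb (fun (_ : 'I_1) j => y j) (l2F y).
Proof.
move=> x; rewrite l2F_le ?mulr_ge0 ?l2F_ge0 // big_ord1.
by rewrite ler_pXn2r ?nnegrE ?cnorm_ge0 ?mulr_ge0 ?l2F_ge0 ?cauchy_schwarz.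
Qed.

Lemma opb_id (I : finType) : opb (fun i j : I => (i == j)%:R : C) 1.
Proof.
have : pinj (@Some I) by move=> i i' j [->] [].
by move=> /(@opb_pmat R); apply: eq_opb.
Qed.

End Opb.

(** * Matrix norms *)

Section OpSpace.
Variable R : realType.
Local Notation C := R[i].
Variables (V : lmodType C) (mn : forall n, 'M[V]_n -> R).
Hypothesis mnP : opspace mn.

Let mn_ge0 n (x : 'M[V]_n) : 0 <= mn x. Proof. by case: mnP => -[]. Qed.

(* Matrices indexed by an arbitrary finite type, transported along its
   enumeration; by Ruan's axioms the choice of enumeration is irrelevant. *)
Definition fF (I : finType) (x : I -> I -> V) : 'M[V]_#|I| :=
  \matrix_(i, j) x (enum_val i) (enum_val j).

Definition nF (I : finType) (x : I -> I -> V) : R := mn (fF x).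

Definition nrm (v : V) : R := mn (mx1 v).

Lemma mn_smul m n (a : 'I_m -> 'I_n -> C) (x : 'M[V]_n) (b : 'I_n -> 'I_m -> C) A B :
  0 <= A -> 0 <= B -> opb a A -> opb b B ->
  mn (\matrix_(i, j) \sum_k \sum_l (a i k * b l j) *: x k l) <= A * mn x * B.
Proof.
move=> A0 B0 aA bB.
have [_ _ /(_ _ _ (\matrix_(i, j) a i j) x (\matrix_(i, j) b i j)) ruan _] := mnP.
have opn (I J : nat) (c : 'I_I -> 'I_J -> C) D : 0 <= D -> opb c D ->
    opnorm (\matrix_(i, j) c i j) <= D.
  by move=> D0 cD; apply: opnormF_le => //; apply: eq_opb cD => i j; rewrite mxE.
have -> : \matrix_(i, j) (\sum_k \sum_l (a i k * b l j) *: x k l) =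
    smulmx (\matrix_(i, j) a i j) x (\matrix_(i, j) b i j).
  apply/matrixP => i j; rewrite !mxE; apply: eq_bigr => k _; apply: eq_bigr => l _.
  by rewrite !mxE.
apply: le_trans ruan _.
by rewrite !ler_pM ?mulr_ge0 ?opnormF_ge0 ?opn.
Qed.

Lemma nF_smul (I J : finType) (a : I -> J -> C) (x : J -> J -> V) (b : J -> I -> C) A B :
  0 <= A -> 0 <= B -> opb a A -> opb b B ->
  nF (fun i j => \sum_k \sum_l (a i k * b l j) *: x k l) <= A * nF x * B.
Proof.
move=> A0 B0 aA bB; pose a' (i : 'I_#|I|) (j : 'I_#|J|) := a (enum_val i) (enum_val j).
pose b' (i : 'I_#|J|) (j : 'I_#|I|) := b (enum_val i) (enum_val j).
have pe (K : finType) : @pinj 'I_#|K| K (fun i => Some (enum_val i)).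
  by move=> i i' j [<-] [/enum_val_inj].
have a'A : opb a' A by have := opb_sub A0 (@pe I) (@pe J) aA.
have b'B : opb b' B by have := opb_sub B0 (@pe J) (@pe I) bB.
have := mn_smul (fF x) A0 B0 a'A b'B; congr (_ <= _); congr mn.
apply/matrixP => i j; rewrite !mxE [RHS](reindex _ (onW_bij _ (@enum_val_bij J))) /=.
apply: eq_bigr => k _; rewrite [RHS](reindex _ (onW_bij _ (@enum_val_bij J))) /=.
by apply: eq_bigr => l _; rewrite mxE.
Qed.

Lemma sum_pmat_scale (I J : finType) (f g : I -> option J) (x : J -> J -> V) i j :
  \sum_k \sum_l (pmat R f i k * pmat R g j l) *: x k l =
  if f i is Some i' then if g j is Some j' then x i' j' else 0 else 0.
Proof.
rewrite /pmat; case: (f i) => [i'|]; last first.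
  by rewrite big1 // => k _; rewrite big1 // => l _; rewrite mul0r scale0r.
rewrite (bigD1 i') //= addrC big1 ?add0r; last first.
  move=> k ki'; rewrite big1 // => l _.
  by case: eqP => [[ik]|]; rewrite ?mul0r ?scale0r // ik eqxx in ki' *.
rewrite eqxx; case: (g j) => [j'|]; last first.
  by rewrite big1 // => l _; rewrite mulr0 scale0r.
rewrite (bigD1 j') //= eqxx mul1r scale1r addrC big1 ?add0r // => l lj'.
by case: eqP => [[jl]|]; rewrite ?mulr0 ?scale0r // jl eqxx in lj' *.
Qed.

(* Restriction, reindexing and padding by zeros are all compressions by
   partial injections. *)
Lemma nF_compress (I J : finType) (f g : I -> option J) (x : J -> J -> V) :
  pinj f -> pinj g ->
  nF (fun i j => if f i is Some i' then if g j is Some j' then x i' j' else 0 else 0)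
    <= nF x.
Proof.
move=> f_inj g_inj.
have := nF_smul x ler01 ler01 (opb_pmat f_inj) (opbT ler01 (opb_pmat g_inj)).
rewrite mulr1 mul1r; congr (nF _ <= _); apply/funext => i; apply/funext => j.
exact: sum_pmat_scale.
Qed.

Lemma mn_nF n (x : 'M[V]_n) : mn x = nF (fun i j => x i j).
Proof.
have pr : @pinj 'I_n 'I_#|'I_n| (fun i => Some (enum_rank i)).
  by move=> i i' j [<-] [/enum_rank_inj].
have pe : @pinj 'I_#|'I_n| 'I_n (fun i => Some (enum_val i)).
  by move=> i i' j [<-] [/enum_val_inj].
apply/eqP; rewrite eq_le; apply/andP; split.
  have := mn_smul (fF (fun i j => x i j)) ler01 ler01 (opb_pmat pr)
    (opbT ler01 (opb_pmat pr)).
  rewrite mulr1 mul1r; congr (mn _ <= _); apply/matrixP => i j.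
  by rewrite mxE [LHS](sum_pmat_scale _ _ (fF _)) !mxE !enum_rankK.
have := mn_smul x ler01 ler01 (opb_pmat pe) (opbT ler01 (opb_pmat pe)).
rewrite mulr1 mul1r; congr (mn _ <= _); apply/matrixP => i j.
by rewrite !mxE [LHS](sum_pmat_scale _ _ x).
Qed.

Lemma nF_ge0 (I : finType) (x : I -> I -> V) : 0 <= nF x.
Proof. exact: mn_ge0. Qed.

Lemma eq_nF (I : finType) (x y : I -> I -> V) : x =2 y -> nF x = nF y.
Proof. by move=> xy; congr nF; apply/funext => i; apply/funext => j. Qed.

Lemma nFD (I : finType) (x y : I -> I -> V) :
  nF (fun i j => x i j + y i j) <= nF x + nF y.
Proof.
have [[_ _ tri _] _ _ _] := mnP; have := tri _ (fF x) (fF y).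
by congr (mn _ <= _); apply/matrixP => i j; rewrite !mxE.
Qed.

Lemma nFZ (I : finType) c (x : I -> I -> V) :
  nF (fun i j => c *: x i j) = cnorm c * nF x.
Proof.
have [[_ _ _ hom] _ _ _] := mnP; rewrite /nF -hom.
by congr mn; apply/matrixP => i j; rewrite !mxE.
Qed.

Lemma nF0 (I : finType) : nF (fun _ _ : I => 0 : V) = 0.
Proof.
transitivity (nF (fun _ _ : I => (0 : C) *: (0 : V))).
  by apply: eq_nF => i j; rewrite scale0r.
by rewrite nFZ cnorm0 mul0r.
Qed.

Lemma nFN (I : finType) (x : I -> I -> V) : nF (fun i j => - x i j) = nF x.
Proof.
transitivity (nF (fun i j => (-1 : C) *: x i j)).
  by apply: eq_nF => i j; rewrite scaleN1r.
by rewrite nFZ cnormN cnorm1 mul1r.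
Qed.

Lemma nF_sum (I : finType) T (r : seq T) (P : pred T) (x : T -> I -> I -> V) :
  nF (fun i j => \sum_(t <- r | P t) x t i j) <= \sum_(t <- r | P t) nF (x t).
Proof.
elim: r => [|t r IHr].
  by rewrite big_nil -(nF0 I); apply/eqW/eq_nF => i j; rewrite big_nil.
rewrite big_cons; case: ifP => Pt; last first.
  by apply: le_trans IHr; apply/eqW/eq_nF => i j; rewrite big_cons Pt.
apply: le_trans (lerD (lexx _) IHr); apply: le_trans (nFD _ _); apply/eqW/eq_nF => i j.
by rewrite big_cons Pt.
Qed.

Lemma nrm_nF v : nrm v = nF (fun _ _ : 'I_1 => v).
Proof. by rewrite /nrm mn_nF; apply: eq_nF => i j; rewrite mxE. Qed.

Lemma nrm_ge0 v : 0 <= nrm v. Proof. exact: mn_ge0. Qed.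

Lemma nrmD v w : nrm (v + w) <= nrm v + nrm w.
Proof. by rewrite !nrm_nF; apply: nFD. Qed.

Lemma nrmZ c v : nrm (c *: v) = cnorm c * nrm v.
Proof. by rewrite !nrm_nF -nFZ. Qed.

Lemma nrm0 : nrm 0 = 0. Proof. by rewrite nrm_nF nF0. Qed.

Lemma nrmN v : nrm (- v) = nrm v.
Proof. by rewrite !nrm_nF; apply: nFN. Qed.

Lemma nrm_eq0 v : nrm v = 0 -> v = 0.
Proof.
have [[_ sep _ _] _ _ _] := mnP; move/sep/matrixP/(_ ord0 ord0).
by rewrite !mxE.
Qed.

Lemma nrm_sum T (r : seq T) (P : pred T) (x : T -> V) :
  nrm (\sum_(t <- r | P t) x t) <= \sum_(t <- r | P t) nrm (x t).
Proof.
rewrite nrm_nF (le_trans (nF_sum r P (fun t _ _ => x t))) //.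
by under eq_bigr do rewrite -nrm_nF.
Qed.

Lemma nrm_seminorm : seminormC nrm.
Proof. by split; [apply: nrmD|apply: nrmZ]. Qed.

Lemma nF_le_entries (I : finType) (x : I -> I -> V) : nF x <= \sum_i \sum_j nrm (x i j).
Proof.
have pd k : @pinj I 'I_1 (fun i => if i == k then Some ord0 else None).
  by move=> i i' j; case: eqP => // -> _; case: eqP => // ->.
have -> : nF x = nF (fun i' j' => \sum_i \sum_j
   (if i' == i then if j' == j then x i j else 0 else 0)).
  apply: eq_nF => i' j'; rewrite (bigD1 i') //= eqxx (bigD1 j') //= eqxx.
  rewrite big1 ?addr0 => [|j jj']; last by rewrite eq_sym (negPf jj').
  rewrite big1 ?addr0 // => i ii'; rewrite big1 // => j _.
  by rewrite eq_sym (negPf ii').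
apply: le_trans (nF_sum _ _ _) _; apply: ler_sum => i _.
apply: le_trans (nF_sum _ _ _) _; apply: ler_sum => j _.
rewrite nrm_nF; apply: le_trans (nF_compress _ (pd i) (pd j)).
by apply/eqW/eq_nF => i' j'; case: eqP => // _; case: eqP.
Qed.

Lemma nF_sum_type (I J : finType) (x : I -> I -> V) (y : J -> J -> V) :
  nF (fun s t : I + J => match s, t with
      | inl i, inl i' => x i i' | inr j, inr j' => y j j' | _, _ => 0 end)
    <= Num.max (nF x) (nF y).
Proof.
have [_ /(_ _ _ (fF x) (fF y)) <- _ _] := mnP; rewrite mn_nF.
pose f (s : I + J) := Some (match s with
  | inl i => lshift #|J| (enum_rank i) | inr j => rshift #|I| (enum_rank j) end).
have f_inj : pinj f.
  move=> s s' k /Some_inj <- /Some_inj/eqP; case: s => [i|j]; case: s' => [i'|j'].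
  - by rewrite eq_lshift => /eqP/enum_rank_inj ->.
  - by rewrite eq_rlshift.
  - by rewrite eq_lrshift.
  - by rewrite eq_rshift => /eqP/enum_rank_inj ->.
apply: le_trans (nF_compress _ f_inj f_inj); apply/eqW/eq_nF => -[i|j] [i'|j'] /=.
- by rewrite block_mxEul mxE !enum_rankK.
- by rewrite block_mxEur mxE.
- by rewrite block_mxEdl mxE.
- by rewrite block_mxEdr mxE !enum_rankK.
Qed.

(** Induction on the number of blocks: the direct sum axiom splits off the first one, along the
    identification [f] of ['I_r.+1 * J] with [J + 'I_r * J]. *)
Lemma nF_block r (J : finType) (x : 'I_r -> J -> J -> V) M :
  0 <= M -> (forall t, nF (x t) <= M) ->
  nF (fun p q : 'I_r * J => if p.1 == q.1 then x p.1 p.2 q.2 else 0) <= M.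
Proof.
move=> M0; elim: r x => [|r IHr] x xM.
  apply: le_trans (nF_le_entries _) _.
  by rewrite big1 ?M0 // => -[[]].
pose f (p : 'I_r.+1 * J) : option (J + 'I_r * J) :=
  Some (if unlift ord0 p.1 is Some t then inr (t, p.2) else inl p.2).
have f_inj : pinj f.
  move=> [t j] [t' j'] k [<-] [] /=.
  case: unliftP => [u ->|->]; case: unliftP => [u' ->|->] //.
    by move=> [-> ->].
  by move=> [->].
have := IHr (fun t => x (lift ord0 t)) (fun t => xM _).
set y := fun p q : 'I_r * J => _ => yM.
have := nF_compress (fun s t : J + 'I_r * J => match s, t with
      | inl i, inl i' => x ord0 i i' | inr j, inr j' => y j j' | _, _ => 0 end) f_inj f_inj.
move=> /le_trans/(_ (nF_sum_type (x ord0) y)) le1.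
have le2 : Num.max (nF (x ord0)) (nF y) <= M by rewrite ge_max xM.
apply: le_trans le2; apply: le_trans le1; apply/eqW/eq_nF => -[t j] [t' j'] /=.
case: unliftP => [u ->|->]; case: unliftP => [u' ->|->] //.
Qed.

Lemma nF_diag (I : finType) (v : V) :
  nF (fun i j : I => if i == j then v else 0) <= nrm v.
Proof.
pose f (i : I) := Some (enum_rank i, ord0 : 'I_1).
have f_inj : pinj f by move=> i i' j [<-] [/enum_rank_inj].
have := @nF_block #|I| _ (fun _ (_ _ : 'I_1) => v) (nrm v) (nrm_ge0 v).
rewrite -nrm_nF => /(_ (fun=> lexx _)); apply: le_trans.
apply: le_trans (nF_compress _ f_inj f_inj); apply/eqW/eq_nF => i j /=.
by rewrite (inj_eq enum_rank_inj).
Qed.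

(** The matrix is the product of [c] with the diagonal matrix of copies of [v], to which Ruan's
    axioms apply. *)
Lemma nF_rank1 (I : finType) (c : I -> I -> C) (v : V) M : 0 <= M -> opb c M ->
  nF (fun i j => c i j *: v) <= M * nrm v.
Proof.
move=> M0 cM.
have := nF_smul (fun i j : I => if i == j then v else 0) M0 ler01 cM (@opb_id R I).
rewrite mulr1 => /le_trans/(_ (ler_wpM2l M0 (nF_diag I v))); apply: le_trans.
apply/eqW/eq_nF => i j; rewrite [RHS](bigD1 j) //= [X in _ + X]big1 ?addr0; last first.
  move=> k kj; rewrite big1 // => l _; case: (l =P j) => [->|_].
    by rewrite (negPf kj) scaler0.
  by rewrite mulr0 scale0r.
rewrite (bigD1 j) //= !eqxx mulr1 big1 ?addr0 // => l lj.
by rewrite (negPf lj) mulr0 scale0r.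
Qed.

Definition bounded_functional (g : V -> C) M :=
  [/\ {morph g : x y / x + y >-> x + y}, forall c x, g (c *: x) = c * g x &
      forall x, cnorm (g x) <= M * nrm x].

Lemma functional0 (g : V -> C) M : bounded_functional g M -> g 0 = 0.
Proof. by case=> _ gZ _; have := gZ 0 0; rewrite scale0r mul0r. Qed.

Lemma functional_sum (g : V -> C) M T (r : seq T) (P : pred T) (x : T -> V) :
  bounded_functional g M ->
  g (\sum_(t <- r | P t) x t) = \sum_(t <- r | P t) g (x t).
Proof. by move=> gM; apply: (big_morph g _ (functional0 gM)); case: gM. Qed.

Lemma nrm_bilinear (I : finType) (x : I -> I -> V) (y z : I -> C) :
  nrm (\sum_i \sum_j (y i * z j) *: x i j) <= l2F y * nF x * l2F z.
Proof.
rewrite nrm_nF; apply: le_trans (nF_smul x (l2F_ge0 y) (l2F_ge0 z) (opb_row y)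
  (opbT (l2F_ge0 z) (opb_row z))).
by apply/eqW/eq_nF.
Qed.

(** Bounded functionals are completely bounded with the same constant: pairing [g (x i j)] with
    scalar vectors is [g] of a 1 by 1 compression of [x]. Hence only ordinary norms of functionals
    have to be controlled later. *)
Lemma functional_opb (g : V -> C) M (I : finType) (x : I -> I -> V) :
  0 <= M -> bounded_functional g M -> opb (fun i j => g (x i j)) (M * nF x).
Proof.
move=> M0 gM; apply/opb_bform; first by rewrite mulr_ge0 ?nF_ge0.
move=> y z; have [gD gZ gb] := gM.
have -> : bform (fun i j => g (x i j)) y z = g (\sum_i \sum_j (y i * z j) *: x i j).
  rewrite (functional_sum _ _ _ gM); apply: eq_bigr => i _.
  rewrite (functional_sum _ _ _ gM); apply: eq_bigr => j _.
  by rewrite gZ mulrAC.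
apply: le_trans (gb _) _; rewrite -!mulrA ler_wpM2l //.
by apply: le_trans (nrm_bilinear _ _ _) _; rewrite mulrCA mulrA.
Qed.

Lemma nF_rank1_functional (g : V -> C) M (I : finType) (x : I -> I -> V) (v : V) :
  0 <= M -> bounded_functional g M -> nF (fun i j => g (x i j) *: v) <= M * nF x * nrm v.
Proof.
move=> M0 gM; apply: nF_rank1; first by rewrite mulr_ge0 ?nF_ge0.
exact: functional_opb.
Qed.

Definition trunc_norm N (f : nat -> nat -> V) : R := nF (fun i j : 'I_N => f i j).

Lemma mn_trunc N f : mn (trunc N f) = trunc_norm N f.
Proof. by rewrite mn_nF; apply: eq_nF => i j; rewrite mxE. Qed.

Lemma infnorm_le f M : (forall N, trunc_norm N f <= M) -> infnorm mn f <= M.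
Proof.
move=> fM; apply: ge_sup; first by exists (mn (trunc 0 f)), 0%N.
by move=> _ [N _ <-]; rewrite mn_trunc.
Qed.

Definition supp_in N (f : nat -> nat -> V) :=
  forall i j, (N <= i)%N \/ (N <= j)%N -> f i j = 0.

Lemma trunc_norm_supp N M f : supp_in N f -> trunc_norm M f <= trunc_norm N f.
Proof.
move=> fN; pose g (i : 'I_M) : option 'I_N := insub (i : nat).
have g_inj : pinj g.
  move=> i i' j; rewrite /g; case: insubP => // u _ ui [<-].
  by case: insubP => // u' _ ui' [uu']; apply/val_inj; rewrite /= -ui -ui' uu'.
apply: le_trans (nF_compress _ g_inj g_inj); apply/eqW/eq_nF => i j; rewrite /g.
case: insubP => [u _ ->|]; last by rewrite -leqNgt => Ni; apply: fN; left.
by case: insubP => [u' _ ->|] //; rewrite -leqNgt => Nj; apply: fN; right.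
Qed.

Lemma le_infnorm N f : fsupp f -> trunc_norm N f <= infnorm mn f.
Proof.
move=> [K fK]; rewrite -mn_trunc; apply: ub_le_sup; last by exists N.
by exists (trunc_norm K f) => _ [M _ <-]; rewrite mn_trunc; apply: trunc_norm_supp.
Qed.

Lemma eq_trunc_norm N f g :
  (forall i j, (i < N)%N -> (j < N)%N -> f i j = g i j) ->
  trunc_norm N f = trunc_norm N g.
Proof. by move=> fg; apply: eq_nF => i j; apply: fg. Qed.

Lemma trunc_normD N f g :
  trunc_norm N (fun i j => f i j + g i j) <= trunc_norm N f + trunc_norm N g.
Proof. exact: nFD. Qed.

Lemma trunc_normB N f g :
  trunc_norm N (fun i j => f i j - g i j) <= trunc_norm N f + trunc_norm N g.
Proof. by apply: le_trans (nFD _ _) _; rewrite nFN. Qed.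

End OpSpace.

(** * Finitely supported infinite matrices *)

Section FiniteSupport.
Variables (V : zmodType).
Implicit Types f g : nat -> nat -> V.

Lemma fsuppD f g : fsupp f -> fsupp g -> fsupp (fun i j => f i j + g i j).
Proof.
move=> [N fN] [M gM]; exists (maxn N M) => i j; rewrite !geq_max.
by case=> /andP[le1 le2]; rewrite ?fN ?gM ?addr0 //; [left|left|right|right].
Qed.

Lemma fsupp_map (W : zmodType) (h : V -> W) f : h 0 = 0 -> fsupp f ->
  fsupp (fun i j => h (f i j)).
Proof. by move=> h0 [N fN]; exists N => i j /fN ->. Qed.

Lemma fsuppB f g : fsupp f -> fsupp g -> fsupp (fun i j => f i j - g i j).
Proof. by move=> fs /(fsupp_map (oppr0 V)); apply: fsuppD. Qed.

End FiniteSupport.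

(** * The trace class norm and slice maps *)

Section TraceNorm.
Variable R : realType.
Local Notation C := R[i].

Lemma opb_bigsum (I J : finType) T (r : seq T) (a : T -> I -> J -> C) (M : T -> R) :
  (forall t, 0 <= M t) -> (forall t, opb (a t) (M t)) ->
  opb (fun i j => \sum_(t <- r) a t i j) (\sum_(t <- r) M t).
Proof.
move=> M0 aM; apply/opb_bform; first exact: sumr_ge0.
move=> y x; have -> : bform (fun i j => \sum_(t <- r) a t i j) y x =
    \sum_(t <- r) bform (a t) y x.
  rewrite exchange_big /=; apply: eq_bigr => i _.
  rewrite exchange_big /=; apply: eq_bigr => j _.
  by rewrite mulr_sumr mulr_suml.
rewrite (le_trans (cnorm_sum _ _ _)) // !mulr_suml; apply: ler_sum => t _.
by move: (aM t) => /(opb_bform _ (M0 t)).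
Qed.

Lemma conjCE (z : C) : Num.conj z = conjc z.
Proof. by []. Qed.

Definition qform n (H : 'M[C]_n) (xi : 'I_n -> C) : C :=
  \sum_a \sum_b xi a * conjc (xi b) * H a b.

(** The spectral theorem gives H = P^-1 D P with [P] unitary and D positive; X is D^(1/2) times the
    entrywise conjugate of [P], conjugated because [qform] conjugates its second vector. *)
Lemma gram_factor n (H : 'M[C]_n) :
  (forall a b, H b a = conjc (H a b)) ->
  (forall xi, 0 < l2F xi -> 0 < Re (qform H xi)) ->
  exists X Y : 'M[C]_n, Y *m X = 1%:M /\ X *m Y = 1%:M /\
    forall xi : 'I_n -> C, Re (qform H xi) = l2F (fmulv X xi) ^+ 2.
Proof.
move=> Hsym Hpos; set P := spectralmx H; set sp := spectral_diag H.
have hermH : H \is hermsymmx.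
  apply/is_hermitianmxP; rewrite expr0 scale1r; apply/matrixP => a b.
  by rewrite !mxE conjCE -Hsym.
have HE : H = invmx P *m diag_mx sp *m P.
  by apply/orthomx_spectralP/hermitian_normalmx.
have /mxOverP spR := hermitian_spectral_diag_real hermH.
have Pu : P \is unitarymx by apply: spectral_unitarymx.
have Hab a b : H a b = \sum_i sp 0 i * (conjc (P i a) * P i b).
  rewrite {1}HE invmx_unitary // mul_mx_diag mxE; apply: eq_bigr => i _.
  by rewrite !mxE conjCE mulrAC mulrC.
pose r i := Re (sp 0 i).
have spE i : sp 0 i = (r i)%:C by rewrite RRe_real.
have qE xi : qform H xi =
    \sum_i (r i * cnorm (\sum_a conjc (P i a) * xi a) ^+ 2)%:C.
  rewrite /qform; under eq_bigr do under eq_bigr do rewrite Hab mulr_sumr.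
  under eq_bigr do rewrite exchange_big /=.
  rewrite exchange_big /=; apply: eq_bigr => i _.
  rewrite rmorphM /= -mulc_conj rmorph_sum big_distrlr mulr_sumr /=.
  apply: eq_bigr => a _; rewrite mulr_sumr; apply: eq_bigr => b _.
  by rewrite spE rmorphM /= conjcK; ring.
have PP i j : \sum_a P i a * conjc (P j a) = (i == j)%:R.
  have /unitarymxP/matrixP/(_ i j) := Pu; rewrite !mxE => <-.
  by apply: eq_bigr => a _; rewrite !mxE conjCE.
have PP' i j : \sum_a conjc (P j a) * P i a = (i == j)%:R.
  by rewrite -PP; apply: eq_bigr => a _; rewrite mulrC.
(* The eigenvalue [r i] is the value of the form at row [i] of [P], a nonzero vector. *)
have r_gt0 i : 0 < r i.
  have Re_q : Re (qform H (fun a => P i a)) = r i.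
    rewrite qE Re_sum (bigD1 i) //= [X in _ + X]big1 ?addr0 => [|j ji].
      by rewrite PP' eqxx cnorm1 expr1n mulr1.
    by rewrite PP' eq_sym (negPf ji) cnorm0 expr0n mulr0.
  rewrite -Re_q; apply: Hpos; rewrite lt_neqAle l2F_ge0 andbT eq_sym.
  apply/eqP => P0; have := PP i i; rewrite eqxx big1 => [/eqP|a _].
    by rewrite eq_sym oner_eq0.
  by rewrite (l2F_eq0 a P0) mul0r.
pose X := \matrix_(i, a) ((Num.sqrt (r i))%:C * conjc (P i a)).
pose Y := \matrix_(a, i) (P i a * (Num.sqrt (r i))^-1%:C).
have XY : X *m Y = 1%:M.
  apply/matrixP => i j; rewrite !mxE.
  under eq_bigr do rewrite !mxE mulrCA -mulrA mulrC [conjc _ * _]mulrC -!mulrA.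
  rewrite -(mulr1 (i == j)%:R).
  transitivity (\sum_a (P j a * conjc (P i a)) * ((Num.sqrt (r i))%:C * (Num.sqrt (r j))^-1%:C)).
    by apply: eq_bigr => a _; ring.
  rewrite -mulr_suml PP eq_sym; case: eqP => [->|_]; last by rewrite !mul0r.
  by rewrite -rmorphM /= divff // gt_eqF // sqrtr_gt0.
exists X, Y; split; first exact: mulmx1C.
split=> // xi; rewrite sqr_l2F qE Re_sum; apply: eq_bigr => i _ /=.
have -> : fmulv X xi i = (Num.sqrt (r i))%:C * \sum_a conjc (P i a) * xi a.
  by rewrite mulr_sumr; apply: eq_bigr => a _; rewrite mxE mulrA.
by rewrite cnormM exprMn cnorm_nneg ?sqrtr_ge0 // sqr_sqrtr // ltW.
Qed.


Section Factorization.
Variables (k N : nat) (m : 'I_k -> 'I_k -> 'I_N -> 'I_N -> C).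

Definition mpair (I J : finType) (m : 'I_k -> 'I_k -> I -> J -> C)
    (a : 'I_k -> I -> C) (b : 'I_k -> J -> C) : C :=
  \sum_p \sum_q \sum_i \sum_j a p i * b q j * m p q i j.

Definition outer (I : finType) (a : 'I_k -> I -> C) : 'M[C]_k :=
  \matrix_(p, q) \sum_i a p i * conjc (a q i).

(** The C*-identity |A|^2 = |A A^H| for the flat matrix A made of all the [a t] side by side, whose
    A A^H is the sum of the [outer (a t)]. *)
Lemma outer_qform_opb (T I : finType) (a : T -> 'I_k -> I -> C) :
  opb (fun p (ti : T * I) => a ti.1 p ti.2)
    (Num.sqrt (opnorm (\sum_t outer (a t)))).
Proof.
set X := \sum_t _; set M := Num.sqrt _.
have M0 : 0 <= M by apply: sqrtr_ge0.
have X0 : 0 <= opnorm X by apply: opnormF_ge0.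
have M2 : M ^+ 2 = opnorm X by rewrite sqr_sqrtr.
apply: (@opbT _ _ _ (fun ti p => a ti.1 p ti.2)) => // y.
rewrite -(@ler_pXn2r _ 2) ?nnegrE ?mulr_ge0 ?l2F_ge0 //.
rewrite exprMn M2 [leLHS]sqr_l2F.
have := (opb_bform (fun i j => X i j) X0).1 (opb_opnormF _) y (fun j => conjc (y j)).
rewrite l2FJ -mulrA -expr2; apply: le_trans.
apply: le_trans (Re_le_cnorm _); apply/eqW.
transitivity (Re (\sum_(ti : T * I) fmulv (fun ti p => a ti.1 p ti.2) y ti *
   conjc (fmulv (fun ti p => a ti.1 p ti.2) y ti))).
  by rewrite Re_sum; apply: eq_bigr => ti _; rewrite mulc_conj.
congr Re; rewrite -(pair_bigA _ (fun t i =>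
  fmulv (fun ti p => a ti.1 p ti.2) y (t, i) *
   conjc (fmulv (fun ti p => a ti.1 p ti.2) y (t, i)))) /=.
transitivity (\sum_t \sum_p \sum_q y p * outer (a t) p q * conjc (y q)); last first.
  rewrite exchange_big; apply: eq_bigr => p _; rewrite exchange_big; apply: eq_bigr => q _.
  by rewrite /X summxE mulr_sumr mulr_suml.
apply: eq_bigr => t _; rewrite /fmulv /=.
under eq_bigr do rewrite rmorph_sum big_distrlr.
rewrite exchange_big; apply: eq_bigr => p _; rewrite exchange_big; apply: eq_bigr => q _.
rewrite mxE mulr_sumr mulr_suml; apply: eq_bigr => i _.
by rewrite rmorphM /=; ring.
Qed.

Variable c : R.
Hypothesis c0 : 0 <= c.
(** Arbitrarily many pairs enter at once, flattened to two rectangular matrices, because the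
    Mazur-Orlicz argument needs a bound on sums of pairs. In [slice_le] it holds with [c] the norm
    of the truncated matrix. *)
Hypothesis mc : forall r (a b : 'I_r -> 'I_k -> 'I_N -> C) A B, 0 <= A -> 0 <= B ->
  opb (fun p (ti : 'I_r * 'I_N) => a ti.1 p ti.2) A ->
  opb (fun p (ti : 'I_r * 'I_N) => b ti.1 p ti.2) B ->
  cnorm (\sum_t mpair m (a t) (b t)) <= c * A * B.

Local Notation coef := (('I_k -> 'I_N -> C) * ('I_k -> 'I_N -> C))%type.
Local Notation E := ('M[C]_k * 'M[C]_k)%type.

(** The maximum, not the sum: its value at the pair of identity matrices is at most [c], which
    becomes the bound on [l1 1%:M + l2 1%:M]. *)
Definition opnorm2 (x : E) : R := c * Num.max (opnorm x.1) (opnorm x.2).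

Lemma opnormD n (x y : 'M[C]_n) : opnorm (x + y) <= opnorm x + opnorm y.
Proof.
apply: opnormF_le; first by rewrite addr_ge0 ?opnormF_ge0.
have := @opb_bigsum _ _ bool [:: true; false]
  (fun t i j => (if t then x else y) i j) (fun t => opnorm (if t then x else y)).
rewrite !big_cons !big_nil addr0 => H.
apply: eq_opb (H _ _) => [i j|t|t].
- by rewrite !big_cons big_nil mxE addr0.
- exact: opnormF_ge0.
- exact: opb_opnormF.
Qed.

Lemma opnormZ_le n (x : 'M[C]_n) t : opnorm (t *: x) <= cnorm t * opnorm x.
Proof.
apply: opnormF_le; first by rewrite mulr_ge0 ?opnormF_ge0 ?cnorm_ge0.
have xx : opb (fun i j => x i j) (opnorm x) by apply: opb_opnormF.
by apply: eq_opb (opbZ t xx) => i j; rewrite mxE.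
Qed.

Lemma opnorm0 n : opnorm (0 : 'M[C]_n) = 0.
Proof.
apply/eqP; rewrite eq_le opnormF_ge0 andbT; apply: opnormF_le => //.
by apply: eq_opb (@opb0 R _ _) => i j; rewrite mxE.
Qed.

Lemma opnorm2_sublinear : sublinear opnorm2.
Proof.
split=> [x y|].
  rewrite /opnorm2 -mulrDr ler_wpM2l // ge_max.
  have le1 : opnorm (x.1 + y.1) <= opnorm x.1 + opnorm y.1 by apply: opnormD.
  have le2 : opnorm (x.2 + y.2) <= opnorm x.2 + opnorm y.2 by apply: opnormD.
  apply/andP; split.
    by apply: le_trans le1 _; apply: lerD; rewrite le_max lexx.
  by apply: le_trans le2 _; apply: lerD; rewrite le_max lexx orbT.
apply: sublinear_homog => [|t x t0].
  by rewrite /opnorm2 !opnorm0 maxxx mulr0.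
have ct : cnorm t%:C = t by rewrite cnorm_nneg ?ltW.
rewrite /opnorm2; set M := Num.max (opnorm x.1) _.
have -> : t * (c * M) = c * (t * M) by ring.
have le1 : opnorm (t%:C *: x).1 <= t * M.
  apply: le_trans (opnormZ_le x.1 t%:C) _; rewrite ct.
  by apply: (ler_wpM2l (ltW t0)); rewrite le_max lexx.
have le2 : opnorm (t%:C *: x).2 <= t * M.
  apply: le_trans (opnormZ_le x.2 t%:C) _; rewrite ct.
  by apply: (ler_wpM2l (ltW t0)); rewrite le_max lexx orbT.
apply: (ler_wpM2l c0); rewrite ge_max; apply/andP.
by split; [exact: le1 | exact: le2].
Qed.

Definition fam_form (e : E) (r : R) := exists l : seq coef,
  e = (\sum_(g <- l) outer g.1, \sum_(g <- l) outer g.2) /\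
  r = \sum_(g <- l) Re (mpair m g.1 g.2).

(** By [outer_qform_opb], [mc] bounds the real part by [c] times the geometric mean of the two
    norms, which is at most their maximum. *)
Lemma fam_form_le e r : fam_form e r -> r <= opnorm2 e.
Proof.
move=> [l [-> ->]]; rewrite /opnorm2 /= !(big_tnth _ _ l).
rewrite -Re_sum; apply: le_trans (Re_le_cnorm _) _.
pose a (t : 'I_(size l)) := (tnth (in_tuple l) t).1.
pose b (t : 'I_(size l)) := (tnth (in_tuple l) t).2.
have := mc (sqrtr_ge0 _) (sqrtr_ge0 _) (outer_qform_opb a) (outer_qform_opb b).
move=> /le_trans -> //; rewrite -mulrA ler_wpM2l //.
set x := opnorm _; set y := opnorm _.
have x0 : 0 <= x by apply: opnormF_ge0.
have y0 : 0 <= y by apply: opnormF_ge0.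
set z := Num.max x y.
rewrite -(sqr_sqrtr (_ : 0 <= z)) ?le_max ?x0 // expr2.
by rewrite !ler_pM ?sqrtr_ge0 // ler_sqrt // ?le_max ?x0 ?lexx ?orbT.
Qed.

Lemma outer_scale t (a : 'I_k -> 'I_N -> C) : 0 <= t ->
  outer (fun p i => (Num.sqrt t)%:C * a p i) = t%:C *: outer a.
Proof.
move=> t0; apply/matrixP => p q; rewrite !mxE mulr_sumr; apply: eq_bigr => i _.
have := sqr_sqrtr t0; move: (Num.sqrt t) => s <-.
rewrite rmorphXn [conjc (_ * _)]rmorphM.
have -> : (conjc : {rmorphism C -> C}) s%:C = s%:C := conjc_real s.
by rewrite /=; ring.
Qed.

Lemma mpair_scale t (a b : 'I_k -> 'I_N -> C) : 0 <= t ->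
  mpair m (fun p i => (Num.sqrt t)%:C * a p i) (fun p i => (Num.sqrt t)%:C * b p i)
    = t%:C * mpair m a b.
Proof.
move=> t0; rewrite /mpair !mulr_sumr.
apply: eq_bigr => p _; rewrite mulr_sumr; apply: eq_bigr => q _; rewrite mulr_sumr.
apply: eq_bigr => i _; rewrite mulr_sumr; apply: eq_bigr => j _.
have := sqr_sqrtr t0; move: (Num.sqrt t) => s <-.
by rewrite rmorphXn /=; ring.
Qed.

(* The hypothesis [mc] makes [Re (mpair m a b)] dominated by [opnorm2] on sums of
   pairs (a a^H, b b^H), so Mazur-Orlicz applies. *)
Lemma dominating_forms : exists l1 l2 : 'M[C]_k -> R,
  [/\ real_linear l1, real_linear l2, l1 1%:M + l2 1%:M <= c &
   forall a b : 'I_k -> 'I_N -> C, Re (mpair m a b) <= l1 (outer a) + l2 (outer b)].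
Proof.
have [||||l [ll lp lS]] := @mazur_orlicz _ _ _ fam_form opnorm2_sublinear.
- by exists [::]; rewrite !big_nil.
- move=> _ _ _ _ [l [-> ->]] [l' [-> ->]]; exists (l ++ l').
  by rewrite !big_cat.
- move=> t _ _ t0 [l [-> ->]].
  exists [seq ((fun p i => (Num.sqrt t)%:C * g.1 p i), (fun p i => (Num.sqrt t)%:C * g.2 p i))
     | g : coef <- l]; rewrite !big_map /=; split.
    have pairZ (x y : 'M[C]_k) : t%:C *: ((x, y) : E) = (t%:C *: x, t%:C *: y) by [].
    rewrite pairZ !scaler_sumr; congr pair.
      by apply: eq_bigr => g _; rewrite outer_scale ?ltW.
    by apply: eq_bigr => g _; rewrite outer_scale ?ltW.
  rewrite mulr_sumr; apply: eq_bigr => g _; rewrite mpair_scale ?ltW //.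
  by case: (mpair m _ _) => x y /=; rewrite mul0r subr0.
- exact: fam_form_le.
have pairD (x y z w : 'M[C]_k) : ((x, y) : E) + (z, w) = (x + z, y + w) by [].
have pairZ t (x y : 'M[C]_k) : t *: ((x, y) : E) = (t *: x, t *: y) by [].
exists (fun x => l (x, 0)), (fun x => l (0, x)); split.
- split=> [x y|r x]; first by rewrite -ll.1 pairD addr0.
  by rewrite -ll.2 pairZ scaler0.
- split=> [x y|r x]; first by rewrite -ll.1 pairD addr0.
  by rewrite -ll.2 pairZ scaler0.
- rewrite -ll.1 pairD addr0 add0r; apply: le_trans (lp _) _.
  rewrite /opnorm2 /= maxxx ler_piMr //; apply: opnormF_le => //.
  by apply: eq_opb (@opb_id R _) => i j; rewrite mxE.
- move=> a b; rewrite -ll.1; apply: lS; exists [:: (a, b)].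
  by rewrite !big_cons !big_nil pairD !addr0 add0r.
Qed.

End Factorization.

Lemma real_complexD (x y : R) : (x + y)%:C = x%:C + y%:C.
Proof. exact: (rmorphD (real_complex R)). Qed.

Lemma real_complexM (x y : R) : (x * y)%:C = x%:C * y%:C.
Proof. exact: (rmorphM (real_complex R)). Qed.

Lemma real_complex_sum T (r : seq T) (P : pred T) (x : T -> R) :
  (\sum_(t <- r | P t) x t)%:C = \sum_(t <- r | P t) (x t)%:C.
Proof. exact: (rmorph_sum (real_complex R)). Qed.

Lemma conjcD (x y : C) : conjc (x + y) = conjc x + conjc y.
Proof. exact: (rmorphD (@conjc R)). Qed.

Lemma conjcM (x y : C) : conjc (x * y) = conjc x * conjc y.
Proof. exact: (rmorphM (@conjc R)). Qed.

Lemma conjc_sum T (r : seq T) (P : pred T) (x : T -> C) :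
  conjc (\sum_(t <- r | P t) x t) = \sum_(t <- r | P t) conjc (x t).
Proof. exact: (rmorph_sum (@conjc R)). Qed.

Definition outv n (xi : 'I_n -> C) : 'M[C]_n := \matrix_(p, q) (xi p * conjc (xi q)).

Lemma outer_outv n (I : finType) (a : 'I_n -> I -> C) :
  outer a = \sum_i outv (fun p => a p i).
Proof.
apply/matrixP => p q; rewrite summxE mxE.
by apply: eq_bigr => i _; rewrite mxE.
Qed.

Lemma real_linear_sum (U : lmodType C) (l : U -> R) T (r : seq T) (x : T -> U) :
  real_linear l -> l (\sum_(t <- r) x t) = \sum_(t <- r) l (x t).
Proof.
move=> ll; elim: r => [|t r IHr]; last by rewrite !big_cons ll.1 IHr.
by rewrite !big_nil; have := ll.2 0 0; rewrite scale0r mul0r.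
Qed.

Lemma complexify_sum (U : lmodType C) (l : U -> R) T (r : seq T) (x : T -> U) :
  real_linear l -> complexify l (\sum_(t <- r) x t) = \sum_(t <- r) complexify l (x t).
Proof.
move=> ll; elim: r => [|t r IHr]; last by rewrite !big_cons complexify_additive // IHr.
by rewrite !big_nil; have := complexifyZ 0 0 ll; rewrite scale0r mul0r.
Qed.

(* The term [eps * l2F xi ^+ 2] makes a possibly degenerate form definite, so that
   its Gram factor is invertible. *)
Lemma psd_gram n (l : 'M[C]_n -> R) eps : real_linear l ->
  (forall xi, 0 <= l (outv xi)) -> 0 < eps ->
  exists X Y : 'M[C]_n, Y *m X = 1%:M /\ X *m Y = 1%:M /\
    forall xi, l (outv xi) + eps * l2F xi ^+ 2 = l2F (fmulv X xi) ^+ 2.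
Proof.
move=> ll lpos eps0; pose L := complexify l.
(* [l] is the real part of [L], so on rank one matrices it sees only the Hermitian part of the
   coefficients of [L]; passing to that part changes no value and makes [gram_factor] applicable. *)
pose H : 'M[C]_n := \matrix_(a, b)
  ((L (delta_mx a b) + conjc (L (delta_mx b a))) / 2%:R + (eps * (a == b)%:R)%:C).
have qE xi : qform H xi = (l (outv xi) + eps * l2F xi ^+ 2)%:C.
  have LE : L (outv xi) = \sum_a \sum_b xi a * conjc (xi b) * L (delta_mx a b).
    rewrite [outv xi]matrix_sum_delta /L complexify_sum //; apply: eq_bigr => a _.
    rewrite complexify_sum //; apply: eq_bigr => b _.
    by rewrite complexifyZ // mxE.
  have -> : l (outv xi) = Re (L (outv xi)) by rewrite Re_complexify.
  rewrite real_complexD ReJ_add {2}LE conjc_sum.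
  under [in RHS]eq_bigr do rewrite conjc_sum.
  rewrite [in RHS]exchange_big {1}LE -big_split /= mulr_suml sqr_l2F mulr_sumr real_complex_sum.
  rewrite -big_split /=; apply: eq_bigr => a _.
  rewrite -big_split /= mulr_suml.
  have -> : (eps * cnorm (xi a) ^+ 2)%:C =
      \sum_b xi a * conjc (xi b) * (eps * (a == b)%:R)%:C.
    rewrite (bigD1 a) //= eqxx big1 ?addr0 => [|b ba].
      by rewrite mulr1 mulc_conj real_complexM mulrC.
    by rewrite eq_sym (negPf ba) !mulr0.
  rewrite -big_split /=; apply: eq_bigr => b _.
  rewrite mxE.
  have -> : conjc (xi b * conjc (xi a) * L (delta_mx b a)) =
     xi a * conjc (xi b) * conjc (L (delta_mx b a)).
    by rewrite !conjcM conjcK; ring.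
  by rewrite mulrDr -[in RHS]mulrDr [in LHS]mulrA.
have [||X [Y [YX [XY XE]]]] := @gram_factor n H.
- move=> a b; rewrite !mxE.
  move: (L (delta_mx a b)) (L (delta_mx b a)) => z w.
  by rewrite conjcD conjcM conjcD conjcK conjc_real eq_sym conjc_inv conjc_nat [w + _]addrC.
- by move=> xi xi0; rewrite qE /= ltr_wpDl // mulr_gt0 ?exprn_gt0.
by exists X, Y; split=> //; split=> // xi; rewrite -XE qE.
Qed.


Definition block n M (y : 'I_n -> 'I_n -> nat -> nat -> C) : 'I_n * 'I_M -> 'I_n * 'I_M -> C :=
  fun pi qj => y pi.1 qj.1 pi.2 qj.2.

Lemma opb_block_supp n M K (y : 'I_n -> 'I_n -> nat -> nat -> C) A : 0 <= A ->
  (forall p q i j, (K <= i)%N \/ (K <= j)%N -> y p q i j = 0) ->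
  opb (block (M := K) y) A -> opb (block (M := M) y) A.
Proof.
move=> A0 yK yA.
pose g (pi : 'I_n * 'I_M) : option ('I_n * 'I_K) := omap (pair pi.1) (insub (pi.2 : nat)).
have g_inj : pinj g.
  move=> [p i] [p' i'] [q j]; rewrite /g /=.
  case: insubP => // u _ ui [<- <-]; case: insubP => // u' _ ui' [<- uu'].
  by congr pair; apply/val_inj; rewrite /= -ui -ui' uu'.
apply: eq_opb (opb_sub A0 g_inj g_inj yA) => -[p i] [q j]; rewrite /g /block /=.
case: insubP => [u _ /= ui|] /=; last by rewrite -leqNgt => Ki; rewrite yK //; left.
case: insubP => [u' _ /= uj|] /=; last by rewrite -leqNgt => Kj; rewrite yK //; right.
by rewrite ui uj.
Qed.

Lemma minfnorm_opb n (y : 'I_n -> 'I_n -> nat -> nat -> C) M :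
  (forall p q, fsupp (y p q)) -> minfnorm y <= 1 -> opb (block (M := M) y) 1.
Proof.
move=> ysupp y1.
have [K yK] : exists K, forall p q i j, (K <= i)%N \/ (K <= j)%N -> y p q i j = 0.
  have [K yK] := boolp.choice (fun pq => ysupp pq.1 pq.2).
  exists (\max_pq K pq)%N => p q i j Kij; apply: (yK (p, q)).
  by case: Kij => [] /(leq_trans (leq_bigmax (p, q))); [left|right].
apply: opb_le (opb_opnormF _) _; apply: le_trans y1.
apply: ub_le_sup; last by exists M.
exists (opnormF (block (M := K) y)) => _ [M' _ <-].
apply: opnormF_le; first exact: opnormF_ge0.
by apply: opb_block_supp yK (opb_opnormF _); apply: opnormF_ge0.
Qed.

Definition slice_block k N n (s : 'I_k -> 'I_k -> 'M[C]_N)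
    (y : 'I_n -> 'I_n -> nat -> nat -> C) : 'I_n * 'I_k -> 'I_n * 'I_k -> C :=
  fun pa qb => \sum_(i < N) \sum_(j < N) s pa.2 qb.2 i j * y pa.1 qb.1 i j.

Lemma tnorm_le k N (s : 'I_k -> 'I_k -> 'M[C]_N) A :
  (forall n (y : 'I_n -> 'I_n -> nat -> nat -> C),
     opb (block (M := N) y) 1 -> opnormF (slice_block s y) <= A) -> tnorm s <= A.
Proof.
move=> sA; apply: ge_sup.
  exists (opnormF (slice_block s (fun _ _ : 'I_0 => fun _ _ => 0))), 0%N, (fun _ _ _ _ => 0).
  split=> // [[]//|]; apply: ge_sup; first by eexists; exists 0%N.
  move=> _ [M _ <-]; apply: opnormF_le => //.
  by apply: opb_le (@opb0 R _ _) _.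
move=> _ [n [y [ysupp y1 ->]]]; apply: sA; exact: minfnorm_opb.
Qed.

(** The point is that the supremum in [tnorm] is finite: each entry of [s] contributes a scalar
    multiple of a compression of [y], so the sum of the moduli of the entries is an upper bound. *)
Lemma slice_block_le_tnorm k N (s : 'I_k -> 'I_k -> 'M[C]_N) n
    (y : 'I_n -> 'I_n -> nat -> nat -> C) :
  (forall p q, fsupp (y p q)) -> minfnorm y <= 1 -> opnormF (slice_block s y) <= tnorm s.
Proof.
move=> ysupp y1; apply: ub_le_sup; last by exists n, y.
exists (\sum_(t : ('I_k * 'I_k) * ('I_N * 'I_N)) cnorm (s t.1.1 t.1.2 t.2.1 t.2.2)).
move=> _ [{ysupp y1 y}n [y [ysupp y1 ->]]].
have yN := @minfnorm_opb _ _ N ysupp y1.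
apply: opnormF_le; first by apply: sumr_ge0 => t _; apply: cnorm_ge0.
pose f (a : 'I_k) (i : 'I_N) (pa : 'I_n * 'I_k) := if pa.2 == a then Some (pa.1, i) else None.
have f_inj a i : pinj (f a i).
  move=> [p b] [q b'] [r j]; rewrite /f /=; case: eqP => // -> [<- _].
  by case: eqP => // -> [->].
have E t := opbZ (s t.1.1 t.1.2 t.2.1 t.2.2)
  (opb_sub ler01 (f_inj t.1.1 t.2.1) (f_inj t.1.2 t.2.2) yN).
have := opb_bigsum (index_enum (('I_k * 'I_k) * ('I_N * 'I_N))%type) _ E.
move=> /(_ (fun=> mulr_ge0 (cnorm_ge0 _) ler01)).
under eq_bigr do rewrite mulr1.
apply: eq_opb => -[p a] [q b]; rewrite /f /=.
rewrite (pair_bigA _ (fun i j => s a b i j * y p q i j)) /=.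
rewrite -(pair_bigA _ (fun ab ij => s ab.1 ab.2 ij.1 ij.2 *
  match (if a == ab.1 then Some (p, ij.1) else None) with
  | Some i' => match (if b == ab.2 then Some (q, ij.2) else None) with
     | Some j' => block y i' j' | None => 0 end | None => 0 end)) /=.
rewrite (bigD1 (a, b)) //= [X in _ + X]big1 ?addr0 => [|[a' b'] ab].
  by apply: eq_bigr => ij _; rewrite !eqxx.
rewrite big1 // => ij _; case: eqP => [aa'|]; last by rewrite mulr0.
case: eqP => [bb'|]; last by rewrite mulr0.
by move: ab; rewrite {1}aa' {1}bb' /= eqxx.
Qed.

(** A phase replaces the real part by the modulus; on unit vectors the right side is then 2, and
    homogeneity does the rest. *)
Lemma opb_of_sum_squares (I J : finType) (a : I -> J -> C) :
  (forall y x, Re (bform a y x) <= l2F y ^+ 2 + l2F x ^+ 2) -> opb a 2.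
Proof.
move=> aE; have abs y x : cnorm (bform a y x) <= l2F y ^+ 2 + l2F x ^+ 2.
  have [u [u1 ux]] := phaseP (bform a y x).
  have := aE (fun i => u * y i) x; rewrite l2FZ u1 mul1r; apply: le_trans.
  have -> : bform a (fun i => u * y i) x = u * bform a y x.
    rewrite mulr_sumr; apply: eq_bigr => i _; rewrite mulr_sumr; apply: eq_bigr => j _.
    by rewrite !mulrA.
  by rewrite ux.
apply/opb_bform => // y x.
have [y0|y0] := eqVneq (l2F y) 0.
  rewrite y0 mulr0 mul0r /bform big1 ?cnorm0 // => i _; rewrite big1 // => j _.
  by rewrite (l2F_eq0 i y0) !mul0r.
have [x0|x0] := eqVneq (l2F x) 0.
  rewrite x0 mulr0 /bform big1 ?cnorm0 // => i _; rewrite big1 // => j _.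
  by rewrite (l2F_eq0 j x0) !mulr0.
have yp : 0 < l2F y by rewrite lt_neqAle eq_sym y0 l2F_ge0.
have xp : 0 < l2F x by rewrite lt_neqAle eq_sym x0 l2F_ge0.
have := abs (fun i => (l2F y)^-1%:C * y i) (fun j => (l2F x)^-1%:C * x j).
rewrite !l2FZ !cnorm_nneg ?invr_ge0 ?l2F_ge0 // !mulVf // expr1n.
have -> : bform a (fun i => (l2F y)^-1%:C * y i) (fun j => (l2F x)^-1%:C * x j) =
    ((l2F y)^-1 * (l2F x)^-1)%:C * bform a y x.
  rewrite mulr_sumr; apply: eq_bigr => i _; rewrite mulr_sumr; apply: eq_bigr => j _.
  by rewrite real_complexM; ring.
rewrite cnormM cnorm_nneg ?mulr_ge0 ?invr_ge0 ?l2F_ge0 //.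
rewrite -invfM mulrC ler_pdivrMr ?mulr_gt0 //.
by rewrite -[1 + 1]/(2 : R) mulrA.
Qed.
End TraceNorm.

(** * Pairing trace class matrices with scalar arrays *)

Section Pairings.
Variable R : realType.
Local Notation C := R[i].


Lemma sum_bilinear_exchange (P Q A B : finType) (u : P -> C) (v : Q -> C)
    (f : A -> P -> C) (g : B -> Q -> C) (m : A -> B -> C) :
  \sum_p \sum_q u p * v q * (\sum_a \sum_b f a p * g b q * m a b) =
  \sum_a \sum_b (\sum_p f a p * u p) * (\sum_q g b q * v q) * m a b.
Proof.
transitivity (\sum_a \sum_b \sum_p \sum_q f a p * u p * (g b q * v q) * m a b).
  under [RHS]eq_bigr do rewrite exchange_big.
  rewrite [RHS]exchange_big; apply: eq_bigr => p _.
  under [RHS]eq_bigr do rewrite exchange_big.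
  rewrite [RHS]exchange_big; apply: eq_bigr => q _.
  rewrite mulr_sumr; apply: eq_bigr => a _; rewrite mulr_sumr; apply: eq_bigr => b _.
  by rewrite /=; ring.
apply: eq_bigr => a _; apply: eq_bigr => b _.
rewrite big_distrlr mulr_suml; apply: eq_bigr => p _.
by rewrite mulr_suml.
Qed.

Lemma sum_pair_exchange (I J K L : finType) (F : I -> J -> K -> L -> C) :
  \sum_(x : I * J) \sum_(y : K * L) F x.1 x.2 y.1 y.2 =
  \sum_j \sum_l \sum_i \sum_k F i j k l.
Proof.
rewrite -(pair_bigA _ (fun i j => \sum_(y : K * L) F i j y.1 y.2)) exchange_big.
apply: eq_bigr => j _ /=; rewrite [RHS]exchange_big; apply: eq_bigr => i _ /=.
by rewrite -(pair_bigA _ (fun k l => F i j k l)) exchange_big.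
Qed.

Lemma l2F_columns n (I : finType) (eta : 'I_n * I -> C) :
  l2F eta ^+ 2 = \sum_i l2F (fun p => eta (p, i)) ^+ 2.
Proof.
under [RHS]eq_bigr do rewrite sqr_l2F.
rewrite exchange_big sqr_l2F pair_bigA /=.
by apply: eq_bigr => -[].
Qed.

Lemma tnorm_ge0 k N (s : 'I_k -> 'I_k -> 'M[C]_N) : 0 <= tnorm s.
Proof.
apply: le_trans (opnormF_ge0 _) (@slice_block_le_tnorm _ _ _ s 0 (fun _ _ _ _ => 0) _ _).
  by case.
apply: ge_sup; first by eexists; exists 0%N.
move=> _ [M _ <-]; apply: opnormF_le => //.
by apply: opb_le (@opb0 R _ _) _.
Qed.

Lemma outv_one n : \sum_a outv (fun p : 'I_n => (p == a)%:R : C) = 1%:M.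
Proof.
apply/matrixP => p q; rewrite summxE mxE (bigD1 p) //= mxE eqxx mul1r conjc_nat eq_sym.
rewrite big1 ?addr0 // => a ap; rewrite mxE eq_sym (negPf ap) mul0r //.
Qed.

(** The squared Hilbert-Schmidt norm is the sum of the squared column norms, that is, of the form at
    the basis vectors, whose rank one matrices sum to the identity. *)
Lemma gram_hilbert_schmidt n (l : 'M[C]_n -> R) eps (X : 'M[C]_n) : real_linear l ->
  (forall xi, l (outv xi) + eps * l2F xi ^+ 2 = l2F (fmulv X xi) ^+ 2) ->
  l2F (fun pa : 'I_n * 'I_n => X pa.1 pa.2) ^+ 2 = l 1%:M + eps * n%:R.
Proof.
move=> ll XE; rewrite l2F_columns /=.
transitivity (\sum_(a < n) (l (outv (fun p : 'I_n => (p == a)%:R)) + eps)).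
  apply: eq_bigr => a _; have := XE (fun p => (p == a)%:R).
  rewrite [l2F (fun p => (p == a)%:R) ^+ 2]sqr_l2F (bigD1 a) //= eqxx cnorm1 expr1n.
  rewrite big1 => [|b ba]; last by rewrite (negPf ba) cnorm0 expr0n.
  rewrite addr0 mulr1 => ->; congr (_ ^+ 2); apply: eq_l2F => p.
  rewrite /fmulv (bigD1 a) //= eqxx mulr1 big1 ?addr0 // => b ba.
  by rewrite (negPf ba) mulr0.
by rewrite big_split /= -real_linear_sum // outv_one sumr_const card_ord mulr_natr.
Qed.

Section Pairing.
Variables (k N : nat) (m : 'I_k -> 'I_k -> 'I_N.+1 -> 'I_N.+1 -> C) (c : R).
Hypothesis c0 : 0 <= c.
Hypothesis mc : forall r (a b : 'I_r -> 'I_k -> 'I_N.+1 -> C) A B, 0 <= A -> 0 <= B ->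
  opb (fun p (ti : 'I_r * 'I_N.+1) => a ti.1 p ti.2) A ->
  opb (fun p (ti : 'I_r * 'I_N.+1) => b ti.1 p ti.2) B ->
  cnorm (\sum_t mpair m (a t) (b t)) <= c * A * B.

(** With [m] written through [X1], [y], [X2], the pairing is twice the form of [slice_block s yy] at
    [X1] and [X2] read as vectors, so only their Hilbert-Schmidt norms enter. *)
Lemma pairing_le_tnorm_eps (s : 'I_k -> 'I_k -> 'M[C]_N.+1) eps : 0 < eps ->
  cnorm (\sum_a \sum_b \sum_i \sum_j s a b i j * m a b i j) <=
    tnorm s * (c + eps * k%:R *+ 2).
Proof.
move=> eps0; have [l1 [l2 [ll1 ll2 l12c lm]]] := dominating_forms c0 mc.
have lin0 l : real_linear l -> l (0 : 'M[C]_k) = 0.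
  by move=> ll; have := ll.2 0 0; rewrite scale0r mul0r.
have outer0 : outer (fun (_ : 'I_k) (_ : 'I_N.+1) => 0 : C) = 0.
  by apply/matrixP => p q; rewrite !mxE big1 // => i _; rewrite mul0r.
(* A rank one matrix is [outer] of an array supported in column 0, which exists because the size is
   [N.+1]. Paired with the zero array, it shows that each form is positive. *)
have outer_ext (xi : 'I_k -> C) :
    outer (fun (p : 'I_k) (i : 'I_N.+1) => if i == ord0 then xi p else 0) = outv xi.
  apply/matrixP => p q; rewrite !mxE (bigD1 ord0) //= big1 ?addr0 // => i i0.
  by rewrite (negPf i0) mul0r.
have pos1 xi : 0 <= l1 (outv xi).
  have := lm (fun p i => if i == ord0 then xi p else 0) (fun _ _ => 0).
  rewrite outer0 outer_ext (lin0 l2) // addr0 /mpair big1 // => a _.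
  by rewrite big1 // => b _; rewrite big1 // => i _; rewrite big1 // => j _; rewrite mulr0 mul0r.
have pos2 xi : 0 <= l2 (outv xi).
  have := lm (fun _ _ => 0) (fun p i => if i == ord0 then xi p else 0).
  rewrite outer0 outer_ext (lin0 l1) // add0r /mpair big1 // => a _.
  by rewrite big1 // => b _; rewrite big1 // => i _; rewrite big1 // => j _; rewrite !mul0r.
have [X1 [Y1 [YX1 [XY1 XE1]]]] := psd_gram ll1 pos1 eps0.
have [X2 [Y2 [YX2 [XY2 XE2]]]] := psd_gram ll2 pos2 eps0.
have fXY (X Y : 'M[C]_k) (eta : 'I_k -> C) : X *m Y = 1%:M ->
    fmulv X (fmulv Y eta) =1 eta.
  move=> XY p; rewrite -fmulmv /fmulv (bigD1 p) //= big1 => [|q qp].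
    have -> : fmulm X Y p p = 1 by have /matrixP/(_ p p) := XY; rewrite !mxE eqxx.
    by rewrite mul1r addr0.
  have -> : fmulm X Y p q = 0.
    by have /matrixP/(_ p q) := XY; rewrite !mxE eq_sym (negPf qp).
  by rewrite mul0r.
(* The inverse Gram factors normalise [m]: since [X1 *m Y1 = 1] and [X2 *m Y2 = 1], the two
   dominating forms become at most the squared norms of the vectors. *)
pose y p q i j := \sum_a \sum_b Y1 a p * Y2 b q * m a b i j.
pose yb (x z : 'I_k * 'I_N.+1) := y x.1 z.1 x.2 z.2.
have yb2 : opb yb 2.
  apply: opb_of_sum_squares => eta zeta.
  pose al a i := fmulv Y1 (fun p => eta (p, i)) a.
  pose be b j := fmulv Y2 (fun q => zeta (q, j)) b.
  have -> : bform yb eta zeta = mpair m al be.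
    transitivity (\sum_(x : 'I_k * 'I_N.+1) \sum_(z : 'I_k * 'I_N.+1)
       eta (x.1, x.2) * zeta (z.1, z.2) * y x.1 z.1 x.2 z.2).
      by apply: eq_bigr => -[p i] _; apply: eq_bigr => -[q j] _ /=; rewrite mulrAC.
    rewrite (sum_pair_exchange (fun p i q j => eta (p, i) * zeta (q, j) * y p q i j)) /mpair.
    under [RHS]eq_bigr do rewrite exchange_big.
    rewrite [RHS]exchange_big; apply: eq_bigr => i _ /=.
    under [RHS]eq_bigr do rewrite exchange_big.
    rewrite [RHS]exchange_big; apply: eq_bigr => j _ /=.
    exact: sum_bilinear_exchange.
  apply: le_trans (lm _ _) _; rewrite !outer_outv !real_linear_sum // !l2F_columns.
  apply: lerD; apply: ler_sum => i _.
    have := XE1 (fun p => al p i); rewrite (eq_l2F (fXY _ _ _ XY1)) => <-.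
    by rewrite lerDl mulr_ge0 ?sqr_ge0 ?ltW.
  have := XE2 (fun p => be p i); rewrite (eq_l2F (fXY _ _ _ XY2)) => <-.
  by rewrite lerDl mulr_ge0 ?sqr_ge0 ?ltW.
(* Halved and padded by zeros, [y] is an admissible test array for [tnorm]. *)
pose yy p q (i j : nat) : C := if insub i is Some i' then
  if insub j is Some j' then 2%:R^-1 * y p q i' j' else 0 else 0.
have yyN p q i j : (N.+1 <= i)%N \/ (N.+1 <= j)%N -> yy p q i j = 0.
  rewrite /yy; case=> le_N; first by rewrite insubF // ltnNge le_N.
  by case: insub => // i'; rewrite insubF // ltnNge le_N.
have yy1 M : opb (block (M := M) yy) 1.
  apply: (opb_block_supp (K := N.+1)) => //.
  have := opbZ (2%:R^-1) yb2.
  have -> : cnorm (2%:R^-1 : C) * 2 = 1.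
    by rewrite cnormV -(rmorph_nat (real_complex R)) cnorm_nneg ?ler0n // mulVf ?pnatr_eq0.
  by apply: eq_opb => -[p i] [q j]; rewrite /block /yy /yb /= !valK.
have yym : minfnorm yy <= 1.
  apply: ge_sup; first by eexists; exists 0%N.
  by move=> _ [M _ <-]; apply: opnormF_le.
have := slice_block_le_tnorm s (fun p q => ex_intro _ N.+1 (yyN p q)) yym.
move=> /opnormF_leP /(opb_bform _ (tnorm_ge0 s)).
move=> /(_ (fun pa => X1 pa.1 pa.2) (fun qb => X2 qb.1 qb.2)).
(* The other order of the inverses, [Y1 *m X1 = 1] and [Y2 *m X2 = 1], recovers [m] from [y]. *)
have mE a b i j : m a b i j = \sum_p \sum_q X1 p a * X2 q b * y p q i j.
  rewrite sum_bilinear_exchange (bigD1 a) //= (bigD1 b) //=.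
  have YX a' a'' (X Y : 'M[C]_k) : Y *m X = 1%:M -> \sum_p Y a' p * X p a'' = (a' == a'')%:R.
    by move=> /matrixP/(_ a' a''); rewrite !mxE.
  rewrite !YX // !eqxx !mul1r big1 => [|b' b'b]; last first.
    by rewrite !YX // (negPf b'b) mulr0 mul0r.
  rewrite addr0 big1 ?addr0 // => a' a'a; rewrite big1 // => b' _.
  by rewrite !YX // (negPf a'a) !mul0r.
have -> : \sum_a \sum_b \sum_i \sum_j s a b i j * m a b i j =
  2%:R * bform (slice_block s yy) (fun pa => X1 pa.1 pa.2) (fun qb => X2 qb.1 qb.2).
  rewrite [bform _ _ _](sum_pair_exchange (fun p a q b => X1 p a *
    (\sum_(i < N.+1) \sum_(j < N.+1) s a b i j * yy p q i j) * X2 q b)).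
  rewrite mulr_sumr; apply: eq_bigr => a _; rewrite mulr_sumr; apply: eq_bigr => b _.
  transitivity (\sum_i \sum_j \sum_p \sum_q s a b i j * (X1 p a * X2 q b * y p q i j)).
    apply: eq_bigr => i _; apply: eq_bigr => j _; rewrite mE mulr_sumr.
    by apply: eq_bigr => p _; rewrite mulr_sumr.
  under eq_bigr do rewrite exchange_big.
  rewrite exchange_big mulr_sumr; apply: eq_bigr => p _ /=.
  under eq_bigr do rewrite exchange_big.
  rewrite exchange_big mulr_sumr; apply: eq_bigr => q _ /=.
  rewrite mulr_sumr mulr_suml mulr_sumr; apply: eq_bigr => i _.
  rewrite mulr_sumr mulr_suml mulr_sumr; apply: eq_bigr => j _.
  rewrite /yy !valK; move: (y p q i j) => z.
  have /(mulfV) : (2%:R : C) != 0 by rewrite pnatr_eq0.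
  move: (2%:R^-1) => w w2.
  transitivity ((2%:R * w) * (X1 p a * (s a b i j * z) * X2 q b)); last by ring.
  by rewrite w2; ring.
rewrite cnormM -(rmorph_nat (real_complex R)) cnorm_nneg //.
set B := cnorm _; set u := l2F _; set v := l2F _ => leB.
have u2 : u ^+ 2 = l1 1%:M + eps * k%:R by apply: gram_hilbert_schmidt.
have v2 : v ^+ 2 = l2 1%:M + eps * k%:R by apply: gram_hilbert_schmidt.
have t0 := tnorm_ge0 s.
(* The arithmetic-geometric mean inequality absorbs the 2 that came from halving [y]. *)
have uv : 2 * (u * v) <= c + eps * k%:R *+ 2.
  by have := sqr_ge0 (u - v); rewrite sqrrB u2 v2 -mulr_natl; lra.
apply: le_trans (ler_wpM2l t0 uv).
by rewrite mulrCA ler_wpM2l // mulrA.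
Qed.

End Pairing.

Lemma pairing_le_tnorm k N (m : 'I_k -> 'I_k -> 'I_N -> 'I_N -> C) c : 0 <= c ->
  (forall r (a b : 'I_r -> 'I_k -> 'I_N -> C) A B, 0 <= A -> 0 <= B ->
    opb (fun p (ti : 'I_r * 'I_N) => a ti.1 p ti.2) A ->
    opb (fun p (ti : 'I_r * 'I_N) => b ti.1 p ti.2) B ->
    cnorm (\sum_t mpair m (a t) (b t)) <= c * A * B) ->
  forall s : 'I_k -> 'I_k -> 'M[C]_N,
    cnorm (\sum_a \sum_b \sum_i \sum_j s a b i j * m a b i j) <= tnorm s * c.
Proof.
move=> c0; case: N m => [|N] m mc s.
  rewrite big1 ?cnorm0 ?mulr_ge0 ?tnorm_ge0 // => a _; rewrite big1 // => b _.
  by rewrite big_ord0.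
apply/ler_addgt0Pr => e e0; have t0 := tnorm_ge0 s.
pose D := tnorm s * k%:R *+ 2 + 1.
have D0 : 0 < D by rewrite ltr_wpDl ?mulrn_wge0 ?mulr_ge0.
apply: le_trans (pairing_le_tnorm_eps c0 mc s (divr_gt0 e0 D0)) _.
rewrite mulrDr lerD2l.
have -> : tnorm s * (e / D * k%:R *+ 2) = e * ((D - 1) / D) by rewrite /D addrK; ring.
by rewrite -[leRHS]mulr1 ler_pM2l // ler_pdivrMr // mul1r gerBl.
Qed.

End Pairings.

(** * The slice map inequality *)

Section Slice.
Variable R : realType.
Local Notation C := R[i].
Variables (V : lmodType C) (mn : forall n, 'M[V]_n -> R).
Hypothesis mnP : opspace mn.

Theorem slice_le k N (s : 'I_k -> 'I_k -> 'M[C]_N) (f : nat -> nat -> V) :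
  mn (slice s f) <= tnorm s * trunc_norm mn N f.
Proof.
pose E : lmodType C := {ffun 'I_k * 'I_k -> V}.
pose p (x : E) := nF mn (fun a b => x (a, b)).
have pP : seminormC p.
  split=> [x y|c x]; rewrite /p.
    by apply: le_trans (nFD mnP _ _); apply/eqW/eq_nF => a b; rewrite ffunE.
  by rewrite -(nFZ mnP); apply: eq_nF => a b; rewrite ffunE.
pose x0 : E := [ffun ab => \sum_(i < N) \sum_(j < N) s ab.1 ab.2 i j *: f i j].
have -> : mn (slice s f) = p x0.
  by rewrite (mn_nF mnP); apply: eq_nF => a b; rewrite mxE ffunE.
have [l [lD lZ lp lx0]] := hahn_banach_norming x0 pP.
apply: le_trans lx0 _.
pose del a b v : E := [ffun ab => if ab == (a, b) then v else 0].
pose m a b (i j : 'I_N) := l (del a b (f i j)).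
have l0 : l 0 = 0 by have := lZ 0 0; rewrite scale0r mul0r.
have l_sum T (r : seq T) (x : T -> E) : l (\sum_(t <- r) x t) = \sum_(t <- r) l (x t).
  exact: (big_morph l lD l0).
have lE (kap : 'I_k -> 'I_k -> 'I_N -> 'I_N -> C) :
    l [ffun ab => \sum_i \sum_j kap ab.1 ab.2 i j *: f i j] =
    \sum_a \sum_b \sum_i \sum_j kap a b i j * m a b i j.
  transitivity (l (\sum_a \sum_b \sum_i \sum_j kap a b i j *: del a b (f i j))).
    congr l; apply/ffunP => -[a b]; rewrite ffunE sum_ffunE (bigD1 a) //= sum_ffunE.
    rewrite (bigD1 b) //= [X in _ + X + _]big1 => [|b' b'b]; last first.
      rewrite sum_ffunE big1 // => i _; rewrite sum_ffunE big1 // => j _.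
      by rewrite !ffunE xpair_eqE eqxx [b == b']eq_sym (negPf b'b) scaler0.
    rewrite [X in _ + X]big1 => [|a' a'a]; last first.
      rewrite sum_ffunE big1 // => b' _; rewrite sum_ffunE big1 // => i _.
      rewrite sum_ffunE big1 // => j _.
      by rewrite !ffunE xpair_eqE eq_sym (negPf a'a) scaler0.
    rewrite !addr0 sum_ffunE; apply: eq_bigr => i _; rewrite sum_ffunE.
    by apply: eq_bigr => j _; rewrite !ffunE eqxx.
  rewrite l_sum; apply: eq_bigr => a _; rewrite l_sum; apply: eq_bigr => b _.
  rewrite l_sum; apply: eq_bigr => i _; rewrite l_sum; apply: eq_bigr => j _.
  by rewrite lZ.
rewrite (lE (fun a b i j => s a b i j)).
apply: pairing_le_tnorm; first exact: nF_ge0.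
move=> r a b A B A0 B0 aA bB.
have -> : \sum_t mpair m (a t) (b t) =
    l [ffun pq => \sum_i \sum_j (\sum_t a t pq.1 i * b t pq.2 j) *: f i j].
  rewrite (lE (fun p q i j => \sum_t a t p i * b t q j)) exchange_big.
  apply: eq_bigr => q _; rewrite exchange_big; apply: eq_bigr => q' _.
  rewrite exchange_big; apply: eq_bigr => i _; rewrite exchange_big.
  by apply: eq_bigr => j _; rewrite mulr_suml.
apply: le_trans (lp _) _.
(* [y] is f tensored with the identity of size [r], no larger in norm than f. The sum of pairings is
   [l] at the product of a, [y] and b transposed, which yields the hypothesis of
   [pairing_le_tnorm]. *)
pose y (x z : 'I_r * 'I_N) := if x.1 == z.1 then f x.2 z.2 else 0.
have yc : nF mn y <= trunc_norm mn N f.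
  by apply: (@nF_block _ _ _ mnP r _ (fun _ (i j : 'I_N) => f i j)) => //; apply: nF_ge0.
have := nF_smul mnP y A0 B0 aA (opbT B0 bB).
move=> /le_trans le1; apply: le_trans (le1 _ _); last first.
  by rewrite [trunc_norm _ _ _ * A]mulrC -!mulrA ler_wpM2l // ler_wpM2r.
apply/eqW/eq_nF => q q'; rewrite ffunE /=.
rewrite -(pair_bigA _ (fun t i => \sum_l0 (a t q i * b l0.1 q' l0.2) *: y (t, i) l0)) /=.
rewrite [RHS]exchange_big; apply: eq_bigr => i _ /=.
under [RHS]eq_bigr do rewrite -(pair_bigA _ (fun t' j =>
  (a _ q i * b t' q' j) *: y (_, i) (t', j))) /=.
transitivity (\sum_j \sum_t (a t q i * b t q' j) *: f i j).
  by apply: eq_bigr => j _; rewrite scaler_suml.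
rewrite exchange_big; apply: eq_bigr => t _ /=.
rewrite [RHS](bigD1 t) //= [X in _ + X]big1 ?addr0 => [|t' t't]; last first.
  by rewrite big1 // => j _; rewrite /y /= eq_sym (negPf t't) scaler0.
by apply: eq_bigr => j _; rewrite /y /= eqxx.
Qed.

End Slice.

Section Linear.
Variables (K : pzRingType) (U V : lmodType K) (phi : U -> V).
Hypothesis phiL : linear phi.

Lemma linear_fun0 : phi 0 = 0.
Proof.
have /eqP := phiL 1 0 0; rewrite !scale1r addr0 -subr_eq subrr eq_sym.
by move/eqP.
Qed.

Lemma linear_funD x y : phi (x + y) = phi x + phi y.
Proof. by have := phiL 1 x y; rewrite !scale1r. Qed.

Lemma linear_funZ a x : phi (a *: x) = a *: phi x.
Proof. by have := phiL a x 0; rewrite !addr0 linear_fun0 addr0. Qed.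

Lemma linear_funB x y : phi (x - y) = phi x - phi y.
Proof. by rewrite -scaleN1r addrC phiL scaleN1r addrC. Qed.

Lemma linear_fun_sum T (r : seq T) (P : pred T) (x : T -> U) :
  phi (\sum_(t <- r | P t) x t) = \sum_(t <- r | P t) phi (x t).
Proof. exact: (big_morph phi linear_funD linear_fun0). Qed.

End Linear.

(** * Completely bounded maps *)

Section CompletelyBounded.
Variable R : realType.
Local Notation C := R[i].

Lemma linear_map_slice (W V : lmodType C) (phi : W -> V) k N
    (s : 'I_k -> 'I_k -> 'M[C]_N) f : linear phi ->
  map_mx phi (slice s f) = slice s (fun i j => phi (f i j)).
Proof.
move=> phiL; apply/matrixP => a b; rewrite !mxE linear_fun_sum //.
apply: eq_bigr => i _; rewrite linear_fun_sum //; apply: eq_bigr => j _.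
by rewrite linear_funZ.
Qed.

Lemma cb_bound (W V : lmodType C) (mnW : forall n, 'M[W]_n -> R)
    (mnV : forall n, 'M[V]_n -> R) (phi : W -> V) :
  opspace mnW -> cbmap mnW mnV phi ->
  exists2 M, 0 <= M & forall n (w : 'M[W]_n), mnV n (map_mx phi w) <= M * mnW n w.
Proof.
move=> mnWP [phiL [M phiM]]; exists `|M| => // n w; apply: le_trans (phiM n w) _.
by rewrite ler_wpM2r ?ler_norm //; have [[]] := mnWP.
Qed.

Lemma cb_nF (W V : lmodType C) (mnW : forall n, 'M[W]_n -> R)
    (mnV : forall n, 'M[V]_n -> R) (phi : W -> V) M (I : finType) (x : I -> I -> W) :
  (forall n (w : 'M[W]_n), mnV n (map_mx phi w) <= M * mnW n w) ->
  nF mnV (fun i j => phi (x i j)) <= M * nF mnW x.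
Proof.
move=> /(_ _ (fF x)); congr (mnV _ _ <= _).
by apply/matrixP => i j; rewrite !mxE.
Qed.

Lemma mn_triangle (V : lmodType C) (mn : forall n, 'M[V]_n -> R) n (x y : 'M[V]_n) :
  opspace mn -> mn n (x + y) <= mn n x + mn n y.
Proof. by move=> [[_ _ + _] _ _ _]; apply. Qed.

Lemma mnN (V : lmodType C) (mn : forall n, 'M[V]_n -> R) n (x : 'M[V]_n) :
  opspace mn -> mn n (- x) = mn n x.
Proof.
move=> [[_ _ _ hom] _ _ _]; rewrite -[RHS]mul1r -(cnorm1 R) -cnormN -hom.
by congr mn; apply/matrixP => i j; rewrite !mxE scaleN1r.
Qed.

Lemma mn0 (V : lmodType C) (mn : forall n, 'M[V]_n -> R) n :
  opspace mn -> mn n 0 = 0.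
Proof.
move=> [[_ _ _ hom] _ _ _]; have := hom n 0 0; rewrite cnorm0 mul0r => <-.
by congr mn; apply/matrixP => i j; rewrite !mxE scale0r.
Qed.

Lemma cb_comp (U W V : lmodType C) (mnU : forall n, 'M[U]_n -> R)
    (mnW : forall n, 'M[W]_n -> R) (mnV : forall n, 'M[V]_n -> R) phi psi :
  opspace mnW -> cbmap mnU mnW phi -> cbmap mnW mnV psi ->
  cbmap mnU mnV (fun u => psi (phi u)).
Proof.
move=> mnWP [phiL [M phiM]] psicb; have [N N0 psiN] := cb_bound mnWP psicb.
split; first by move=> a u v; rewrite phiL psicb.1.
exists (N * M) => n w; rewrite -mulrA.
apply: le_trans (ler_wpM2l N0 (phiM n w)); apply: le_trans (psiN _ _).
by apply/eqW; congr mnV; apply/matrixP => i j; rewrite !mxE.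
Qed.

Lemma cb_sub (W V : lmodType C) (mnW : forall n, 'M[W]_n -> R)
    (mnV : forall n, 'M[V]_n -> R) phi psi :
  opspace mnV -> cbmap mnW mnV phi -> cbmap mnW mnV psi ->
  cbmap mnW mnV (fun w => phi w - psi w).
Proof.
move=> mnVP [phiL [M phiM]] [psiL [N psiN]]; split.
  by move=> a u v; rewrite phiL psiL scalerBr opprD addrACA.
exists (M + N) => n w; rewrite mulrDl.
apply: le_trans (lerD (phiM n w) (psiN n w)); rewrite -[X in _ <= _ + X]mnN //.
apply: le_trans (mn_triangle _ _ mnVP).
by apply/eqW; congr mnV; apply/matrixP => i j; rewrite !mxE.
Qed.

Lemma cb_id (V : lmodType C) (mnV : forall n, 'M[V]_n -> R) : cbmap mnV mnV id.
Proof.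
split=> [//|]; exists 1 => n w; rewrite mul1r.
by apply/eqW; congr mnV; apply/matrixP => i j; rewrite !mxE.
Qed.

Lemma cbnorm_le (W V : lmodType C) (mnW : forall n, 'M[W]_n -> R)
    (mnV : forall n, 'M[V]_n -> R) phi M : opspace mnW ->
  (forall n (w : 'M[W]_n), mnW n w <= 1 -> mnV n (map_mx phi w) <= M) ->
  cbnorm mnW mnV phi <= M.
Proof.
move=> mnWP phiM; apply: ge_sup; last by move=> _ [n [w [w1 ->]]]; apply: phiM.
by exists (mnV 0%N (map_mx phi 0)), 0%N, 0; rewrite mn0.
Qed.

Lemma le_cbnorm (W V : lmodType C) (mnW : forall n, 'M[W]_n -> R)
    (mnV : forall n, 'M[V]_n -> R) phi n (w : 'M[W]_n) :
  opspace mnW -> cbmap mnW mnV phi -> mnW n w <= 1 ->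
  mnV n (map_mx phi w) <= cbnorm mnW mnV phi.
Proof.
move=> mnWP phicb w1; have [M M0 phiM] := cb_bound mnWP phicb.
apply: ub_le_sup; last by exists n, w.
exists M => _ [m [v [v1 ->]]]; apply: le_trans (phiM _ _) _.
by rewrite -[leRHS]mulr1 ler_wpM2l.
Qed.

Theorem OAP_approximation (V : lmodType C) (mnV : forall n, 'M[V]_n -> R)
    (W : lmodType C) (mnW : forall n, 'M[W]_n -> R) (phi : W -> V) :
  opspace mnV -> opspace mnW -> OAP mnV ->
  cbmap mnW mnV phi -> op_compact_map mnW mnV phi ->
  forall e : R, 0 < e -> exists psi : W -> V,
    [/\ cbmap mnW mnV psi, finrank psi & cbnorm mnW mnV (fun w => phi w - psi w) < e].
Proof.
move=> mnVP mnWP [D [le [f [_ [le_refl _] _ fP fid]]]] phicb [_ [x [kx phix]]] e e0.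
have [d0 d0P] := fid x kx (e / 2) (divr_gt0 e0 (ltr0n _ 2)).
have [l [lx le2]] := d0P d0 (le_refl d0).
have [fcb [n [v fv]]] := fP d0.
exists (fun w => f d0 (phi w)); split; first exact: cb_comp fcb.
  by exists n, v => w; apply: fv.
pose T v := f d0 v - v.
have Tcb : cbmap mnV mnV T by apply: cb_sub => //; apply: cb_id.
have [M M0 TM] := cb_bound mnVP Tcb.
have TL := Tcb.1.
apply: (@le_lt_trans _ _ (e / 2)); last by rewrite ltr_pdivrMr // mulr_natr mulr2n ltrDl.
apply: cbnorm_le => // k w w1.
have -> : map_mx (fun w => phi w - f d0 (phi w)) w = - map_mx T (map_mx phi w).
  by apply/matrixP => i j; rewrite !mxE opprB.
rewrite mnN //; set y := map_mx phi w.
apply/ler_addgt0Pr => d d_gt0.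
(* Two replacements cost [M * del] each: [y] by a point [z] of the hull, and [z] by a slice of an
   actual finite matrix [x j]. *)
pose del := d / (M *+ 2 + 1).
have del0 : 0 < del by rewrite divr_gt0 // ltr_wpDl // mulrn_wge0.
have [|z [[N [s [s1 sz]]] yz]] := phix k y _ del del0; first by exists w.
have [K1 K1P] := sz _ del0.
have [|K2 K2P] := lx (e / 2 - l); first by rewrite subr_gt0.
set j := maxn K1 K2.
have := K1P j (leq_maxl _ _); set u := slice s (x j) => uz.
have := K2P j (leq_maxr _ _); rewrite -/T => /ltr_normlW lj.
have -> : map_mx T y = map_mx T (y - z) + (map_mx T (z - u) + map_mx T u).
  by apply/matrixP => a b; rewrite !mxE !(linear_funB TL) !subrK.
have le1 : mnV k (map_mx T (y - z)) <= M * del.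
  by apply: le_trans (TM _ _) _; rewrite ler_wpM2l // ltW.
have le3 : mnV k (map_mx T (z - u)) <= M * del.
  by apply: le_trans (TM _ _) _; rewrite ler_wpM2l // -mnN // opprB ltW.
have le4 : mnV k (map_mx T u) <= e / 2.
  rewrite linear_map_slice //; apply: le_trans (slice_le mnVP _ _) _.
  have Tx : fsupp (fun a b => T (x j a b)).
    by apply: fsupp_map (kx.1 j); apply: linear_fun0.
  apply: le_trans (_ : 1 * infnorm mnV (fun a b => T (x j a b)) <= _).
    by rewrite ler_pM ?tnorm_ge0 ?nF_ge0 ?le_infnorm.
  by rewrite mul1r; move: lj; rewrite /T; lra.
apply: le_trans (mn_triangle _ _ mnVP) _.
have le5 := mn_triangle (map_mx T (z - u)) (map_mx T u) mnVP.
have : del * (M *+ 2 + 1) = d by rewrite /del divfK // gt_eqF // ltr_wpDl // mulrn_wge0.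
rewrite mulrDr mulr1 mulrnAr mulrC mulr2n; lra.
Qed.

End CompletelyBounded.

(** * Submodules as modules *)

Section Subspace.
Variables (K : pzRingType) (V : lmodType K).

(** The closure proof is an argument so that the instance exists for any predicate, including one
    such as [gauge_pred] whose closure depends on hypotheses. *)
Definition subspace_pred (P : {pred V}) (closed_P : submod_closed P) : {pred V} := P.

HB.instance Definition _ P closed_P :=
  GRing.isSubmodClosed.Build K V (@subspace_pred P closed_P) closed_P.

Variables (P : {pred V}) (closed_P : submod_closed P).

Record subspace := Subspace { subspace_val :> V; _ : subspace_val \in subspace_pred closed_P }.

HB.instance Definition _ := [isSub for subspace_val].
HB.instance Definition _ := [Choice of subspace by <:].
HB.instance Definition _ := [SubChoice_isSubLmodule of subspace by <:].

End Subspace.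


Lemma sum_pair (U : nmodType) (T I : finType) (F : T * I -> U) :
  \sum_x F x = \sum_t \sum_i F (t, i).
Proof. by rewrite pair_bigA; apply: eq_bigr => -[]. Qed.

(** * Block matrices of scalars *)

Section Ampliation.
Variable R : realType.
Local Notation C := R[i].

Lemma opb_block_diag (T I J : finType) (a : T -> I -> J -> C) M : 0 <= M ->
  (forall t, opb (a t) M) ->
  opb (fun (x : T * I) (y : T * J) => if x.1 == y.1 then a x.1 x.2 y.2 else 0) M.
Proof.
move=> M0 aM xi; rewrite l2F_le ?mulr_ge0 ?l2F_ge0 // exprMn sqr_l2F.
rewrite !sum_pair mulr_sumr.
apply: ler_sum => t _; have := aM t (fun j => xi (t, j)).
rewrite l2F_le ?mulr_ge0 ?l2F_ge0 // exprMn sqr_l2F; congr (_ <= _).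
apply: eq_bigr => i _; congr (cnorm _ ^+ 2); rewrite /fmulv.
rewrite sum_pair /=.
rewrite [RHS](bigD1 t) //= eqxx [X in _ = _ + X]big1 ?addr0 // => t' t't.
by rewrite big1 // => j _; rewrite eq_sym (negPf t't) mul0r.
Qed.

(** After transposition the two images of a vector are stacked, so squared norms add. This law is
    why [hull] bounds its factors by square roots: it makes the hull additive in its parameter. *)
Lemma opb_col_mx (I J J' : finType) (a : I -> J -> C) (b : I -> J' -> C) s t :
  0 <= s -> 0 <= t -> opb a (Num.sqrt s) -> opb b (Num.sqrt t) ->
  opb (fun i (x : J + J') => match x with inl j => a i j | inr j => b i j end)
    (Num.sqrt (s + t)).
Proof.
move=> s0 t0 as_ bt.
apply: (@opbT _ _ _ (fun (x : J + J') i => match x with inl j => a i j | inr j => b i j end)).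
  exact: sqrtr_ge0.
move=> xi; rewrite l2F_le ?mulr_ge0 ?sqrtr_ge0 ?l2F_ge0 // exprMn sqr_sqrtr ?addr_ge0 //.
rewrite big_sumType /= mulrDl; apply: lerD.
  have := opbT (sqrtr_ge0 _) as_ xi.
  by rewrite l2F_le ?mulr_ge0 ?sqrtr_ge0 ?l2F_ge0 // exprMn sqr_sqrtr.
have := opbT (sqrtr_ge0 _) bt xi.
by rewrite l2F_le ?mulr_ge0 ?sqrtr_ge0 ?l2F_ge0 // exprMn sqr_sqrtr.
Qed.

Lemma opb_direct_sum (I J I' J' : finType) (a : I -> J -> C) (b : I' -> J' -> C) M :
  0 <= M -> opb a M -> opb b M ->
  opb (fun (x : I + I') (y : J + J') => match x, y with
    | inl i, inl j => a i j | inr i, inr j => b i j | _, _ => 0 end) M.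
Proof.
move=> M0 aM bM xi; rewrite l2F_le ?mulr_ge0 ?l2F_ge0 // exprMn sqr_l2F.
rewrite !big_sumType /= mulrDr; apply: lerD.
  have := aM (fun j => xi (inl j)).
  rewrite l2F_le ?mulr_ge0 ?l2F_ge0 // exprMn sqr_l2F; congr (_ <= _).
  apply: eq_bigr => i _; congr (cnorm _ ^+ 2); rewrite /fmulv big_sumType /=.
  by rewrite [X in _ = _ + X]big1 ?addr0 // => j _; rewrite mul0r.
have := bM (fun j => xi (inr j)).
rewrite l2F_le ?mulr_ge0 ?l2F_ge0 // exprMn sqr_l2F; congr (_ <= _).
apply: eq_bigr => i _; congr (cnorm _ ^+ 2); rewrite /fmulv big_sumType /=.
by rewrite [X in _ = X + _]big1 ?add0r // => j _; rewrite mul0r.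
Qed.

End Ampliation.

(** * The gauge space of an absolutely matrix convex hull *)

Section Hull.
Variable R : realType.
Local Notation C := R[i].
Variables (V : lmodType C) (mn : forall n, 'M[V]_n -> R).
Hypothesis mnP : opspace mn.
Variables (f : nat -> nat -> V) (B : R).
Hypotheses (B0 : 0 <= B) (fB : forall N, trunc_norm mn N f <= B).

(* The matrix f (x) 1_T with rows and columns indexed by T * nat. *)
Definition ampl (T : finType) (x y : T * nat) : V := if x.1 == y.1 then f x.2 y.2 else 0.

(* The elements a (f (x) 1) b^T with |a|^2, |b|^2 <= t: t times the hull of f.
   An injection g selects the finitely many indices involved. *)
Definition hull (I : finType) t (y : I -> I -> V) := exists (T J : finType)
  (g : J -> T * nat) (a b : I -> J -> C),
  [/\ injective g, opb a (Num.sqrt t), opb b (Num.sqrt t) &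
   forall i i', y i i' = \sum_j \sum_k (a i j * b i' k) *: ampl (g j) (g k)].

Lemma nF_ampl (T J : finType) (g : J -> T * nat) : injective g ->
  nF mn (fun j k => ampl (g j) (g k)) <= B.
Proof.
move=> g_inj; pose N := (\max_j (g j).2).+1.
have gN j : ((g j).2 < N)%N by rewrite ltnS (leq_bigmax j).
pose h j := Some (enum_rank (g j).1, Ordinal (gN j)).
have h_inj : pinj h.
  move=> j j' k [<-] [] /enum_rank_inj e1 e2; apply: g_inj.
  by rewrite [LHS]surjective_pairing [RHS]surjective_pairing e1 e2.
have := @nF_block _ _ _ mnP #|T| _ (fun _ (i j : 'I_N) => f i j) B B0 (fun=> fB N).
apply: le_trans; apply: le_trans (nF_compress mnP _ h_inj h_inj).
by apply/eqW/eq_nF => j k /=; rewrite (inj_eq enum_rank_inj).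
Qed.

Lemma hull_bound (I : finType) t (y : I -> I -> V) : 0 <= t -> hull t y -> nF mn y <= t * B.
Proof.
move=> t0 [T [J [g [a [b [g_inj at_ bt yE]]]]]].
have := nF_smul mnP (fun j k => ampl (g j) (g k)) (sqrtr_ge0 t) (sqrtr_ge0 t) at_
  (opbT (sqrtr_ge0 t) bt).
rewrite mulrAC -expr2 sqr_sqrtr // => le1.
apply: le_trans (ler_wpM2l t0 (nF_ampl g_inj)); apply: le_trans le1.
by apply/eqW/eq_nF.
Qed.

Lemma hull_mono (I : finType) t t' (y : I -> I -> V) : t <= t' -> hull t y -> hull t' y.
Proof.
move=> tt' [T [J [g [a [b [g_inj at_ bt yE]]]]]]; exists T, J, g, a, b.
by split=> //; [apply: opb_le at_ _ | apply: opb_le bt _]; apply: ler_wsqrtr.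
Qed.

Lemma eq_hull (I : finType) t (y z : I -> I -> V) : y =2 z -> hull t y -> hull t z.
Proof.
move=> yz [T [J [g [a [b [g_inj at_ bt yE]]]]]]; exists T, J, g, a, b.
by split=> // i i'; rewrite -yz yE.
Qed.

Lemma hull0 (I : finType) : hull 0 (fun _ _ : I => 0).
Proof.
exists unit, void, (fun v : void => match v with end), (fun _ _ => 0), (fun _ _ => 0).
rewrite sqrtr0; split; [by case|exact: opb0|exact: opb0|].
by move=> i i'; rewrite big1 // => -[].
Qed.

(** The two presentations are placed on disjoint copies of [f], indexed by [T + T']; the cross terms
    of [ampl] vanish and [opb_col_mx] adds the parameters. *)
Lemma hullD (I : finType) s t (y z : I -> I -> V) : 0 <= s -> 0 <= t ->
  hull s y -> hull t z -> hull (s + t) (fun i j => y i j + z i j).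
Proof.
move=> s0 t0 [T [J [g [a [b [g_inj as_ bs yE]]]]]] [T' [J' [g' [a' [b' [g'_inj a't b't zE]]]]]].
exists (T + T')%type, (J + J')%type.
exists (fun x => match x with inl j => (inl (g j).1, (g j).2)
                            | inr j => (inr (g' j).1, (g' j).2) end).
exists (fun i x => match x with inl j => a i j | inr j => a' i j end).
exists (fun i x => match x with inl j => b i j | inr j => b' i j end).
split; [|exact: opb_col_mx|exact: opb_col_mx|].
  move=> [j|j] [k|k] // [e1 e2]; congr (_ _); [apply: g_inj|apply: g'_inj];
  by rewrite [LHS]surjective_pairing [RHS]surjective_pairing e1 e2.
move=> i i'; rewrite big_sumType /= yE zE; congr (_ + _); apply: eq_bigr => j _.
  rewrite big_sumType /= [X in _ = _ + X]big1 ?addr0 // => k _.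
  by rewrite /ampl /= scaler0.
rewrite big_sumType /= [X in _ = X + _]big1 ?add0r // => k _.
by rewrite /ampl /= scaler0.
Qed.

Lemma hull_direct_sum (I I' : finType) t (y : I -> I -> V) (z : I' -> I' -> V) : 0 <= t ->
  hull t y -> hull t z -> hull t (fun x x' : I + I' => match x, x' with
    | inl i, inl i' => y i i' | inr i, inr i' => z i i' | _, _ => 0 end).
Proof.
move=> t0 [T [J [g [a [b [g_inj as_ bs yE]]]]]] [T' [J' [g' [a' [b' [g'_inj a't b't zE]]]]]].
exists (T + T')%type, (J + J')%type.
exists (fun x => match x with inl j => (inl (g j).1, (g j).2)
                            | inr j => (inr (g' j).1, (g' j).2) end).
exists (fun x y => match x, y with
    | inl i, inl j => a i j | inr i, inr j => a' i j | _, _ => 0 end).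
exists (fun x y => match x, y with
    | inl i, inl j => b i j | inr i, inr j => b' i j | _, _ => 0 end).
split; [|exact: opb_direct_sum (sqrtr_ge0 _) _ _|exact: opb_direct_sum (sqrtr_ge0 _) _ _|].
  move=> [j|j] [k|k] // [e1 e2]; congr (_ _); [apply: g_inj|apply: g'_inj];
  by rewrite [LHS]surjective_pairing [RHS]surjective_pairing e1 e2.
move=> [i|i] [i'|i']; rewrite big_sumType /=.
- rewrite [X in _ = _ + X]big1 ?addr0 => [|j _]; last first.
    by rewrite big1 // => k _; rewrite mul0r scale0r.
  rewrite yE; apply: eq_bigr => j _; rewrite big_sumType /=.
  by rewrite [X in _ = _ + X]big1 ?addr0 // => k _; rewrite mulr0 scale0r.
- rewrite !big1 ?addr0 // => j _; rewrite big_sumType /= !big1 ?addr0 // => k _;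
  by rewrite /ampl /= ?mulr0 ?mul0r ?scale0r ?scaler0.
- rewrite !big1 ?addr0 // => j _; rewrite big_sumType /= !big1 ?addr0 // => k _;
  by rewrite /ampl /= ?mulr0 ?mul0r ?scale0r ?scaler0.
- rewrite [X in _ = X + _]big1 ?add0r => [|j _]; last first.
    by rewrite big1 // => k _; rewrite mul0r scale0r.
  rewrite zE; apply: eq_bigr => j _; rewrite big_sumType /=.
  by rewrite [X in _ = X + _]big1 ?add0r // => k _; rewrite mulr0 scale0r.
Qed.

(** [p] and [q] are absorbed into the two factors. The hull wants equal bounds on both sides, so a
    scalar is first moved from one to the other. *)
Lemma hull_conj (I I' : finType) t (y : I -> I -> V) (p q : I' -> I -> C) P Q :
  0 <= t -> 0 <= P -> 0 <= Q -> opb p P -> opb q Q -> hull t y ->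
  hull (P * t * Q) (fun i i' => \sum_j \sum_k (p i j * q i' k) *: y j k).
Proof.
move=> t0 P0 Q0 pP qQ [T [J [g [a [b [g_inj at_ bt yE]]]]]].
have opb_0 (K L : finType) (c : K -> L -> C) : opb c 0 -> forall k l, c k l = 0.
  move=> c0 k l; have := c0 (fun l' => (l' == l)%:R); rewrite mul0r => le0.
  have e0 : l2F (fmulv c (fun l' => (l' == l)%:R)) = 0.
    by apply/eqP; rewrite eq_le le0 l2F_ge0.
  have := l2F_eq0 k e0; rewrite /fmulv (bigD1 l) //= eqxx mulr1 big1 ?addr0 // => m ml.
  by rewrite (negPf ml) mulr0.
(* A bound 0 forces [p] or [q] to vanish, so the product is 0; this case cannot be balanced. *)
have [PQ0|PQ0] := eqVneq (P * Q) 0.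
  rewrite mulrAC PQ0 mul0r; apply: eq_hull (hull0 I') => i i'.
  move/eqP: PQ0; rewrite mulf_eq0 => /orP[] /eqP e0.
    rewrite e0 in pP; rewrite big1 // => j _; rewrite big1 // => k _.
    by rewrite (opb_0 _ _ _ pP) mul0r scale0r.
  rewrite e0 in qQ; rewrite big1 // => j _; rewrite big1 // => k _.
  by rewrite (opb_0 _ _ _ qQ) mulr0 scale0r.
have [Pn0 Qn0] : P != 0 /\ Q != 0.
  by move: PQ0; rewrite mulf_eq0 negb_or => /andP.
have Pp : 0 < P by rewrite lt_neqAle eq_sym Pn0.
have Qp : 0 < Q by rewrite lt_neqAle eq_sym Qn0.
(* Multiplying [p] by [u] and [q] by its inverse gives both the bound [Num.sqrt (P * Q)]. *)
pose u := Num.sqrt (Q / P).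
have u0 : 0 < u by rewrite sqrtr_gt0 divr_gt0.
have u2 : u ^+ 2 = Q / P by rewrite sqr_sqrtr // divr_ge0.
have uP : u * P = Num.sqrt (P * Q).
  rewrite -[u * P]ger0_norm ?mulr_ge0 ?ltW // -sqrtr_sqr exprMn u2 expr2.
  by congr Num.sqrt; field.
have uQ : u^-1 * Q = Num.sqrt (P * Q).
  rewrite -[u^-1 * Q]ger0_norm ?mulr_ge0 ?invr_ge0 ?ltW // -sqrtr_sqr exprMn exprVn u2 expr2.
  by congr Num.sqrt; field; rewrite Pn0 Qn0.
have sE : Num.sqrt (P * t * Q) = Num.sqrt (P * Q) * Num.sqrt t.
  by rewrite mulrAC sqrtrM // mulr_ge0.
exists T, J, g, (fmulm (fun i j => u%:C * p i j) a), (fmulm (fun i j => u^-1%:C * q i j) b).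
split=> //.
- rewrite sE; apply: opbM => //; first exact: sqrtr_ge0.
  by have := opbZ u%:C pP; rewrite cnorm_nneg ?ltW // uP.
- rewrite sE; apply: opbM => //; first exact: sqrtr_ge0.
  by have := opbZ u^-1%:C qQ; rewrite cnorm_nneg ?invr_ge0 ?ltW // uQ.
move=> i i'.
transitivity (\sum_j \sum_k \sum_j' \sum_k' ((p i j * a j j') * (q i' k * b k k')) *:
   ampl (g j') (g k')).
  apply: eq_bigr => j _; apply: eq_bigr => k _; rewrite yE scaler_sumr.
  apply: eq_bigr => j' _; rewrite scaler_sumr; apply: eq_bigr => k' _.
  by rewrite scalerA; congr (_ *: _); ring.
under eq_bigr do rewrite exchange_big /=.
rewrite exchange_big; apply: eq_bigr => j' _ /=.
under eq_bigr do rewrite exchange_big /=.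
rewrite exchange_big; apply: eq_bigr => k' _ /=.
rewrite /fmulm big_distrlr scaler_suml; apply: eq_bigr => j _ /=.
rewrite scaler_suml; apply: eq_bigr => k _; congr (_ *: _).
have uu : u%:C * u^-1%:C = 1 by rewrite -rmorphM /= mulfV // gt_eqF.
rewrite -[LHS]mul1r -uu; ring.
Qed.

End Hull.

(** * The closed hull and its gauge norm *)

Section Gauge.
Variable R : realType.
Local Notation C := R[i].
Variables (V : lmodType C) (mn : forall n, 'M[V]_n -> R).
Hypothesis mnP : opspace mn.
Variables (f : nat -> nat -> V) (B : R).
Hypotheses (B0 : 0 <= B) (fB : forall N, trunc_norm mn N f <= B).

Definition hull_closure (I : finType) t (w : I -> I -> V) := forall e : R, 0 < e ->
  exists y, hull f t y /\ nF mn (fun i j => w i j - y i j) < e.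

Local Notation Cl := hull_closure.

Lemma hull_Cl (I : finType) t (w : I -> I -> V) : hull f t w -> Cl t w.
Proof.
move=> hw e e0; exists w; split=> //; rewrite (@eq_nF _ _ _ _ _ (fun _ _ => 0)) ?nF0 //.
by move=> i j; rewrite subrr.
Qed.

Lemma eq_Cl (I : finType) t (y z : I -> I -> V) : y =2 z -> Cl t y -> Cl t z.
Proof.
move=> yz yt e /yt [x [hx le]]; exists x; split=> //.
by move: le; congr (_ < _); apply: eq_nF => i j; rewrite yz.
Qed.

Lemma Cl_mono (I : finType) t t' (y : I -> I -> V) : t <= t' -> Cl t y -> Cl t' y.
Proof. by move=> tt' yt e /yt [x [hx le]]; exists x; split=> //; apply: hull_mono hx. Qed.

Lemma Cl_bound (I : finType) t (w : I -> I -> V) : 0 <= t -> Cl t w -> nF mn w <= t * B.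
Proof.
move=> t0 wt; apply/ler_addgt0Pr => e /wt [y [hy le]].
rewrite addrC; apply: le_trans (lerD (ltW le) (hull_bound mnP B0 fB t0 hy)).
by apply: le_trans (nFD mnP _ _); apply/eqW/eq_nF => i j; rewrite subrK.
Qed.

Lemma Cl0 (I : finType) : Cl 0 (fun _ _ : I => 0).
Proof. exact/hull_Cl/hull0. Qed.

Lemma ClD (I : finType) s t (y z : I -> I -> V) : 0 <= s -> 0 <= t ->
  Cl s y -> Cl t z -> Cl (s + t) (fun i j => y i j + z i j).
Proof.
move=> s0 t0 ys zt e e0; have e20 : 0 < e / 2 by rewrite divr_gt0.
have [y' [hy' le1]] := ys _ e20; have [z' [hz' le2]] := zt _ e20.
exists (fun i j => y' i j + z' i j); split; first exact: hullD.
rewrite [e]splitr; apply: le_lt_trans (ltrD le1 le2).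
apply: le_trans (nFD mnP _ _); apply/eqW/eq_nF => i j.
by rewrite opprD addrACA.
Qed.

Lemma Cl_direct_sum (I I' : finType) t (y : I -> I -> V) (z : I' -> I' -> V) : 0 <= t ->
  Cl t y -> Cl t z -> Cl t (fun x x' : I + I' => match x, x' with
    | inl i, inl i' => y i i' | inr i, inr i' => z i i' | _, _ => 0 end).
Proof.
move=> t0 yt zt e e0.
have [y' [hy' le1]] := yt _ e0; have [z' [hz' le2]] := zt _ e0.
exists (fun x x' : I + I' => match x, x' with
    | inl i, inl i' => y' i i' | inr i, inr i' => z' i i' | _, _ => 0 end).
split; first exact: hull_direct_sum.
have : Num.max (nF mn (fun i j => y i j - y' i j)) (nF mn (fun i j => z i j - z' i j)) < e.
  by rewrite gt_max le1 le2.
apply: le_lt_trans; apply: le_trans (nF_sum_type mnP _ _); apply/eqW/eq_nF.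
by move=> [i|i] [j|j]; rewrite ?subrr.
Qed.

Lemma Cl_conj (I I' : finType) t (y : I -> I -> V) (p q : I' -> I -> C) P Q :
  0 <= t -> 0 <= P -> 0 <= Q -> opb p P -> opb q Q -> Cl t y ->
  Cl (P * t * Q) (fun i i' => \sum_j \sum_k (p i j * q i' k) *: y j k).
Proof.
move=> t0 P0 Q0 pP qQ yt e e0; pose D := P * Q + 1.
have D0 : 0 < D by rewrite ltr_wpDl ?mulr_ge0.
have [y' [hy' le]] := yt _ (divr_gt0 e0 D0).
exists (fun i i' => \sum_j \sum_k (p i j * q i' k) *: y' j k); split.
  exact: hull_conj.
have := nF_smul mnP (fun i j => y i j - y' i j) P0 Q0 pP (opbT Q0 qQ).
have le2 : P * nF mn (fun i j => y i j - y' i j) * Q < e.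
  rewrite mulrAC; apply: le_lt_trans (_ : P * Q * (e / D) < e).
    by rewrite ler_wpM2l ?mulr_ge0 // ltW.
  by rewrite mulrCA -[ltRHS]mulr1 ltr_pM2l // ltr_pdivrMr // mul1r ltrDl.
move=> le1; apply: le_lt_trans le2; apply: le_trans le1; apply/eqW/eq_nF => i i'.
rewrite -sumrB; apply: eq_bigr => j _; rewrite -sumrB; apply: eq_bigr => k _.
by rewrite scalerBr.
Qed.

Lemma Cl_compress (I I' : finType) t (y : I -> I -> V) (g h : I' -> option I) : 0 <= t ->
  pinj g -> pinj h -> Cl t y ->
  Cl t (fun i j => if g i is Some i' then if h j is Some j' then y i' j' else 0 else 0).
Proof.
move=> t0 g_inj h_inj yt.
have := Cl_conj t0 ler01 ler01 (opb_pmat g_inj) (opb_pmat h_inj) yt.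
rewrite mulr1 mul1r; apply: eq_Cl => i j; exact: sum_pmat_scale.
Qed.

Lemma ClZ (I : finType) t c (y : I -> I -> V) : 0 <= t ->
  Cl t y -> Cl (cnorm c * t) (fun i j => c *: y i j).
Proof.
move=> t0 yt.
have pc : opb (fun i j : I => c * (i == j)%:R) (cnorm c).
  by have := opbZ c (@opb_id R I); rewrite mulr1.
have := Cl_conj t0 (cnorm_ge0 c) ler01 pc (@opb_id R I) yt.
rewrite mulr1; apply: eq_Cl => i j.
rewrite (bigD1 i) //= eqxx mulr1 [X in _ + X]big1 ?addr0 => [|k ki]; last first.
  by rewrite big1 // => l _; rewrite eq_sym (negPf ki) mulr0 mul0r scale0r.
rewrite (bigD1 j) //= eqxx mulr1 big1 ?addr0 // => k kj.
by rewrite eq_sym (negPf kj) mulr0 scale0r.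
Qed.

Lemma hullZ_le (I : finType) t c (y : I -> I -> V) : 0 <= t -> 0 <= c ->
  hull f t y -> hull f (c * t) (fun i j => c%:C *: y i j).
Proof.
move=> t0 c0 yt.
have pc : opb (fun i j : I => c%:C * (i == j)%:R) c.
  by have := opbZ c%:C (@opb_id R I); rewrite mulr1 cnorm_nneg.
have := hull_conj t0 c0 ler01 pc (@opb_id R I) yt.
rewrite mulr1; apply: eq_hull => i j.
rewrite (bigD1 i) //= eqxx mulr1 [X in _ + X]big1 ?addr0 => [|k ki]; last first.
  by rewrite big1 // => l _; rewrite eq_sym (negPf ki) mulr0 mul0r scale0r.
rewrite (bigD1 j) //= eqxx mulr1 big1 ?addr0 // => k kj.
by rewrite eq_sym (negPf kj) mulr0 scale0r.
Qed.

(** Scaling by [t / (t + d)] brings the hull at [t + d] into the hull at [t] and displaces points by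
    at most [d * B]. Consequently the infimum in [gauge] is attained, and balls for the gauge are
    exactly closed hulls. *)
Lemma Cl_right_continuous (I : finType) t (w : I -> I -> V) : 0 <= t ->
  (forall e, 0 < e -> Cl (t + e) w) -> Cl t w.
Proof.
move=> t0 wt e e0; pose d := e / ((B + 1) *+ 2).
have D0 : 0 < (B + 1) *+ 2 by rewrite pmulrn_lgt0 // ltr_wpDl.
have d0 : 0 < d by rewrite divr_gt0.
have [y [hy le]] := wt d d0 (e / 2) (divr_gt0 e0 (ltr0n _ 2)).
have td0 : 0 < t + d by rewrite ltr_wpDl.
pose c := t / (t + d).
have c0 : 0 <= c by rewrite divr_ge0 // ltW.
have ct : c * (t + d) = t by rewrite divfK // gt_eqF.
exists (fun i j => c%:C *: y i j); split.
  by rewrite -{1}ct; apply: hullZ_le => //; apply: ltW.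
have c1 : 0 <= 1 - c by rewrite subr_ge0 ler_pdivrMr // mul1r lerDl ltW.
have le2 : nF mn (fun i j => (1 - c)%:C *: y i j) <= d * B.
  rewrite nFZ // cnorm_nneg //.
  apply: le_trans (ler_wpM2l c1 (hull_bound mnP B0 fB (ltW td0) hy)) _.
  by rewrite mulrA mulrBl ct mul1r [t + d]addrC addrK.
have le3 : d * B <= e / 2.
  rewrite /d mulrAC ler_pdivrMr //.
  have -> : e / 2 * ((B + 1) *+ 2) = e * (B + 1) by field.
  by rewrite ler_pM2l // lerDl.
rewrite [e]splitr; apply: le_lt_trans (ltr_leD le (le_trans le2 le3)).
apply: le_trans (nFD mnP _ _); apply/eqW/eq_nF => i j.
by rewrite rmorphB /= scalerBl scale1r addrA subrK.
Qed.

Lemma Cl_closed (I : finType) t (w : I -> I -> V) :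
  (forall e, 0 < e -> exists2 y, Cl t y & nF mn (fun i j => w i j - y i j) < e) -> Cl t w.
Proof.
move=> wt e e0; have e20 : 0 < e / 2 by rewrite divr_gt0.
have [y /(_ _ e20)[z [hz le1]] le2] := wt _ e20.
exists z; split=> //; rewrite [e]splitr; apply: le_lt_trans (ltrD le2 le1).
by apply: le_trans (nFD mnP _ _); apply/eqW/eq_nF => i j; rewrite addrA subrK.
Qed.

Definition gauge (I : finType) (w : I -> I -> V) : R :=
  inf [set t | 0 <= t /\ Cl t w].

Definition gauge_finite (I : finType) (w : I -> I -> V) := exists t, 0 <= t /\ Cl t w.

Lemma gauge_le (I : finType) t (w : I -> I -> V) : 0 <= t -> Cl t w -> gauge w <= t.
Proof. by move=> t0 wt; apply: ge_inf; [exists 0 => s [] | split]. Qed.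

Lemma gauge_ge0 (I : finType) (w : I -> I -> V) : gauge_finite w -> 0 <= gauge w.
Proof. by move=> [t tw]; apply: lb_le_inf; [exists t | move=> s []]. Qed.

Lemma Cl_gauge (I : finType) (w : I -> I -> V) : gauge_finite w -> Cl (gauge w) w.
Proof.
move=> fw; apply: Cl_right_continuous (gauge_ge0 fw) _ => e e0.
have [|t [t0 wt] le] := @inf_adherent _ [set t | 0 <= t /\ Cl t w] _ e0.
  by case: fw => t tw; split; [exists t | exists 0 => s []].
exact: Cl_mono (ltW le) wt.
Qed.

(** A matrix is the sum of its one-entry matrices. The gauge space is defined by 1 by 1 gauges, and
    this makes every matrix over it have finite gauge, so that no infimum over an empty set
    occurs. *)
Lemma gauge_finite_entries (I : finType) (w : I -> I -> V) :
  (forall i j, gauge_finite (fun _ _ : 'I_1 => w i j)) -> gauge_finite w.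
Proof.
move=> wfin.
have fin_sum T (r : seq T) (y : T -> I -> I -> V) : (forall t, gauge_finite (y t)) ->
    gauge_finite (fun i j => \sum_(t <- r) y t i j).
  move=> yfin; elim: r => [|t r [s [s0 ys]]].
    by exists 0; split=> //; apply: eq_Cl (Cl0 I) => i j; rewrite big_nil.
  have [s' [s'0 ys']] := yfin t; exists (s' + s); split; first exact: addr_ge0.
  by apply: eq_Cl (ClD s'0 s0 ys' ys) => i j; rewrite big_cons.
have pd k : @pinj I 'I_1 (fun i => if i == k then Some ord0 else None).
  by move=> i i' j; case: eqP => // -> _; case: eqP => // ->.
pose y (t : I * I) i j := if i == t.1 then if j == t.2 then w t.1 t.2 else 0 else 0.
have [|s [s0 ws]] := fin_sum _ (index_enum (I * I)%type) y.
  move=> [k l]; have [s [s0 ws]] := wfin k l; exists s; split=> //.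
  apply: eq_Cl (Cl_compress s0 (pd k) (pd l) ws) => i j.
  by rewrite /y /=; case: eqP => // _; case: eqP.
exists s; split=> //; apply: eq_Cl ws => i j.
rewrite (bigD1 (i, j)) //= /y /= !eqxx big1 ?addr0 // => -[k l] /=.
rewrite xpair_eqE negb_and => /orP[] /negPf ne; first by rewrite [i == k]eq_sym ne.
by rewrite [j == l]eq_sym ne; case: ifP.
Qed.

Lemma gauge_finite_entry (I : finType) (w : I -> I -> V) i j :
  gauge_finite w -> gauge_finite (fun _ _ : 'I_1 => w i j).
Proof.
have p1 k : @pinj 'I_1 I (fun=> Some k).
  by move=> a b c _ _; rewrite [a]ord1 [b]ord1.
by move=> [t [t0 wt]]; exists t; split=> //; apply: Cl_compress (p1 i) (p1 j) wt.
Qed.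

Definition gauge_pred : {pred V} := fun v => `[< gauge_finite (fun _ _ : 'I_1 => v) >].

Lemma gauge_pred_closed : submod_closed gauge_pred.
Proof.
split=> [|c u v]; rewrite !unfold_in.
  by apply/asboolP; exists 0; split=> //; apply: Cl0.
move=> /asboolP[s [s0 us]] /asboolP[t [t0 vt]]; apply/asboolP; exists (cnorm c * s + t).
by split; [rewrite addr_ge0 ?mulr_ge0 ?cnorm_ge0 | apply: ClD (ClZ _ _ us) vt;
  rewrite ?mulr_ge0 ?cnorm_ge0].
Qed.

Definition gauge_space : lmodType C := subspace gauge_pred_closed.
Local Notation W := gauge_space.
Definition gval : W -> V := @subspace_val _ _ _ _.

Lemma gval_linear : linear gval. Proof. by []. Qed.

Lemma gval_inj : injective gval. Proof. exact: val_inj. Qed.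

Lemma gval_finite (I : finType) (w : I -> I -> W) : gauge_finite (fun i j => gval (w i j)).
Proof. by apply: gauge_finite_entries => i j; apply/asboolP; apply: valP (w i j). Qed.

Definition gauge_norm n (w : 'M[W]_n) : R := gauge (fun i j => gval (w i j)).

Lemma gauge_normP n (w : 'M[W]_n) : Cl (gauge_norm w) (fun i j => gval (w i j)).
Proof. exact/Cl_gauge/gval_finite. Qed.

Lemma gauge_norm_ge0 n (w : 'M[W]_n) : 0 <= gauge_norm w.
Proof. exact/gauge_ge0/gval_finite. Qed.

Lemma gauge_norm_leP n (w : 'M[W]_n) t :
  0 <= t -> gauge_norm w <= t <-> Cl t (fun i j => gval (w i j)).
Proof.
by move=> t0; split=> [wt|]; [apply: Cl_mono wt (gauge_normP w) | apply: gauge_le].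
Qed.

Lemma mn_gval_le n (w : 'M[W]_n) : mn (map_mx gval w) <= gauge_norm w * B.
Proof.
apply: le_trans (Cl_bound (gauge_norm_ge0 w) (gauge_normP w)).
by rewrite mn_nF //; apply/eqW/eq_nF => i j; rewrite mxE.
Qed.

Lemma gauge_norm_scale_le n (w : 'M[W]_n) c :
  gauge_norm (map_mx (fun v => c *: v) w) <= cnorm c * gauge_norm w.
Proof.
apply/gauge_norm_leP; first by rewrite mulr_ge0 ?cnorm_ge0 ?gauge_norm_ge0.
by apply: eq_Cl (ClZ c (gauge_norm_ge0 w) (gauge_normP w)) => i j; rewrite mxE.
Qed.

Lemma gauge_norm_block_le m n (x : 'M[W]_m) (y : 'M[W]_n) t : 0 <= t ->
  (gauge_norm (block_mx x 0 0 y) <= t) = (gauge_norm x <= t) && (gauge_norm y <= t).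
Proof.
move=> t0; apply/idP/andP => [/(gauge_norm_leP _ t0) xyt | [xt yt]].
  have pl : @pinj 'I_m 'I_(m + n) (fun i => Some (lshift n i)).
    by move=> i i' j /Some_inj <- /Some_inj/lshift_inj.
  have pr : @pinj 'I_n 'I_(m + n) (fun i => Some (rshift m i)).
    by move=> i i' j /Some_inj <- /Some_inj/rshift_inj.
  split; apply/(gauge_norm_leP _ t0).
    by apply: eq_Cl (Cl_compress t0 pl pl xyt) => i j; rewrite block_mxEul.
  by apply: eq_Cl (Cl_compress t0 pr pr xyt) => i j; rewrite block_mxEdr.
apply/(gauge_norm_leP _ t0).
have ps : @pinj 'I_(m + n) ('I_m + 'I_n)%type (fun i => Some (split i)).
  by move=> i i' j /Some_inj <- /Some_inj/(congr1 (@unsplit _ _)); rewrite !splitK.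
have := Cl_direct_sum t0 ((gauge_norm_leP _ t0).1 xt) ((gauge_norm_leP _ t0).1 yt).
move/(Cl_compress t0 ps ps); apply: eq_Cl => i j.
rewrite -[in RHS](splitK i) -[in RHS](splitK j).
case: (split i) => i'; case: (split j) => j' /=.
- by rewrite block_mxEul.
- by rewrite block_mxEur mxE.
- by rewrite block_mxEdl mxE.
- by rewrite block_mxEdr.
Qed.

Lemma gauge_opspace : opspace gauge_norm.
Proof.
split.
- split=> [n w|n w w0|n x y|n c w].
  + exact: gauge_norm_ge0.
  + have := mn_gval_le w; rewrite w0 mul0r => le0.
    have [[pos sep _ _] _ _ _] := mnP.
    have /sep/matrixP wE : mn (map_mx gval w) = 0 by apply/eqP; rewrite eq_le le0 pos.
    by apply/matrixP => i j; apply: gval_inj; have := wE i j; rewrite !mxE.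
  + apply/gauge_norm_leP; first by rewrite addr_ge0 ?gauge_norm_ge0.
    have xyD := ClD (gauge_norm_ge0 x) (gauge_norm_ge0 y) (gauge_normP x) (gauge_normP y).
    by apply: eq_Cl xyD => i j; rewrite mxE.
  + apply/eqP; rewrite eq_le gauge_norm_scale_le /=.
    have [->|c0] := eqVneq c 0; first by rewrite cnorm0 mul0r gauge_norm_ge0.
    have nc0 : 0 < cnorm c.
      by rewrite lt_neqAle cnorm_ge0 andbT eq_sym; apply: contra_neq c0; apply: cnorm_eq0.
    have := gauge_norm_scale_le (map_mx (fun v => c *: v) w) c^-1.
    have -> : map_mx (fun v => c^-1 *: v) (map_mx (fun v => c *: v) w) = w.
      by apply/matrixP => i j; rewrite !mxE scalerA mulVf // scale1r.
    by rewrite cnormV ler_pdivlMl.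
- move=> m n x y; apply/eqP; rewrite eq_le.
  rewrite gauge_norm_block_le ?le_max ?gauge_norm_ge0 // !lexx orbT /=.
  by have := gauge_norm_block_le x y (gauge_norm_ge0 (block_mx x 0 0 y)); rewrite lexx ge_max => <-.
- move=> m n a x b; apply/gauge_norm_leP.
    by rewrite !mulr_ge0 ?gauge_norm_ge0 ?opnormF_ge0.
  have aP : opb (fun i j => a i j) (opnorm a) by apply: opb_opnormF.
  have bP : opb (fun i j => b i j) (opnorm b) by apply: opb_opnormF.
  have b0 : 0 <= opnorm b by apply: opnormF_ge0.
  have a0 : 0 <= opnorm a by apply: opnormF_ge0.
  apply: eq_Cl (Cl_conj (gauge_norm_ge0 x) a0 b0 aP (opbT b0 bP) (gauge_normP x)) => i j.
  rewrite mxE (linear_fun_sum gval_linear); apply: eq_bigr => k _.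
  by rewrite (linear_fun_sum gval_linear); apply: eq_bigr.
(* Completeness: the limit is found in [V], and because gauge balls are closed in [V], the Cauchy
   condition for the gauge passes to the limit. *)
move=> u uC; have [_ _ _ compl] := mnP.
have nrmE (w : W) : nrm mn (gval w) <= gauge_norm (mx1 w) * B.
  apply: le_trans (mn_gval_le _); apply/eqW; congr mn.
  by apply/matrixP => i j; rewrite !mxE.
have [|v vlim] := compl (fun k => gval (u k)).
  move=> e e0; have D0 : 0 < B + 1 by rewrite ltr_wpDl.
  have [K KP] := uC _ (divr_gt0 e0 D0); exists K => k l Kk Kl.
  apply: le_lt_trans (nrmE (u k - u l)) _.
  apply: le_lt_trans (ler_wpM2r B0 (ltW (KP k l Kk Kl))) _.
  by rewrite -mulrA -[ltRHS]mulr1 ltr_pM2l // ltr_pdivrMl // mulr1 ltrDl.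
have close e : 0 < e -> exists K, forall k, (K <= k)%N ->
    Cl e (fun _ _ : 'I_1 => gval (u k) - v).
  move=> e0; have [K KP] := uC e e0; exists K => k Kk; apply: Cl_closed => d d0.
  have [K' K'P] := vlim d d0; set l := maxn K K'.
  exists (fun _ _ => gval (u k) - gval (u l)).
    have /(gauge_norm_leP _ (ltW e0)) := ltW (KP k l Kk (leq_maxl _ _)).
    by apply: eq_Cl => i j; rewrite mxE.
  have := K'P l (leq_maxr _ _); rewrite -[mn _]/(nrm mn _) nrm_nF //.
  congr (_ < _); apply: eq_nF => i j.
  by rewrite opprB [RHS]addrC addrA subrK.
(* [v] is [u K] minus [u K - v], and both have finite gauge. *)
have vW : v \in gauge_pred.
  have [K /(_ K (leqnn _)) KP] := close 1 ltr01.
  have [t [t0 ut]] := gval_finite (fun _ _ : 'I_1 => u K).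
  apply/asboolP; exists (t + cnorm (-1) * 1); split.
    by rewrite addr_ge0 ?mulr_ge0 ?cnorm_ge0.
  apply: eq_Cl (ClD t0 _ ut (ClZ (-1) ler01 KP)) => [i j|]; last first.
    by rewrite mulr_ge0 ?cnorm_ge0.
  by rewrite scaleN1r opprB addrCA subrr addr0.
exists (Subspace vW : W) => e e0; have e20 : 0 < e / 2 by rewrite divr_gt0.
have [K KP] := close _ e20; exists K => k /KP ut.
apply: le_lt_trans (_ : e / 2 < e); last by rewrite ltr_pdivrMr // mulr_natr mulr2n ltrDl.
by apply/gauge_norm_leP; [exact: ltW | apply: eq_Cl ut => i j; rewrite mxE].
Qed.

End Gauge.

(** * Operator compactness of the inclusion of the gauge space *)

Section GaugeInclusion.
Variable R : realType.
Local Notation C := R[i].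
Variables (V : lmodType C) (mn : forall n, 'M[V]_n -> R).
Hypothesis mnP : opspace mn.
Variables (f : nat -> nat -> V) (B : R).
Hypotheses (B0 : 0 <= B) (fB : forall N, trunc_norm mn N f <= B).
Variable xs : nat -> nat -> nat -> V.
Hypothesis xs_kelt : kelt mn xs.
Hypothesis xs_f : forall N, exists K, forall l, (K <= l)%N ->
  forall i j, (i < N)%N -> (j < N)%N -> xs l i j = f i j.

Lemma fmulm_ampliation n (I J : finType) (K : Type) (a : I -> J -> C)
    (X : 'I_n * J -> K -> C) p i z :
  \sum_(y : 'I_n * J) (if p == y.1 then a i y.2 else 0) * X y z = \sum_j a i j * X (p, j) z.
Proof.
rewrite sum_pair (bigD1 p) //= eqxx [X in _ + X]big1 ?addr0 // => q qp.
by rewrite big1 // => j _; rewrite eq_sym (negPf qp) mul0r.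
Qed.

(** The coefficients a, b are collected into a trace class matrix [s], keeping only pairs of indices
    in the same copy of [f]. On a test array z, [s] acts as (1 (x) a) Y (1 (x) b)^T with Y a
    compression of copies of z, so [tnorm s] is at most 1. *)
Lemma hull_amchull k (y : 'I_k -> 'I_k -> V) :
  hull f 1 y -> amchull mn xs (\matrix_(i, j) y i j).
Proof.
move=> [T [J [g [a [b [g_inj]]]]]]; rewrite sqrtr1 => a1 b1 yE.
pose N := (\max_j (g j).2).+1.
have gN j : ((g j).2 < N)%N by rewrite ltnS (leq_bigmax j).
pose h j : 'I_N := Ordinal (gN j).
pose s p q : 'M[C]_N := \matrix_(P, Q) \sum_j \sum_l
  (if ((g j).1 == (g l).1) && ((h j, h l) == (P, Q)) then a p j * b q l else 0).
have sE (U : lmodType C) p q (z : nat -> nat -> U) :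
    \sum_i \sum_j s p q i j *: z i j =
    \sum_j \sum_l (a p j * b q l) *: (if (g j).1 == (g l).1 then z (g j).2 (g l).2 else 0).
  transitivity (\sum_i \sum_i' \sum_j \sum_l
    (if ((g j).1 == (g l).1) && ((h j, h l) == (i, i')) then a p j * b q l else 0) *: z i i').
    apply: eq_bigr => i _; apply: eq_bigr => i' _.
    rewrite mxE scaler_suml; apply: eq_bigr => j _.
    by rewrite scaler_suml.
  under eq_bigr do rewrite exchange_big /=.
  rewrite exchange_big; apply: eq_bigr => j _ /=.
  under eq_bigr do rewrite exchange_big /=.
  rewrite exchange_big; apply: eq_bigr => l _ /=.
  rewrite (bigD1 (h j)) //= [X in _ + X]big1 ?addr0 => [|i ij]; last first.
    by rewrite big1 // => i' _; rewrite xpair_eqE [h j == i]eq_sym (negPf ij) andbF scale0r.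
  rewrite (bigD1 (h l)) //= big1 ?addr0 => [|i il]; last first.
    by rewrite xpair_eqE [h l == i]eq_sym (negPf il) !andbF scale0r.
  by rewrite eqxx andbT; case: ifP => _; rewrite ?scaler0 ?scale0r.
exists N, s; split.
  apply: tnorm_le => n z zN; apply: opnormF_le => //.
  pose Y (x x' : 'I_n * J) : C := if (g x.2).1 == (g x'.2).1
    then z x.1 x'.1 (g x.2).2 (g x'.2).2 else 0.
  have Y1 : opb Y 1.
    pose e (x : 'I_n * J) := Some ((g x.2).1, (x.1, h x.2)).
    have e_inj : pinj e.
      move=> [p j] [q l] x [<-] [e1 -> e2]; congr pair; apply: g_inj.
      by rewrite [LHS]surjective_pairing [RHS]surjective_pairing e1 e2.
    have := opb_sub ler01 e_inj e_inj (opb_block_diag ler01 (fun _ : T => zN)).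
    by apply: eq_opb.
  have := opbM ler01 (opb_block_diag ler01 (fun _ : 'I_n => a1))
    (opbM ler01 Y1 (opbT ler01 (opb_block_diag ler01 (fun _ : 'I_n => b1)))).
  rewrite !mulr1; apply: eq_opb => -[p i] [q j].
  rewrite [LHS](fmulm_ampliation a (fmulm Y (fun (y : 'I_n * J) (x : 'I_n * 'I_k) =>
    if x.1 == y.1 then b x.2 y.2 else 0)) p i (q, j)) /slice_block /=.
  have /= -> := sE (C : lmodType C) i j (z p q).
  apply: eq_bigr => l _.
  transitivity (a i l * \sum_l' b j l' * Y (p, l) (q, l')).
    congr (_ * _); rewrite -(fmulm_ampliation b (fun x x' => Y x' x) q j (p, l)).
    by apply: eq_bigr => x _; rewrite mulrC.
  rewrite mulr_sumr; apply: eq_bigr => l' _.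
  by rewrite /GRing.scale /= mulrA.
(* Only entries below [N] are sliced, and those of [xs l] are eventually equal to those of [f]. *)
have [K KP] := xs_f N; move=> e e0; exists K => l Kl.
suff -> : slice s (xs l) - \matrix_(i, j) y i j = 0 by rewrite mn0.
apply/matrixP => p q; rewrite !mxE; apply/eqP; rewrite subr_eq0; apply/eqP.
rewrite yE -(sE V p q f); apply: eq_bigr => i _; apply: eq_bigr => j _.
by rewrite KP.
Qed.

Lemma gval_cb : cbmap (@gauge_norm _ _ _ mnP f) mn (@gval _ _ _ mnP f).
Proof.
split; first exact: gval_linear.
by exists B => n w; rewrite mulrC; apply: mn_gval_le.
Qed.

(** The image of a unit ball is the whole closed hull at parameter 1, which settles closedness; the
    hull itself is dense in it and lies in the absolutely matrix convex hull of [xs]. *)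
Lemma gval_op_compact : op_compact_map (@gauge_norm _ _ _ mnP f) mn (@gval _ _ _ mnP f).
Proof.
split=> [n y ycl|].
  have y1 : hull_closure mn f 1 (fun i j => y i j).
    apply: (Cl_closed mnP) => e e0; have [_ [[w w1 <-] yw]] := ycl e e0.
    exists (fun i j => gval (w i j)); first by apply/(gauge_norm_leP B0 fB).
    move: yw; rewrite mn_nF //; congr (_ < _); apply: eq_nF => i j.
    by rewrite !mxE.
  have yW i j : y i j \in gauge_pred mn f.
    apply/asboolP; apply: (gauge_finite_entry mnP (w := fun i j => y i j)).
    by exists 1; split; [exact: ler01 | exact: y1].
  exists (\matrix_(i, j) (Subspace (yW i j) : gauge_space mnP f)) => /=.
    apply/(gauge_norm_leP B0 fB) => //.
    by apply: eq_Cl y1 => i j; rewrite mxE.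
  by apply/matrixP => i j; rewrite !mxE.
exists xs; split=> // k _ [w w1 <-] e e0.
have /(gauge_norm_leP B0 fB _ ler01) wC := w1.
have [y [hy yw]] := wC _ e0.
exists (\matrix_(i, j) y i j); split; first exact: hull_amchull.
move: yw; rewrite mn_nF //; congr (_ < _); apply: eq_nF => i j.
by rewrite !mxE.
Qed.

End GaugeInclusion.

(** * Block diagonal elements of K(V) *)

Section BlockDiagonal.
Variable R : realType.
Local Notation C := R[i].
Variables (V : lmodType C) (mn : forall n, 'M[V]_n -> R).
Hypothesis mnP : opspace mn.

(** Partial: naturals that decode to nothing index zero rows and columns of [bdiag]. *)
Definition decode (P : nat) : option (nat * nat) := pickle_inv P.
Definition encode (ki : nat * nat) : nat := pickle ki.

Lemma encodeK ki : decode (encode ki) = Some ki.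
Proof. exact: pickleK_inv. Qed.

Lemma decode_inj P Q ki : decode P = Some ki -> decode Q = Some ki -> P = Q.
Proof.
move=> eP eQ; have := @pickle_invK (nat * nat)%type P; have := @pickle_invK (nat * nat)%type Q.
by rewrite -![pickle_inv _]/(decode _) eP eQ /= => -> ->.
Qed.

Lemma decode_bound N : exists L, forall P k i, (P < N)%N -> decode P = Some (k, i) ->
  (k < L)%N /\ (i < L)%N.
Proof.
elim: N => [|N [L LP]]; first by exists 0%N.
case eN : (decode N) => [[k i]|].
  exists (maxn L (maxn k.+1 i.+1)) => P k' i'; rewrite ltnS leq_eqVlt => /predU1P[->|PN].
    by rewrite eN => -[<- <-]; rewrite !leq_max !leqnn !orbT.
  by move=> /(LP _ _ _ PN)[kL iL]; rewrite !leq_max kL iL.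
exists L => P k i; rewrite ltnS leq_eqVlt => /predU1P[->|PN]; first by rewrite eN.
exact: LP.
Qed.

(* The block diagonal matrix diag(w 0, w 1, ...) along a pairing of nat. *)
Definition bdiag (w : nat -> nat -> nat -> V) (P Q : nat) : V :=
  if decode P is Some (k, i) then
    if decode Q is Some (l, j) then if k == l then w k i j else 0 else 0 else 0.

Lemma trunc_norm_bdiag w N M : 0 <= M ->
  (forall k L, trunc_norm mn L (w k) <= M) -> trunc_norm mn N (bdiag w) <= M.
Proof.
move=> M0 wM; have [L LP] := decode_bound N.
pose g (P : 'I_N) : option ('I_L * 'I_L) :=
  if decode P is Some (k, i) then
    if insub k is Some k' then if insub i is Some i' then Some (k', i') else None else None
  else None.
have g_inj : pinj g.
  move=> P Q [k i]; rewrite /g; case eP : (decode P) => [[k1 i1]|] //.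
  case: insubP => // k1' _ vk1; case: insubP => // i1' _ vi1 [e1 e2].
  case eQ : (decode Q) => [[k2 i2]|] //.
  case: insubP => // k2' _ vk2; case: insubP => // i2' _ vi2 [e3 e4].
  apply/val_inj/(decode_inj eP); rewrite eQ /=.
  by rewrite -vk1 -vi1 -vk2 -vi2 e1 e2 e3 e4.
have := @nF_block _ _ _ mnP L _ (fun k (i j : 'I_L) => w k i j) M M0 (fun k => wM k L).
apply: le_trans; apply: le_trans (nF_compress mnP _ g_inj g_inj).
apply/eqW/eq_nF => P Q; rewrite /bdiag /g.
case eP : (decode P) => [[k i]|] //; have [kL iL] := LP _ _ _ (ltn_ord P) eP.
rewrite !insubT /=; case eQ : (decode Q) => [[l j]|] //.
by have [lL jL] := LP _ _ _ (ltn_ord Q) eQ; rewrite !insubT.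
Qed.

Variables (z : nat -> nat -> nat -> V) (b : nat -> R).
Hypotheses (z_supp : forall k, fsupp (z k)) (zb : forall k N, trunc_norm mn N (z k) <= b k).
Hypothesis b0 : forall e : R, 0 < e -> exists K, forall k, (K <= k)%N -> b k < e.

Definition bdiag_seq (l : nat) := bdiag (fun k i j => if (k < l)%N then z k i j else 0).

Lemma bdiag_seq_fsupp l : fsupp (bdiag_seq l).
Proof.
have [N NP] : exists N, forall k i j, (k < l)%N -> (N <= i)%N \/ (N <= j)%N -> z k i j = 0.
  elim: l => [|l [N NP]]; first by exists 0%N.
  have [M MP] := z_supp l; exists (maxn N M) => k i j; rewrite ltnS leq_eqVlt !geq_max.
  case/predU1P => [->|kl]; first by move=> H; apply: MP; case: H => /andP[]; [left|right].
  by move=> H; apply: NP => //; case: H => /andP[]; [left|right].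
pose M := (\max_(k < l) \max_(i < N) (encode (k : nat, i : nat))).+1.
have MP P k i : (M <= P)%N -> decode P = Some (k, i) -> (k < l)%N -> (i < N)%N -> False.
  move=> MP eP kl iN.
  have PE : P = encode (k, i) by apply: (decode_inj eP); apply: encodeK.
  move: MP; rewrite PE /M ltnNge => /negP; apply.
  rewrite (leq_trans _ (leq_bigmax (Ordinal kl))) //=.
  exact: (leq_bigmax (Ordinal iN)).
exists M => P Q; rewrite /bdiag_seq /bdiag.
case eP : (decode P) => [[k i]|] //; case eQ : (decode Q) => [[k' j]|] //.
case: eqP => // ekk; case: ifP => // kl; rewrite -{k'}ekk in eQ.
case=> [MPP|MPQ].
  by apply: NP => //; left; rewrite leqNgt; apply/negP => iN; apply: MP MPP eP kl iN.
by apply: NP => //; right; rewrite leqNgt; apply/negP => jN; apply: MP MPQ eQ kl jN.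
Qed.

Lemma trunc_norm0 N : trunc_norm mn N (fun _ _ => 0) = 0.
Proof. exact: nF0. Qed.

(** Two truncations differ by a block diagonal matrix made of late blocks only, whose norm is
    governed by the largest of them, hence by the tail of [b]. *)
Lemma bdiag_seq_kelt : kelt mn bdiag_seq.
Proof.
split=> [l|e e0]; first exact: bdiag_seq_fsupp.
have e20 : 0 < e / 2 by rewrite divr_gt0.
have [K KP] := b0 e20; exists K => l m Kl Km.
apply: le_lt_trans (_ : e / 2 < e); last by rewrite ltr_pdivrMr // mulr_natr mulr2n ltrDl.
apply: (infnorm_le mnP) => N.
rewrite (eq_trunc_norm mn (g := bdiag (fun k i j =>
  if (k < l)%N then if (k < m)%N then 0 else z k i j
  else if (k < m)%N then - z k i j else 0))).
  apply: trunc_norm_bdiag => [|k L]; first exact: ltW.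
  have [lk|kl] := leqP l k; have [mk|km] := leqP m k.
  - by rewrite trunc_norm0 ltW.
  - by rewrite /trunc_norm nFN // ltW // (le_lt_trans (zb _ _)) // KP // (leq_trans Kl).
  - by rewrite ltW // (le_lt_trans (zb _ _)) // KP // (leq_trans Km).
  - by rewrite trunc_norm0 ltW.
move=> P Q _ _; rewrite /bdiag_seq /bdiag.
case: (decode P) => [[k i]|]; last by rewrite subrr.
case: (decode Q) => [[k' j]|]; last by rewrite subrr.
case: eqP => _; last by rewrite subrr.
by case: (k < l)%N; case: (k < m)%N; rewrite ?subrr ?subr0 ?sub0r.
Qed.

Lemma bdiag_seq_eventually N : exists K, forall l, (K <= l)%N ->
  forall i j, (i < N)%N -> (j < N)%N -> bdiag_seq l i j = bdiag z i j.
Proof.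
have [L LP] := decode_bound N; exists L => l Ll P Q PN QN.
rewrite /bdiag_seq /bdiag; case eP : (decode P) => [[k i]|] //.
by have [kL _] := LP _ _ _ PN eP; rewrite (leq_trans kL Ll).
Qed.

Lemma bdiag_bounded : exists2 B, 0 <= B & forall N, trunc_norm mn N (bdiag z) <= B.
Proof.
have [K KP] := b0 ltr01; pose B := 1 + \sum_(k < K) `|b k|.
have B0 : 0 <= B by rewrite addr_ge0 // sumr_ge0.
exists B => // N; apply: trunc_norm_bdiag => // k L; apply: le_trans (zb k L) _.
have [kK|Kk] := ltnP k K; last first.
  by apply: le_trans (ltW (KP _ Kk)) _; rewrite lerDl sumr_ge0.
rewrite /B (bigD1 (Ordinal kK)) //=; apply: le_trans (ler_norm _) _.
by rewrite addrCA lerDl addr_ge0 // sumr_ge0.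
Qed.

(** One copy and identity coefficients at the codes of block [k] suffice. Every block thus has gauge
    at most 1, whatever its norm in [V]. *)
Lemma hull_block k N : hull (bdiag z) 1 (fun i j : 'I_N => z k i j).
Proof.
exists unit, 'I_N, (fun i : 'I_N => (tt, encode (k, i : nat))).
exists (fun i j => (i == j)%:R), (fun i j => (i == j)%:R); rewrite sqrtr1; split.
- move=> i j [] /(congr1 decode); rewrite !encodeK => -[]; exact: val_inj.
- exact: opb_id.
- exact: opb_id.
move=> i j; rewrite (bigD1 i) //= eqxx [X in _ = _ + X]big1 ?addr0 => [|l li]; last first.
  by rewrite big1 // => m _; rewrite eq_sym (negPf li) mul0r scale0r.
rewrite (bigD1 j) //= eqxx mul1r big1 ?addr0 => [|l lj]; last first.
  by rewrite eq_sym (negPf lj) mulr0 scale0r.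
by rewrite scale1r /ampl /= /bdiag !encodeK eqxx.
Qed.

End BlockDiagonal.

(** * Helly's lemma *)

Section FiniteProjection.
Variable R : realType.
Local Notation C := R[i].
Variables (V : lmodType C) (mn : forall n, 'M[V]_n -> R).
Hypothesis mnP : opspace mn.

Lemma dual_functional (v : V) : v != 0 ->
  exists (h : V -> C) M, [/\ 0 <= M, bounded_functional mn h M & h v = 1].
Proof.
move=> v0; have [l [lD lZ lb lv]] := hahn_banach_norming v (nrm_seminorm mnP).
have nv0 : 0 < nrm mn v.
  by rewrite lt_neqAle nrm_ge0 // andbT eq_sym; apply: contra_neq v0; apply: nrm_eq0.
have lv0 : l v != 0.
  by apply/eqP => lv0; move: lv; rewrite lv0 cnorm0 leNgt nv0.
exists (fun x => (l v)^-1 * l x), (cnorm (l v)^-1); split.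
- exact: cnorm_ge0.
- split=> [x y|c x|x]; first by rewrite lD mulrDr.
    by rewrite lZ mulrCA.
  by rewrite cnormM ler_wpM2l ?cnorm_ge0.
- by rewrite mulVf.
Qed.

(** A bounded projection P onto the span, built one vector at a time: [r] is what P misses of the
    new vector, and the new functional is h(1 - P) with h(r) = 1. The vectors may be dependent,
    hence the case [r = 0]. It splits a finite rank map into bounded functionals. *)
Lemma finite_projection n (e : 'I_n -> V) :
  exists m (g : 'I_m -> V -> C) (v : 'I_m -> V) (M : 'I_m -> R),
  [/\ forall i, 0 <= M i, forall i, bounded_functional mn (g i) (M i) &
      forall c : 'I_n -> C, let x := \sum_j c j *: e j in \sum_i g i x *: v i = x].
Proof.
elim: n e => [|n IHn] e.
  exists 0%N, (fun _ _ => 0), (fun _ => 0), (fun _ => 0).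
  by split=> [[]//|[]//|c] /=; rewrite !big_ord0.
have [m [g [v [M [M0 gM gE]]]]] := IHn (fun j => e (lift ord0 j)).
pose P x := \sum_i g i x *: v i.
have PD x y : P (x + y) = P x + P y.
  rewrite -big_split; apply: eq_bigr => i _ /=.
  by have [-> _ _] := gM i; rewrite scalerDl.
have PZ c x : P (c *: x) = c *: P x.
  rewrite scaler_sumr; apply: eq_bigr => i _.
  by have [_ -> _] := gM i; rewrite scalerA.
have Pb x : nrm mn (P x) <= (\sum_i M i * nrm mn (v i)) * nrm mn x.
  apply: le_trans (nrm_sum mnP _ _ _) _; rewrite mulr_suml; apply: ler_sum => i _.
  have [_ _ gb] := gM i; rewrite nrmZ // mulrAC ler_wpM2r ?nrm_ge0 //.
pose r := e ord0 - P (e ord0).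
have PE c : let x := \sum_j c j *: e j in x - P x = c ord0 *: r.
  rewrite /= big_ord_recl; set y := \sum_i _.
  have Py : P y = y by apply: (gE (fun j => c (lift ord0 j))).
  by rewrite PD PZ Py /r scalerBr opprD addrACA subrr addr0.
have [r0|r0] := eqVneq r 0.
  exists m, g, v, M; split=> // c /=.
  by apply/esym/eqP; rewrite -subr_eq0 -/(P _) PE r0 scaler0.
have [h [Mh [Mh0 [hD hZ hb] hr]]] := dual_functional r0.
have hN x y : h (x - y) = h x - h y by rewrite hD -scaleN1r hZ mulN1r.
exists m.+1, (fun i => if unlift ord0 i is Some j then g j else fun x => h (x - P x)).
exists (fun i => if unlift ord0 i is Some j then v j else r).
exists (fun i => if unlift ord0 i is Some j then M j
  else Mh * (1 + \sum_i M i * nrm mn (v i))); split.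
- move=> i; case: unliftP => [j _|_] //; rewrite mulr_ge0 // addr_ge0 // sumr_ge0 // => j _.
  by rewrite mulr_ge0 ?nrm_ge0.
- move=> i; case: unliftP => [j _|_] //; split=> [x y|c x|x].
  + by rewrite PD opprD addrACA; apply: hD.
  + by rewrite PZ -scalerBr hZ.
  + apply: le_trans (hb _) _; rewrite -mulrA ler_wpM2l // mulrDl mul1r.
    apply: le_trans (nrmD mnP _ _) _; rewrite nrmN // lerD2l; exact: Pb.
- move=> c x; rewrite big_ord_recl unlift_none.
  under eq_bigr do rewrite liftK.
  by rewrite -/(P x) PE hZ hr mulr1 -PE -/x subrK.
Qed.

End FiniteProjection.

Section Helly.
Variable R : realType.
Local Notation C := R[i].

Lemma real_net (d : R) : 0 < d -> exists (T : finType) (z : T -> R),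
  forall r, `|r| <= 1 -> exists k, `|r - z k| <= d.
Proof.
move=> d0; pose K := (Num.truncn (2 / d)).+1.
exists 'I_K.+1, (fun k : 'I_K.+1 => -1 + k%:R * d) => r r1.
have [rl ru] : -1 <= r /\ r <= 1 by apply/andP; rewrite -ler_norml.
pose x := (r + 1) / d.
have x0 : 0 <= x by apply: divr_ge0; [lra | exact: ltW].
have /andP[xl xu] := truncn_itv x0.
have kK : (Num.truncn x < K.+1)%N.
  rewrite ltnS /K; apply: leqW; apply: le_truncn.
  by rewrite ler_pM2r ?invr_gt0 //; lra.
exists (Ordinal kK) => /=.
have xE : r = -1 + x * d by rewrite /x divfK ?gt_eqF //; ring.
rewrite xE opprD addrACA subrr add0r -mulrBl normrM (gtr0_norm d0) ger_pMl //.
by rewrite ger0_norm ?subr_ge0 // lerBlDr addrC natr1 ltW.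
Qed.

Lemma complex_net (d : R) : 0 < d -> exists (T : finType) (z : T -> C),
  forall c, cnorm c <= 1 -> exists k, cnorm (c - z k) <= d.
Proof.
move=> d0; have [T [z zP]] := real_net (divr_gt0 d0 (ltr0n R 2)).
exists (T * T)%type, (fun kl => (z kl.1)%:C + 'i%C * (z kl.2)%:C) => c c1.
have Re1 : `|complex.Re c| <= 1.
  by apply: le_trans c1; have := normc_ge_Re c; rewrite normc_cnorm lecR.
have Im1 : `|complex.Im c| <= 1.
  apply: le_trans c1; have := normc_ge_Re (c * 'i%C).
  by rewrite normc_cnorm lecR cnormM cnorm_i mulr1 ReiNIm normrN.
have [k kP] := zP _ Re1; have [l lP] := zP _ Im1; exists (k, l) => /=.
have -> : c - ((z k)%:C + 'i%C * (z l)%:C) =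
    (complex.Re c - z k)%:C + 'i%C * (complex.Im c - z l)%:C.
  by rewrite [in LHS](complexE c) !rmorphB /=; ring.
apply: le_trans (cnormD _ _) _; rewrite cnormM cnorm_i mul1r !cnorm_real [d]splitr.
exact: lerD.
Qed.

Variables (V : lmodType C) (mn : forall n, 'M[V]_n -> R).
Hypothesis mnP : opspace mn.
Variables (f : nat -> nat -> V) (B : R).
Hypotheses (B0 : 0 <= B) (fB : forall N, trunc_norm mn N f <= B).

Local Notation W := (gauge_space mnP f).
Local Notation gval := (@gval _ _ _ mnP f).
Local Notation nW := (nrm (@gauge_norm _ _ _ mnP f)).
Local Notation nV := (nrm mn).
Let WP := gauge_opspace mnP B0 fB.

Lemma gauge_nrm_leP (w : W) t : 0 <= t ->
  nW w <= t <-> hull_closure mn f t (fun _ _ : 'I_1 => gval w).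
Proof.
move=> t0; split=> [/(gauge_norm_leP B0 fB _ t0)|wt].
  by apply: eq_Cl => i j; rewrite mxE.
by apply/(gauge_norm_leP B0 fB) => //; apply: eq_Cl wt => i j; rewrite mxE.
Qed.

(* Lower semicontinuity of the gauge for the norm of V, in Lipschitz form. *)
Lemma gauge_lower_bound (x : W) s : 0 <= s -> s < nW x ->
  exists2 n, 0 <= n & forall u, nW u <= s -> 1 <= n * nV (gval u + gval x).
Proof.
move=> s0 sx; apply: contrapT => H.
have /(gauge_nrm_leP _ s0) : hull_closure mn f s (fun _ _ : 'I_1 => gval x).
  apply: (Cl_closed mnP) => e e0.
  have [u [us ux]] : exists u, nW u <= s /\ nV (gval u + gval x) < e.
    apply: contrapT => H'; apply: H; exists e^-1; first by rewrite invr_ge0 ltW.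
    move=> u us; rewrite ler_pdivlMl // mulr1 leNgt; apply/negP => ux.
    by apply: H'; exists u.
  exists (fun _ _ => gval (- u)).
    by apply/(gauge_nrm_leP _ s0); rewrite nrmN.
  have -> : nF mn (fun _ _ : 'I_1 => gval x - gval (- u)) = nV (gval u + gval x).
    by rewrite nrm_nF //; apply: eq_nF => i j; rewrite opprK addrC.
  exact: ux.
by rewrite leNgt sx.
Qed.

(** If the gauge of [u] exceeds that of [x] minus [d / M], the left side is at most 0; otherwise
    [gauge_lower_bound] keeps [gval u + gval x] away from 0, and a large [n] wins. *)
Lemma gauge_lipschitz_bound (x : W) M d : 0 <= M -> 0 < d ->
  exists2 n, 0 <= n & forall u, M * nW x - M * nW u - d <= n * nV (gval u + gval x).
Proof.
move=> M0 d0; have nx0 := nrm_ge0 WP x.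
have [Mx|Mx] := leP (M * nW x) d.
  exists 0 => // u; rewrite mul0r.
  have := mulr_ge0 M0 (nrm_ge0 WP u); lra.
have Mp : 0 < M.
  rewrite lt_neqAle M0 andbT eq_sym; apply/eqP => M0'; move: Mx.
  by rewrite M0' mul0r ltNge ltW.
pose s := nW x - d / M.
have s0 : 0 <= s by rewrite subr_ge0 ler_pdivrMr // mulrC ltW.
have sx : s < nW x by rewrite gtrBl divr_gt0.
have [n n0 nP] := gauge_lower_bound s0 sx.
exists (M * nW x * n) => [|u]; first by rewrite !mulr_ge0.
have Mu0 := mulr_ge0 M0 (nrm_ge0 WP u).
have Mx0 : 0 <= M * nW x by rewrite mulr_ge0.
have [us|su] := leP (nW u) s.
  have := ler_wpM2l Mx0 (nP u us); rewrite mulr1 mulrA; lra.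
have : 0 <= M * nW x * n * nV (gval u + gval x) by rewrite !mulr_ge0 ?nrm_ge0.
have : M * s <= M * nW u by rewrite ler_wpM2l // ltW.
rewrite /s mulrBr mulrCA divff ?gt_eqF // mulr1; lra.
Qed.

Variables (m : nat) (w : 'I_m -> W) (psi : W -> C) (M eta : R).
Hypotheses (M0 : 0 <= M) (psiM : bounded_functional (@gauge_norm _ _ _ mnP f) psi M).
Hypothesis eta0 : 0 < eta.

Let comb (t : 'I_m -> C) : W := \sum_j t j *: w j.

(** This is the domination required by Mazur-Orlicz. [gauge_lipschitz_bound] gives a constant for
    each combination; homogeneity reduces to coefficients of total modulus 1, and a finite net of
    these makes one constant serve all, at the price of the [eta] term. *)
Lemma helly_bound : exists2 n, 0 <= n & forall (u : W) (t : 'I_m -> C),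
  Re (psi (comb t)) - M * nW u - eta * \sum_j cnorm (t j) <= n * nV (gval u + gval (comb t)).
Proof.
pose S := 1 + \sum_j nW (w j).
have S0 : 0 < S by rewrite ltr_wpDr // sumr_ge0 // => j _; apply: nrm_ge0.
(* Moving to the net changes [M] times a gauge by at most [M * (d * S) <= eta / 4]; this occurs
   twice, and the other [eta / 2] is the loss at the net point. *)
pose d := eta / (4 * (M + 1) * S).
have D0 : 0 < 4 * (M + 1) * S by rewrite !mulr_gt0 // ltr_wpDl.
have d0 : 0 < d by rewrite divr_gt0.
have [T [z zP]] := complex_net d0.
pose tz (k : {ffun 'I_m -> T}) j := z (k j).
have eta20 : 0 < eta / 2 by rewrite divr_gt0.
have /boolp.choice[n nP] : forall k, exists n, 0 <= n /\ forall u : W,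
    M * nW (comb (tz k)) - M * nW u - eta / 2 <= n * nV (gval u + gval (comb (tz k))).
  move=> k; have [n n0 nP] := gauge_lipschitz_bound (comb (tz k)) M0 eta20.
  by exists n.
have n0 k : 0 <= n k by have [] := nP k.
have psib x : Re (psi x) <= M * nW x.
  by apply: le_trans (Re_le_cnorm _) _; have [_ _] := psiM; apply.
have normalized (u : W) (t : 'I_m -> C) : \sum_j cnorm (t j) = 1 ->
    Re (psi (comb t)) - M * nW u - eta <= (\sum_k n k) * nV (gval u + gval (comb t)).
  move=> t1.
  have /boolp.choice[k kP] : forall j, exists k, cnorm (t j - z k) <= d.
    move=> j; apply: zP; rewrite -t1 (bigD1 j) //= lerDl sumr_ge0 // => i _.
    exact: cnorm_ge0.
  pose k' := [ffun j => k j].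
  (* The discrepancy is moved into [u'], so the vector measured in [V] stays exactly the same. *)
  pose x := comb t; pose x' := comb (tz k'); pose u' := u + (x - x').
  have xx' : nW (x - x') <= d * S.
    have -> : x - x' = \sum_j (t j - z (k j)) *: w j.
      rewrite /x /x' /comb -sumrB; apply: eq_bigr => j _.
      by rewrite /tz ffunE scalerBl.
    apply: le_trans (nrm_sum WP _ _ _) _.
    apply: (@le_trans _ _ (\sum_j d * nW (w j))).
      by apply: ler_sum => j _; rewrite nrmZ // ler_wpM2r ?nrm_ge0.
    by rewrite -mulr_sumr; apply: (ler_wpM2l (ltW d0)); rewrite lerDr.
  have uu' : gval u + gval x = gval u' + gval x'.
    by rewrite -!(linear_funD (@gval_linear _ _ _ mnP f)) /u' -addrA subrK.
  have nu' : nW u' <= nW u + d * S.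
    by apply: le_trans (nrmD WP _ _) _; rewrite lerD2l.
  have nx : nW x <= nW x' + d * S.
    have -> : x = x' + (x - x') by rewrite addrC subrK.
    by apply: le_trans (nrmD WP _ _) _; rewrite lerD2l.
  have := (nP k').2 u'; rewrite -/x' -uu' => le1.
  have le2 : n k' * nV (gval u + gval x) <= (\sum_k n k) * nV (gval u + gval x).
    apply: ler_wpM2r; first exact: nrm_ge0.
    by rewrite (bigD1 k') //= lerDl sumr_ge0.
  have le3 : M * nW u' <= M * nW u + M * (d * S) by rewrite -mulrDr ler_wpM2l.
  have le4 : M * nW x <= M * nW x' + M * (d * S) by rewrite -mulrDr ler_wpM2l.
  have le5 : M * (d * S) <= eta / 4.
    have -> : d * S = eta / (4 * (M + 1)).
      by rewrite /d; field; rewrite !gt_eqF // ltr_wpDl.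
    rewrite mulrA ler_pdivrMr ?mulr_gt0 ?ltr_wpDl //.
    have -> : eta / 4 * (4 * (M + 1)) = eta * (M + 1) by field.
    by rewrite mulrC ler_pM2l // lerDl.
  have := psib x; rewrite -/x.
  have -> : eta = eta / 2 + eta / 4 + eta / 4 by field.
  lra.
have psi0 := functional0 psiM.
exists (\sum_k n k) => [|u t]; first exact: sumr_ge0.
set s := \sum_j cnorm (t j); have s0 : 0 <= s by apply: sumr_ge0 => j _; apply: cnorm_ge0.
have [se0|sn0] := eqVneq s 0.
  have t0 j : t j = 0.
    move/eqP: se0; rewrite psumr_eq0 => [/allP/(_ j (mem_index_enum _))/eqP|i _].
      exact: cnorm_eq0.
    exact: cnorm_ge0.
  have -> : comb t = 0 by rewrite /comb big1 // => j _; rewrite t0 scale0r.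
  rewrite psi0 se0 mulr0 subr0 sub0r.
  apply: (@le_trans _ _ 0); last by rewrite mulr_ge0 ?nrm_ge0 // sumr_ge0.
  by rewrite oppr_le0 mulr_ge0 // nrm_ge0.
have sp : 0 < s by rewrite lt_neqAle eq_sym sn0.
have si0 : 0 <= s^-1 by rewrite invr_ge0.
have := normalized (s^-1%:C *: u) (fun j => s^-1%:C * t j).
have -> : \sum_j cnorm (s^-1%:C * t j) = 1.
  transitivity (\sum_j s^-1 * cnorm (t j)).
    by apply: eq_bigr => j _; rewrite cnormM cnorm_nneg.
  by rewrite -mulr_sumr mulVf.
have -> : comb (fun j => s^-1%:C * t j) = s^-1%:C *: comb t.
  by rewrite scaler_sumr; apply: eq_bigr => j _; rewrite scalerA.
move=> /(_ erefl).
rewrite -(linear_funD (@gval_linear _ _ _ mnP f)) -scalerDr.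
rewrite (linear_funZ (@gval_linear _ _ _ mnP f)) !nrmZ // cnorm_nneg //.
have [_ psiZ _] := psiM; rewrite psiZ (linear_funD (@gval_linear _ _ _ mnP f)).
have -> : Re (s^-1%:C * psi (comb t)) = s^-1 * Re (psi (comb t)).
  by case: (psi (comb t)) => a b /=; rewrite mul0r subr0.
move: (Re (psi (comb t))) (nW u) (nV _) (\sum_k n k) => a b c n' le1.
have -> : a - M * b - eta * s = s * (s^-1 * a - M * (s^-1 * b) - eta) by field.
have -> : n' * c = s * (n' * (s^-1 * c)) by field.
exact: ler_wpM2l.
Qed.

(* Helly's lemma: functionals on V are weak* dense in the ball of the dual of W. *)
Lemma functional_approximation : exists (h : V -> C) (Mh : R),
  [/\ 0 <= Mh, bounded_functional mn h Mh,
      bounded_functional (@gauge_norm _ _ _ mnP f) (fun u => h (gval u)) M &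
      forall j, cnorm (h (gval (w j)) - psi (w j)) <= eta].
Proof.
have [n n0 nP] := helly_bound.
(* With [t = 0] the constraint bounds the functional by [M] on the gauge space; with [u = 0] it ties
   it to [psi] on the [w j] up to [eta]. *)
pose S (e : V) (r : R) := exists (u : W) (t : 'I_m -> C), e = gval u + gval (comb t) /\
  r <= Re (psi (comb t)) - M * nW u - eta * \sum_j cnorm (t j).
have [psiD psiZ psib] := psiM; have psi0 := functional0 psiM.
have gL := @gval_linear _ _ _ mnP f.
have combD t t' : comb (fun j => t j + t' j) = comb t + comb t'.
  by rewrite -big_split; apply: eq_bigr => j _; rewrite scalerDl.
have combZ s t : comb (fun j => s * t j) = s *: comb t.
  by rewrite scaler_sumr; apply: eq_bigr => j _; rewrite scalerA.
have sub_n : seminormC (fun v => n * nV v).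
  split=> [x y|c x]; first by rewrite -mulrDr ler_wpM2l // nrmD.
  by rewrite nrmZ // mulrCA.
have [||||l [ll lp lS]] := @mazur_orlicz _ _ _ S (seminormC_sublinear sub_n).
- exists 0, (fun=> 0); split.
    by rewrite /comb big1 => [|j _]; rewrite ?scale0r // (linear_fun0 gL) addr0.
  rewrite /comb big1 => [|j _]; last by rewrite scale0r.
  by rewrite psi0 nrm0 // mulr0 subr0 big1 ?mulr0 ?subr0 // => j _; rewrite cnorm0.
- move=> _ r _ r' [u [t [-> rt]]] [u' [t' [-> rt']]].
  exists (u + u'), (fun j => t j + t' j); split.
    by rewrite combD !(linear_funD gL) addrACA.
  have -> : Re (psi (comb (fun j => t j + t' j))) = Re (psi (comb t)) + Re (psi (comb t')).
    by rewrite combD psiD; case: (psi _) (psi _) => a b [c d].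
  have le1 : M * nW (u + u') <= M * nW u + M * nW u'.
    by rewrite -mulrDr ler_wpM2l // nrmD.
  have le2 : eta * \sum_j cnorm (t j + t' j) <=
      eta * \sum_j cnorm (t j) + eta * \sum_j cnorm (t' j).
    rewrite -mulrDr; apply: (ler_wpM2l (ltW eta0)); rewrite -big_split; apply: ler_sum => j _.
    exact: cnormD.
  lra.
- move=> s _ r s0 [u [t [-> rt]]]; exists (s%:C *: u), (fun j => s%:C * t j).
  rewrite combZ !(linear_funZ gL) scalerDr; split=> //.
  have -> : Re (psi (s%:C *: comb t)) = s * Re (psi (comb t)).
    by rewrite psiZ; case: (psi _) => a b /=; rewrite mul0r subr0.
  rewrite nrmZ // (cnorm_nneg (ltW s0)).
  have -> : \sum_j cnorm (s%:C * t j) = s * \sum_j cnorm (t j).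
    by rewrite mulr_sumr; apply: eq_bigr => j _; rewrite cnormM cnorm_nneg ?ltW.
  apply: le_trans (ler_wpM2l (ltW s0) rt) _.
  by apply/eqW; ring.
- by move=> _ r [u [t [-> rt]]]; apply: le_trans rt _; apply: nP.
have hD := complexify_additive ll.
have hZ c x := complexifyZ c x ll.
exists (complexify l), n; split=> //.
- by split=> // x; apply: (cnorm_complexify_le x sub_n ll lp).
- split=> [x y|c x|x]; first by rewrite (linear_funD gL) hD.
    by rewrite (linear_funZ gL) hZ.
  have [u [u1 ux]] := phaseP (complexify l (gval x)).
  have := congr1 (@complex.Re R) ux; rewrite -hZ Re_complexify /= => <-.
  have : - (M * nW x) <= l (gval (- (u *: x))).
    apply: lS; exists (- (u *: x)), (fun=> 0).
    have -> : comb (fun=> 0) = 0 by rewrite /comb big1 // => j _; rewrite scale0r.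
    rewrite (linear_fun0 gL) addr0; split=> //.
    rewrite psi0 nrmN // nrmZ // u1 mul1r big1 => [|j _]; last by rewrite cnorm0.
    by rewrite mulr0 subr0 sub0r.
  have lN y : l (- y) = - l y.
    by have := ll.2 (-1) y; rewrite rmorphN scaleN1r => ->; rewrite mulN1r.
  have -> : gval (- (u *: x)) = - (u *: gval x) by [].
  by rewrite lN lerN2.
move=> j; set y := _ - _; have [u [u1 uy]] := phaseP y.
have := congr1 (@complex.Re R) uy => /= <-.
(* The constraints are lower bounds only; applied to the rotated negative of [w j], one becomes the
   upper bound on the modulus. *)
have : - Re (u * psi (w j)) - eta <= l (gval (- u *: w j)).
  apply: lS; exists 0, (fun i => if i == j then - u else 0).
  have -> : comb (fun i => if i == j then - u else 0) = - u *: w j.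
    rewrite /comb (bigD1 j) //= eqxx big1 ?addr0 // => i ij.
    by rewrite (negPf ij) scale0r.
  rewrite (linear_fun0 gL) add0r; split=> //.
  rewrite nrm0 // mulr0 subr0 (bigD1 j) //= eqxx cnormN u1 big1 => [|i ij]; last first.
    by rewrite (negPf ij) cnorm0.
  rewrite addr0 mulr1 psiZ mulNr; case: (u * psi (w j)) => a b /=; lra.
have -> : l (gval (- u *: w j)) = - Re (u * complexify l (gval (w j))).
  have -> : l (gval (- u *: w j)) = Re (complexify l (- u *: gval (w j))).
    by rewrite Re_complexify.
  by rewrite hZ mulNr; case: (u * _).
rewrite /y; move: (complexify l (gval (w j))) (psi (w j)) => z1 z2; rewrite mulrBr.
case: (u * z1) => a b; case: (u * z2) => c d /=; lra.
Qed.

End Helly.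

(** * From compact approximation to the approximation property *)

Section Limits.
Variable R : realType.
Local Notation C := R[i].

Lemma cauchy_seq_cvg (u : nat -> R) :
  (forall e, 0 < e -> exists K, forall k l, (K <= k)%N -> (K <= l)%N -> `|u k - u l| < e) ->
  exists l, seq_cvg u l.
Proof.
move=> uC; pose S := [set t | exists K, forall k, (K <= k)%N -> t <= u k].
exists (sup S) => e e0; have e30 : 0 < e / 3 by rewrite divr_gt0.
have [K KP] := uC _ e30; exists K => k Kk.
have near m : (K <= m)%N -> u K - e / 3 <= u m <= u K + e / 3.
  move=> Km; have := KP m K Km (leqnn _); rewrite ltr_norml => /andP[]; lra.
have inS : S (u K - e / 3) by exists K => m /near/andP[].
have ubS : ubound S (u K + e / 3).
  move=> t [M MP]; apply: le_trans (MP (maxn K M) (leq_maxr _ _)) _.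
  by have /andP[] := near _ (leq_maxl K M).
have le1 : u K - e / 3 <= sup S by apply: ub_le_sup => //; exists (u K + e / 3).
have le2 : sup S <= u K + e / 3 by apply: ge_sup => //; exists (u K - e / 3).
have := KP k K Kk (leqnn _); rewrite !ltr_norml => /andP[? ?]; apply/andP; split; lra.
Qed.

Lemma half_pow_small (e : R) : 0 < e -> exists K, forall k, (K <= k)%N -> 2^-1 ^+ k < e.
Proof.
move=> e0; exists (Num.truncn e^-1).+1 => k Kk.
have ei0 : 0 <= e^-1 by rewrite invr_ge0 ltW.
have /andP[_ lt1] := truncn_itv ei0.
have -> : 2^-1 ^+ k = (2 ^+ k)^-1 :> R by rewrite exprVn.
rewrite invf_plt ?posrE ?exprn_gt0 //.
apply: lt_le_trans lt1 _; rewrite -natrX ler_nat; apply: leq_trans Kk _.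
by apply: ltnW; apply: ltn_expl.
Qed.

Lemma geometric_tail K L : \sum_(K <= k < L) 2^-1 ^+ k <= 2 * 2^-1 ^+ K :> R.
Proof.
(* Adding the missing tail makes the bound stable under induction on [L]. *)
suff : \sum_(K <= k < L) 2^-1 ^+ k + (if (K <= L)%N then 2 * 2^-1 ^+ L else 0)
    <= 2 * 2^-1 ^+ K :> R.
  apply: le_trans; rewrite lerDl; case: ifP => // _.
  by rewrite mulr_ge0 // exprn_ge0 // invr_ge0.
elim: L => [|L IHL].
  rewrite big_geq // add0r; case: ifP => [|_]; first by rewrite leqn0 => /eqP ->.
  by rewrite mulr_ge0 // exprn_ge0 // invr_ge0.
have [KL|LK] := leqP K L.
  rewrite big_nat_recr //= (leqW KL); move: IHL; rewrite KL; apply: le_trans.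
  have -> : 2 * 2^-1 ^+ L.+1 = 2^-1 ^+ L :> R by rewrite exprS; field.
  by rewrite -addrA lerD2l mulrDl mul1r.
rewrite big_geq // add0r; case: ifP => [KL1|_].
  by have -> : K = L.+1 by apply/eqP; rewrite eqn_leq KL1 LK.
by rewrite mulr_ge0 // exprn_ge0 // invr_ge0.
Qed.

Variables (V : lmodType C) (mn : forall n, 'M[V]_n -> R).
Hypothesis mnP : opspace mn.

Lemma knorm_exists (T : V -> V) (x : nat -> nat -> nat -> V) :
  cbmap mn mn T -> kelt mn x -> exists l, knorm_is mn T x l.
Proof.
move=> Tcb [xs xC]; have [M M0 TM] := cb_bound mnP Tcb; have TL := Tcb.1.
have T0 := linear_fun0 TL.
apply: cauchy_seq_cvg => e e0.
have D0 : 0 < M + 1 by rewrite ltr_wpDl.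
have [K KP] := xC _ (divr_gt0 e0 D0); exists K => k l Kk Kl.
have tri p q : (K <= p)%N -> (K <= q)%N ->
    infnorm mn (fun i j => T (x p i j)) <= infnorm mn (fun i j => T (x q i j)) + M * (e / (M + 1)).
  move=> Kp Kq; apply: (infnorm_le mnP) => N.
  apply: le_trans (_ : trunc_norm mn N (fun i j => T (x q i j)) +
    trunc_norm mn N (fun i j => T (x p i j - x q i j)) <= _).
    apply: le_trans (trunc_normD mnP _ _ _); apply/eqW/eq_trunc_norm => i j _ _.
    by rewrite linear_funB // addrC subrK.
  apply: lerD; first by apply: le_infnorm => //; apply: fsupp_map.
  apply: le_trans (cb_nF _ TM) _; rewrite ler_wpM2l //.
  by apply: le_trans (ltW (KP p q Kp Kq)); apply: le_infnorm => //; apply: fsuppB.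
have lt : M * (e / (M + 1)) < e.
  by rewrite mulrCA -[ltRHS]mulr1 ltr_pM2l // ltr_pdivrMr // mul1r ltrDl.
have := tri k l Kk Kl; have := tri l k Kl Kk.
by rewrite ltr_norml => ? ?; apply/andP; split; lra.
Qed.

Lemma seq_cvg_le (u v : nat -> R) a b : seq_cvg u a -> seq_cvg v b ->
  (forall k, u k <= v k) -> a <= b.
Proof.
move=> ua vb uv; apply/ler_addgt0Pr => e e0; have e20 : 0 < e / 2 by rewrite divr_gt0.
have [K KP] := ua _ e20; have [L LP] := vb _ e20.
have := KP _ (leq_maxl K L); have := LP _ (leq_maxr K L); have := uv (maxn K L).
by rewrite !ltr_norml => ? /andP[? ?] /andP[? ?]; lra.
Qed.

Lemma seq_cvg_le_frequently (u : nat -> R) a b : seq_cvg u a ->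
  (forall K, exists2 k, (K <= k)%N & u k <= b) -> a <= b.
Proof.
move=> ua ub; apply/ler_addgt0Pr => e e0; have [K KP] := ua _ e0.
have [k Kk kb] := ub K; have := KP k Kk.
by rewrite ltr_norml => /andP[? ?]; lra.
Qed.

Lemma trunc_norm_le_bdiag w k N : fsupp (bdiag w) -> trunc_norm mn N (w k) <= infnorm mn (bdiag w).
Proof.
move=> ws; pose M := (\max_(i < N) encode (k, i : nat)).+1.
have iM (i : 'I_N) : (encode (k, i : nat) < M)%N by rewrite ltnS (leq_bigmax i).
pose g (i : 'I_N) := Some (Ordinal (iM i)).
have g_inj : pinj g.
  move=> i i' j [<-] [] /(congr1 decode); rewrite !encodeK => -[ii'].
  exact/val_inj/esym.
apply: le_trans (le_infnorm mnP M ws); apply: le_trans (nF_compress mnP _ g_inj g_inj).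
by apply/eqW/eq_nF => i j /=; rewrite /bdiag !encodeK eqxx.
Qed.

(* x (+) y in K(V), from two blocks of the block diagonal construction. *)
Definition pair_elt (x y : nat -> nat -> nat -> V) (l : nat) :=
  bdiag_seq (fun k => if k is 0 then x l else y l) 2.

Lemma pair_elt_kelt x y : kelt mn x -> kelt mn y -> kelt mn (pair_elt x y).
Proof.
move=> [xs xC] [ys yC]; split=> [l|e e0].
  by apply: bdiag_seq_fsupp => -[|k].
have e20 : 0 < e / 2 by rewrite divr_gt0.
have [K KP] := xC _ e20; have [L LP] := yC _ e20; exists (maxn K L) => k l.
rewrite !geq_max => /andP[Kk Lk] /andP[Kl Ll].
apply: le_lt_trans (_ : e / 2 < e); last by rewrite ltr_pdivrMr // mulr_natr mulr2n ltrDl.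
apply: (infnorm_le mnP) => N.
rewrite (eq_trunc_norm mn (g := bdiag (fun c i j => if (c < 2)%N then
  if c is 0 then x k i j - x l i j else y k i j - y l i j else 0))).
  apply: (trunc_norm_bdiag mnP) => [|[|[|c]] N'] /=; first exact: ltW.
  - by apply: le_trans (ltW (KP k l Kk Kl)); apply: le_infnorm => //; apply: fsuppB.
  - by apply: le_trans (ltW (LP k l Lk Ll)); apply: le_infnorm => //; apply: fsuppB.
  - by rewrite trunc_norm0 // ltW.
move=> P Q _ _; rewrite /pair_elt /bdiag_seq /bdiag.
case: (decode P) => [[c i]|]; last by rewrite subrr.
case: (decode Q) => [[c' j]|]; last by rewrite subrr.
case: eqP => _; last by rewrite subrr.
by case: c => [|[|c]] //=; rewrite subrr.
Qed.

Lemma map_pair_elt (T : V -> V) x y l : T 0 = 0 ->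
  (fun i j => T (pair_elt x y l i j)) =
  bdiag (fun k i j => if (k < 2)%N then T ((if k is 0 then x l else y l) i j) else 0).
Proof.
move=> T0; apply/funext => P; apply/funext => Q; rewrite /pair_elt /bdiag_seq /bdiag.
case: (decode P) => [[c i]|] //; case: (decode Q) => [[c' j]|] //.
by case: eqP => // _; case: ifP.
Qed.

Lemma knorm_pair_elt (T : V -> V) x y l : cbmap mn mn T ->
  kelt mn x -> kelt mn y -> knorm_is mn T (pair_elt x y) l ->
  (exists2 l', knorm_is mn T x l' & l' <= l) /\ (exists2 l', knorm_is mn T y l' & l' <= l).
Proof.
move=> Tcb kx ky Tl; have T0 := linear_fun0 Tcb.1.
have pfs k : fsupp (bdiag (fun c i j => if (c < 2)%N then
    T ((if c is 0 then x k else y k) i j) else 0)).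
  by rewrite -(map_pair_elt x y k T0); apply: fsupp_map => //; apply: (pair_elt_kelt kx ky).1.
split.
  have [l' xl'] := knorm_exists Tcb kx; exists l' => //.
  apply: seq_cvg_le xl' Tl _ => k; rewrite map_pair_elt //; apply: (infnorm_le mnP) => N.
  by have := trunc_norm_le_bdiag 0 N (pfs k).
have [l' yl'] := knorm_exists Tcb ky; exists l' => //.
apply: seq_cvg_le yl' Tl _ => k; rewrite map_pair_elt //; apply: (infnorm_le mnP) => N.
by have := trunc_norm_le_bdiag 1 N (pfs k).
Qed.

(** Approximation at one element gives a net because two elements are handled at once by their
    direct sum [pair_elt]; this supplies directedness. *)
Theorem OAP_of_approximation :
  (forall x, kelt mn x -> forall e : R, 0 < e -> exists T : V -> V,
    [/\ cbmap mn mn T, finrank T &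
        exists l, knorm_is mn (fun v => T v - v) x l /\ l < e]) ->
  OAP mn.
Proof.
move=> approx.
(* A pair (x, e) indexes one of the maps T with |(id (x) (T - 1)) x| < e; the
   order is reverse inclusion of the sets of such maps. *)
pose D := {xe : (nat -> nat -> nat -> V) * R | kelt mn xe.1 /\ 0 < xe.2}.
pose good (d : D) (T : V -> V) := [/\ cbmap mn mn T, finrank T &
   exists l, knorm_is mn (fun v => T v - v) (sval d).1 l /\ l < (sval d).2].
have /boolp.choice[F FP] : forall d : D, exists T, good d T.
  by move=> [[x e] [/= kx e0]]; apply: approx.
exists D, (fun a b => forall T, good b T -> good a T), F; split.
- have k0 : kelt mn (fun _ _ _ => 0 : V).
    split=> [k|e e0]; first by exists 0%N.
    exists 0%N => k l _ _; apply: le_lt_trans e0; apply: (infnorm_le mnP) => N.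
    by rewrite (eq_trunc_norm mn (g := fun _ _ => 0)) ?trunc_norm0 // => i j _ _; rewrite subrr.
  by constructor; exists ((fun _ _ _ => 0), 1); split.
- by split=> // a b c ab bc T /bc/ab.
- move=> [[x e] [/= kx e0]] [[y d] [/= ky d0]].
  have kP : kelt mn (pair_elt x y, Num.min e d).1 /\ 0 < (pair_elt x y, Num.min e d).2.
    by split; [apply: pair_elt_kelt | rewrite /= lt_min e0 d0].
  exists (exist _ (pair_elt x y, Num.min e d) kP).
  split=> T [Tcb Tfr [l [/= Tl lle]]]; split=> //;
  have [[lx Txl xl] [ly Tyl yl]] := knorm_pair_elt (cb_sub mnP Tcb (cb_id mn)) kx ky Tl.
    by exists lx; split=> //=; move: lle; rewrite lt_min => /andP[le _]; apply: le_lt_trans le.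
  by exists ly; split=> //=; move: lle; rewrite lt_min => /andP[_ le]; apply: le_lt_trans le.
- by move=> d; have [] := FP d.
move=> x kx e e0; exists (exist _ (x, e) (conj kx e0)) => d /(_ _ (FP d)) [_ _ [l [Tl le]]].
by exists l.
Qed.

End Limits.

(** * Approximating the identity at one element of K(V) *)

Section Approximation.
Variable R : realType.
Local Notation C := R[i].
Variables (V : lmodType C) (mn : forall n, 'M[V]_n -> R).
Hypothesis mnP : opspace mn.

Lemma le_cbnorm_mul (W : lmodType C) (mnW : forall n, 'M[W]_n -> R) (phi : W -> V) n
    (w : 'M[W]_n) : opspace mnW -> cbmap mnW mn phi ->
  mn (map_mx phi w) <= cbnorm mnW mn phi * mnW n w.
Proof.
move=> WP phicb; have [M M0 phiM] := cb_bound WP phicb.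
have [w0|w0] := eqVneq (mnW n w) 0.
  by apply: le_trans (phiM n w) _; rewrite w0 !mulr0.
have wp : 0 < mnW n w by rewrite lt_neqAle eq_sym w0; have [[-> _ _ _] _ _ _] := WP.
have [[_ _ _ homW] _ _ _] := WP; have [[_ _ _ homV] _ _ _] := mnP.
pose s := (mnW n w)^-1; have s0 : 0 <= s by rewrite invr_ge0 ltW.
have /(le_cbnorm WP phicb) : mnW n (map_mx (fun v => s%:C *: v) w) <= 1.
  by rewrite homW cnorm_nneg // mulVf.
have -> : map_mx phi (map_mx (fun v => s%:C *: v) w) =
    map_mx (fun v => s%:C *: v) (map_mx phi w).
  by apply/matrixP => i j; rewrite !mxE (linear_funZ phicb.1).
by rewrite homV cnorm_nneg // ler_pdivrMl // mulrC.
Qed.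

Lemma finite_rank_sum_cb m (h : 'I_m -> V -> C) (v : 'I_m -> V) (M : 'I_m -> R) :
  (forall i, 0 <= M i) -> (forall i, bounded_functional mn (h i) (M i)) ->
  cbmap mn mn (fun x => \sum_i h i x *: v i) /\ finrank (fun x => \sum_i h i x *: v i).
Proof.
move=> M0 hM; split; last by exists m, v => x; exists (h ^~ x).
split=> [a x y|].
  rewrite scaler_sumr -big_split; apply: eq_bigr => i _ /=.
  by have [hD hZ _] := hM i; rewrite hD hZ scalerDl scalerA.
exists (\sum_i M i * nrm mn (v i)) => n x; rewrite !(mn_nF mnP).
rewrite (@eq_nF _ _ _ _ _ (fun a b => \sum_i h i (x a b) *: v i)) => [|a b]; last by rewrite mxE.
apply: le_trans (nF_sum mnP _ _ _) _; rewrite mulr_suml; apply: ler_sum => i _.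
by apply: le_trans (nF_rank1_functional mnP _ _ (M0 i) (hM i)) _; rewrite mulrAC.
Qed.

Variable x : nat -> nat -> nat -> V.
Hypothesis kx : kelt mn x.

(** The rate is a product because its factors have separate uses: one is consumed by the rescaling,
    the other remains as decay. *)
Lemma fast_subsequence : exists nu : nat -> nat, (forall k, (k <= nu k)%N) /\
  forall k, infnorm mn (fun i j => x (nu k.+1) i j - x (nu k) i j) < 2^-1 ^+ k * 2^-1 ^+ k.
Proof.
have pow0 k : 0 < 2^-1 ^+ k * 2^-1 ^+ k :> R by rewrite mulr_gt0 // exprn_gt0 // invr_gt0.
have /boolp.choice[nu nuP] := fun k => kx.2 _ (pow0 k).
(* The running maximum puts both [k] and [k.+1] terms past the Cauchy threshold for [k]. *)
exists (fun k => maxn k (\max_(j < k.+1) nu j)); split=> k; first exact: leq_maxl.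
by apply: nuP; rewrite leq_max; apply/orP; right;
  [apply: (leq_bigmax (Ordinal (leqnSn k.+1))) | apply: (leq_bigmax ord_max)].
Qed.

Definition increments (nu : nat -> nat) (k i j : nat) : V :=
  if k is l.+1 then x (nu k) i j - x (nu l) i j else x (nu 0) i j.

Lemma sum_increments nu K i j :
  \sum_(0 <= k < K.+1) increments nu k i j = x (nu K) i j.
Proof.
elim: K => [|K IHK]; first by rewrite big_nat1.
by rewrite big_nat_recr //= IHK addrC subrK.
Qed.

Hypothesis approx : forall (W : lmodType C) (mnW : forall n, 'M[W]_n -> R),
  opspace mnW -> forall phi : W -> V, cbmap mnW mn phi -> op_compact_map mnW mn phi ->
  forall e : R, 0 < e -> exists psi : W -> V,
    [/\ cbmap mnW mn psi, finrank psi & cbnorm mnW mn (fun w => phi w - psi w) < e].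

Lemma approximation_on_element (e : R) : 0 < e -> exists T : V -> V,
  [/\ cbmap mn mn T, finrank T & exists l, knorm_is mn (fun v => T v - v) x l /\ l < e].
Proof.
move=> e0; have [nu [nu_ge nuP]] := fast_subsequence.
pose rho k : R := 2^-1 ^+ k.
have rho0 k : 0 < rho k by rewrite exprn_gt0 // invr_gt0.
have rho_ge0 k : 0 <= rho k by apply: ltW.
have rhoV_ge0 k : 0 <= (rho k)^-1 by rewrite invr_ge0.
pose d := increments nu.
have d_supp k : fsupp (d k).
  by case: k => [|k]; [apply: kx.1 | apply: fsuppB; apply: kx.1].
pose z k i j : V := (rho k)^-1%:C *: d k i j.
have z_supp k : fsupp (z k).
  by apply: (fsupp_map (h := fun v => (rho k)^-1%:C *: v)) (d_supp k); rewrite scaler0.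
(* [d l.+1] has norm below [rho l * rho l], and dividing by [rho l.+1] leaves [2 * rho l]. *)
pose b k := if k is l.+1 then 2 * rho l else infnorm mn (d 0%N).
have zb k N : trunc_norm mn N (z k) <= b k.
  rewrite /trunc_norm nFZ // (cnorm_nneg (rhoV_ge0 k)) -/(trunc_norm mn N (d k)).
  case: k => [|k] /=.
    by rewrite /rho expr0 invr1 mul1r; apply: (le_infnorm mnP N (d_supp 0%N)).
  rewrite ler_pdivrMl //; apply: le_trans (le_infnorm mnP N (d_supp k.+1)) _.
  apply: le_trans (ltW (nuP k)) _; rewrite -/(rho k).
  have -> : rho k.+1 * (2 * rho k) = rho k * rho k by rewrite /rho exprS; field.
  exact: lexx.
have b_lim eps : 0 < eps -> exists K, forall k, (K <= k)%N -> b k < eps.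
  move=> eps0; have [K KP] := half_pow_small (divr_gt0 eps0 (ltr0n R 2)).
  exists K.+1 => -[|k] //; rewrite ltnS => /KP /=.
  by rewrite ltr_pdivlMr // mulrC.
have [B B0 fB] := bdiag_bounded mnP zb b_lim.
pose F := bdiag z; pose W := gauge_space mnP F.
pose gn := @gauge_norm _ _ _ mnP F; pose g : W -> V := @gval _ _ _ mnP F.
have WP : opspace gn := gauge_opspace mnP B0 fB.
have gL : linear g := @gval_linear _ _ _ mnP F.
have gcb : cbmap gn mn g := gval_cb mnP B0 fB.
have gcpt : op_compact_map gn mn g.
  apply: (gval_op_compact mnP B0 fB (bdiag_seq_kelt mnP z_supp zb b_lim)).
  exact: bdiag_seq_eventually.
(* The partial sums of x have norm at most 2 over W, so this contributes [e / 8]. *)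
pose delta := e / 16; have delta0 : 0 < delta by rewrite divr_gt0.
have [psi [psicb [p [ev psifin]] psin]] := approx WP gcb gcpt delta0.
have psiL := psicb.1; have [Mp Mp0 psiM] := cb_bound WP psicb.
have zW k i j : z k i j \in gauge_pred mn F.
  have iN : (i < (maxn i j).+1)%N by rewrite ltnS leq_maxl.
  have jN : (j < (maxn i j).+1)%N by rewrite ltnS leq_maxr.
  apply/asboolP; apply: (gauge_finite_entry mnP (I := 'I_(maxn i j).+1)
    (w := fun a c => z k a c) (Ordinal iN) (Ordinal jN)).
  by exists 1; split; [exact: ler01 | apply: hull_Cl => //; apply: hull_block].
(* The increment lifted to W as [rho k] times a block of gauge at most 1: its norm there is
   summable. *)
pose dW k i j : W := (rho k)%:C *: (Subspace (zW k i j) : W).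
have gdW k i j : g (dW k i j) = d k i j.
  rewrite /dW (linear_funZ gL) -[g _]/(z k i j) /z scalerA -rmorphM /= divff ?gt_eqF //.
  by rewrite scale1r.
have dW_supp k : fsupp (dW k).
  have [N NP] := d_supp k; exists N => i j ij; apply: gval_inj.
  by rewrite -[LHS]/(g (dW k i j)) gdW NP // -[RHS]/(g 0) linear_fun0.
have dWn k N : trunc_norm gn N (dW k) <= rho k.
  rewrite /trunc_norm /dW nFZ // (cnorm_nneg (rho_ge0 k)) -[leRHS]mulr1.
  apply: (ler_wpM2l (rho_ge0 k)).
  rewrite (_ : nF _ _ = gn N (\matrix_(i, j) Subspace (zW k i j))).
    apply/(gauge_norm_leP B0 fB) => //.
    apply: (@eq_Cl _ _ _ _ _ _ (fun i j : 'I_N => z k i j)) => [i j|].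
      by rewrite mxE.
    by apply: hull_Cl => //; apply: hull_block.
  by rewrite mn_nF //; apply: eq_nF => i j; rewrite mxE.
pose X a c i j : W := \sum_(a <= k < c) dW k i j.
have Xn a c N : trunc_norm gn N (X a c) <= 2 * rho a.
  apply: le_trans (nF_sum WP _ _ _) _; apply: le_trans (geometric_tail _ _ c).
  by apply: ler_sum => k _; apply: dWn.
have gX K i j : g (X 0%N K.+1 i j) = x (nu K) i j.
  rewrite /X (linear_fun_sum gL) -sum_increments.
  by apply: eq_bigr => k _; rewrite gdW.
have [m [h0 [v [M [M0 h0M h0E]]]]] := finite_projection mnP ev.
pose psi_ i w := h0 i (psi w).
have psiE w : psi w = \sum_i psi_ i w *: v i.
  by have [c cE] := psifin w; rewrite /psi_ cE -[LHS](h0E c).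
pose Q i := M i * Mp.
have Q0 i : 0 <= Q i by rewrite mulr_ge0.
have psi_b i : bounded_functional gn (psi_ i) (Q i).
  have [hD hZ hb] := h0M i; split=> [u w|c w|w].
  - by rewrite /psi_ linear_funD // hD.
  - by rewrite /psi_ linear_funZ // hZ.
  apply: le_trans (hb _) _; rewrite -mulrA ler_wpM2l //.
  apply: le_trans (psiM _ (mx1 w)); apply/eqW; congr mn.
  by apply/matrixP => i' j'; rewrite !mxE.
pose P := \sum_i nrm mn (v i); pose PQ := \sum_i Q i * nrm mn (v i).
have P0 : 0 <= P by apply: sumr_ge0 => i _; apply: nrm_ge0.
have PQ0 : 0 <= PQ by apply: sumr_ge0 => i _; rewrite mulr_ge0 ?nrm_ge0.
have D1 : 0 < 32 * (PQ + 1) by rewrite mulr_gt0 // ltr_wpDl.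
(* The tail beyond [K0] has norm at most [2 * rho K0] over W, so any functionals with bounds [Q]
   send it below [e / 16]. The replacements [h] have these bounds too, so [K0] can be fixed before
   them. *)
have [K0 K0P] := half_pow_small (divr_gt0 e0 D1).
have [N0 N0P] : exists N0, forall i j, (N0 <= i)%N \/ (N0 <= j)%N -> X 0%N K0 i j = 0.
  have XS : fsupp (X 0%N K0).
    elim: K0 {K0P} => [|K IHK]; first by exists 0%N => i j _; rewrite /X big_geq.
    have [N NP] := fsuppD IHK (dW_supp K).
    by exists N => i j /NP <-; rewrite /X big_nat_recr.
  exact: XS.
have D2 : 0 < 8 * (P + 1) * (N0 * N0 + 1)%:R :> R.
  by rewrite !mulr_gt0 ?ltr_wpDl // ltr0n addn1.
(* The head has at most [N0 * N0] nonzero entries, each with error at most [eta * P], for a total of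
   [e / 8]. *)
pose eta := e / (8 * (P + 1) * (N0 * N0 + 1)%:R).
have eta0 : 0 < eta by rewrite divr_gt0.
pose ws (t : 'I_#|{: 'I_N0 * 'I_N0}|) : W := X 0%N K0 (enum_val t).1 (enum_val t).2.
have /boolp.choice[h hP] : forall i, exists h : V -> C, exists Mh : R,
  [/\ 0 <= Mh, bounded_functional mn h Mh,
      bounded_functional gn (fun u => h (g u)) (Q i) &
      forall j, cnorm (h (g (ws j)) - psi_ i (ws j)) <= eta].
  by move=> i; apply: (functional_approximation B0 fB ws (Q0 i) (psi_b i) eta0).
have /boolp.choice[Mh MhP] := hP.
have [Tcb Tfr] := finite_rank_sum_cb v (fun i => let: And4 a _ _ _ := MhP i in a)
  (fun i => let: And4 _ a _ _ := MhP i in a).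
pose T u := \sum_i h i u *: v i.
exists T; split=> //.
have [l lT] := knorm_exists mnP (cb_sub mnP Tcb (cb_id mn)) kx.
exists l; split=> //; apply: (@le_lt_trans _ _ (e / 2)); last first.
  by rewrite ltr_pdivrMr // mulr_natr mulr2n ltrDl.
(* The limit exists along the whole sequence, so it may be estimated along [nu], where x is a sum of
   increments; the maximum with [K0] ensures that the head is included. *)
apply: seq_cvg_le_frequently lT _ => K; exists (nu (maxn K K0)).
  by apply: leq_trans (leq_maxl _ _) (nu_ge _).
set L := maxn K K0; apply: (infnorm_le mnP) => N.
have XE i j : X 0%N L.+1 i j = X 0%N K0 i j + X K0 L.+1 i j.
  by rewrite /X -big_cat_nat //= leqW // leq_maxr.
(* The error splits into psi against the inclusion ([A1]), [h] against psi on the head ([A2]), and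
   the tail under [h] ([A3]) and under psi ([A4]); the bounds add up to [3 e / 8]. *)
pose A1 i j := psi (X 0%N L.+1 i j) - g (X 0%N L.+1 i j).
pose A2 i j := \sum_t (h t (g (X 0%N K0 i j)) - psi_ t (X 0%N K0 i j)) *: v t.
pose A3 i j := \sum_t h t (g (X K0 L.+1 i j)) *: v t.
pose A4 i j := \sum_t psi_ t (X K0 L.+1 i j) *: v t.
have hlin t u w : h t (u + w) = h t u + h t w.
  by have [_ [-> _ _] _ _] := MhP t.
have plin t u w : psi_ t (u + w) = psi_ t u + psi_ t w by have [-> _ _] := psi_b t.
have -> : trunc_norm mn N (fun i j => T (x (nu L) i j) - x (nu L) i j) =
    trunc_norm mn N (fun i j => A1 i j + (A2 i j + (A3 i j - A4 i j))).
  apply: eq_trunc_norm => i j _ _; rewrite -gX /A1 /A2 /A3 /A4 psiE /T.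
  rewrite -sumrB -!big_split /= [RHS]addrAC -big_split /=; congr (_ - _).
  apply: eq_bigr => t _; rewrite -scalerBl -!scalerDl; congr (_ *: _).
  by rewrite XE (linear_funD gL) hlin plin; ring.
apply: le_trans (trunc_normD mnP _ _ _) _.
have le1 : trunc_norm mn N A1 <= e / 8.
  have le := cb_nF (fun i j : 'I_N => X 0%N L.+1 i j)
    (fun n w => le_cbnorm_mul w WP (cb_sub mnP gcb psicb)).
  apply: (@le_trans _ _ (delta * 2)); last by apply/eqW; rewrite /delta; field.
  apply: le_trans (_ : delta * trunc_norm gn N (X 0%N L.+1) <= _); last first.
    apply: ler_wpM2l; first exact: ltW.
    by apply: le_trans (Xn _ _ _) _; rewrite /rho expr0 mulr1.
  apply: le_trans (ler_wpM2r (nF_ge0 WP _) (ltW psin)).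
  apply: le_trans le; rewrite /trunc_norm -(nFN mnP); apply/eqW/eq_nF => i j.
  by rewrite /A1 opprB.
have tail (q : 'I_m -> W -> C) : (forall t, bounded_functional gn (q t) (Q t)) ->
    trunc_norm mn N (fun i j => \sum_t q t (X K0 L.+1 i j) *: v t) <= e / 16.
  move=> qQ; apply: le_trans (nF_sum mnP _ _ _) _.
  apply: (@le_trans _ _ (\sum_t (Q t * nrm mn (v t)) * (2 * rho K0))).
    apply: ler_sum => t _.
    have qb := functional_opb WP (fun i j : 'I_N => X K0 L.+1 i j) (Q0 t) (qQ t).
    have Qn0 : 0 <= Q t * nF gn (fun i j : 'I_N => X K0 L.+1 i j).
      by rewrite mulr_ge0 ?nF_ge0.
    apply: le_trans (nF_rank1 mnP (v t) Qn0 qb) _; rewrite mulrAC.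
    by apply: ler_wpM2l; [rewrite mulr_ge0 ?nrm_ge0 | apply: Xn].
  rewrite -mulr_suml -/PQ.
  have := ltW (K0P K0 (leqnn _)); rewrite -/(rho K0) => rK.
  apply: (@le_trans _ _ ((PQ + 1) * (2 * (e / (32 * (PQ + 1)))))).
    apply: ler_pM => //; first by rewrite mulr_ge0.
      by rewrite lerDl.
    by rewrite ler_pM2l.
  by apply/eqW; field; rewrite gt_eqF // ltr_wpDl.
have le3 : trunc_norm mn N A3 <= e / 16.
  by apply: (tail (fun t w => h t (g w))) => t; have [] := MhP t.
have le4 : trunc_norm mn N A4 <= e / 16 by apply: tail.
have le2 : trunc_norm mn N A2 <= e / 8.
  have A2s : supp_in N0 A2.
    move=> i j /N0P X0; rewrite /A2 big1 // => t _; rewrite X0 linear_fun0 //.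
    have [_ [_ hZ _] _ _] := MhP t; have := hZ 0 0; rewrite scale0r mul0r => ->.
    by rewrite (functional0 (psi_b t)) subrr scale0r.
  apply: le_trans (trunc_norm_supp mnP _ A2s) _.
  apply: le_trans (nF_le_entries mnP _) _.
  apply: (@le_trans _ _ (\sum_(i < N0) \sum_(j < N0) eta * P)).
    apply: ler_sum => i _; apply: ler_sum => j _; rewrite /A2.
    apply: le_trans (nrm_sum mnP _ _ _) _; rewrite /P mulr_sumr; apply: ler_sum => t _.
    rewrite nrmZ // ler_wpM2r ?nrm_ge0 //.
    have [_ _ _ /(_ (enum_rank (i, j)))] := MhP t.
    by rewrite /ws enum_rankK.
  rewrite !sumr_const !card_ord -mulrnA -(mulr_natr (eta * P)).
  apply: (@le_trans _ _ (eta * (P + 1) * (N0 * N0 + 1)%:R)).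
    apply: ler_pM => //; first by rewrite mulr_ge0 // ltW.
      by rewrite ler_pM2l // lerDl.
    by rewrite ler_nat leq_addr.
  have n0 : (N0 * N0 + 1)%:R != 0 :> R by rewrite pnatr_eq0 addn1.
  have p0 : P + 1 != 0 by rewrite gt_eqF // ltr_wpDl.
  apply/eqW; rewrite /eta; move: (_%:R : R) n0 => n n0; field.
  by rewrite n0 p0.
have := trunc_normD mnP N A2 (fun i j => A3 i j - A4 i j).
have := trunc_normB mnP N A3 A4; lra.
Qed.

End Approximation.

Theorem theorem4p4 (R : realType) (V : lmodType R[i])
    (mnV : forall n, 'M[V]_n -> R) :
  opspace mnV ->
  (OAP mnV <->
   (forall (W : lmodType R[i]) (mnW : forall n, 'M[W]_n -> R),
      opspace mnW ->
      forall phi : W -> V,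
        cbmap mnW mnV phi -> op_compact_map mnW mnV phi ->
        forall e : R, 0 < e ->
          exists psi : W -> V,
            [/\ cbmap mnW mnV psi, finrank psi &
                cbnorm mnW mnV (fun w => phi w - psi w) < e])).
Proof.
move=> mnVP; split=> [oap W mnW mnWP phi phicb phic e e0|approx].
  exact: OAP_approximation oap phicb phic e e0.
apply: OAP_of_approximation => // x kx e e0.
exact: (approximation_on_element mnVP kx approx e0).
Qed.
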